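(* Let $(E,\mathcal{E})$ be a measurable space and let $Q\in\mathcal{T}(E,\mathcal{E})$ be a bounded positive kernel. Assume that there exist an integer $\ell\ge 1$, a probability measure $\nu\in\mathcal{P}$ and a function $\alpha\in\mathcal{H}_\nu$ such that $S=Q^\ell-T_{\nu,\alpha}\ge 0$ and $r(S)^{1/\ell}<r(Q)$. Then: (i) the operator $Q$ is quasi-compact on $\mathcal{B}$ and $r_e(Q)\le r(S)^{1/\ell}$; (ii) assume moreover that either $\ell=1$, or $\mathcal{E}$ is countably generated; then, if $\chi\in\mathcal{X}$ is such that $\|\chi\|\,r(S)^{1/\ell}<r(Q_\chi)$, the operator $Q_\chi$ is quasi-compact on $\mathcal{B}$ and $r_e(Q_\chi)\le\|\chi\|\,r(S)^{1/\ell}$.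
   Context: A bounded positive kernel on $(E,\mathcal{E})$ is a function $Q:E\times\mathcal{E}\to\mathbb{R}_+$ such that $Q(\cdot,A)$ is $\mathcal{E}$-measurable for every $A\in\mathcal{E}$, $Q(x,\cdot)$ is a positive measure for every $x\in E$, and $\sup_{x}Q(x,E)<+\infty$; $\mathcal{T}(E,\mathcal{E})$ is the set of these. $\mathcal{B}$ is the Banach space of bounded measurable complex functions on $E$ with the supremum norm $\|\cdot\|$. A kernel $Q\in\mathcal{T}(E,\mathcal{E})$ is identified with the bounded operator $Qf(x)=\int_E f(y)\,Q(x,dy)$ on $\mathcal{B}$; $Q^\ell$ is the $\ell$-th power. For two kernels, $K_1-K_2\ge0$ means $K_1(x,A)\ge K_2(x,A)$ for all $(x,A)\in E\times\mathcal{E}$. $\mathcal{X}$ is the space of bounded measurable complex functions on $E\times E$, with $\|\chi\|=\sup_{E\times E}|\chi|$, and $Q_\chi f(x)=\int_E f(y)\chi(x,y)\,Q(x,dy)$ for $f\in\mathcal{B}$. $\mathcal{P}$ is the set of probability measures on $(E,\mathcal{E})$. For $\nu\in\mathcal{P}$, $\mathcal{H}_\nu$ is the set of nonnegative $\mathcal{E}\otimes\mathcal{E}$-measurable functions $\alpha$ on $E\times E$ such that $\lim_{m\to+\infty}\sup_{x\in E}\int_{\{y:\alpha(x,y)\ge m\}}\alpha(x,y)\,d\nu(y)=0$, and $T_{\nu,\alpha}(x,A)=\int_A\alpha(x,y)\,d\nu(y)$. $r(\cdot)$ is the spectral radius of a bounded operator on $\mathcal{B}$. The essential spectral radius $r_e(T)$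 of a bounded operator $T$ on a Banach space $\mathcal{B}$ is the infimum of $r(T)$ and of the real numbers $\rho\ge0$ such that $\mathcal{B}=F_\rho\oplus H_\rho$ where $F_\rho,H_\rho$ are $T$-invariant subspaces, $H_\rho$ is closed, $r(T_{|H_\rho})<\rho$, $\dim F_\rho<+\infty$ and all eigenvalues of $T_{|F_\rho}$ have modulus $\ge\rho$. $T$ is quasi-compact if $r_e(T)<r(T)$. *)

(* Defs.v *)
From HB Require Import structures.
From mathcomp Require Import all_boot all_order all_algebra.
From mathcomp Require Import all_classical all_reals all_analysis.
From mathcomp Require Import measurable_realfun complex.

Set Implicit Arguments.
Unset Strict Implicit.
Unset Printing Implicit Defensive.

Import Order.TTheory GRing.Theory Num.Theory.
Import numFieldNormedType.Exports.
Import Normc.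

(* Not the ['Re] and ['Im] of [numClosedFieldType], which are [R[i]]-valued. *)
Local Notation Re := complex.Re.
Local Notation Im := complex.Im.

Local Open Scope classical_set_scope.
Local Open Scope ring_scope.
Local Open Scope complex_scope.

Section spectral.
Context {R : realType} {V : normedModType R[i]}.
Implicit Types (T U : V -> V) (F H : set V).

Definition is_subspace H :=
  H 0 /\ forall (a : R[i]) u v, H u -> H v -> H (a *: u + v).

Definition bounded_linear_on H U :=
  [/\ forall v, H v -> H (U v),
      forall (a : R[i]) u v, H u -> H v -> U (a *: u + v) = a *: U u + U v
    & exists M : R, forall v, H v -> `|U v| <= M%:C * `|v| ].

(* Spectrum of the restriction of [T] to the [T]-invariant subspace [H]:
   the [z] such that [z - T] has no bounded inverse on [H]. *)
Definition spectrum_on H T : set R[i] :=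
  [set z | ~ exists U, bounded_linear_on H U /\
     forall v, H v -> U (z *: v - T v) = v /\ z *: U v - T (U v) = v].

(* [sup set0 = 0]: the operator on the zero space has spectral radius 0. *)
Definition spectral_radius_on H T : R := sup [set normc z | z in spectrum_on H T].

Definition spectral_radius T : R := spectral_radius_on setT T.

Definition finite_dimensional F :=
  exists (n : nat) (b : 'I_n -> V),
    F = [set v | exists c : 'I_n -> R[i], v = \sum_(i < n) c i *: b i].

Definition direct_sum F H :=
  (forall v, exists f h, [/\ F f, H h & v = f + h]) /\ F `&` H = [set 0].

Definition invariant H T := forall v, H v -> H (T v).

Definition ess_decomposition T (rho : R) F H :=
  [/\ is_subspace F, is_subspace H, invariant F T & invariant H T] /\
  [/\ direct_sum F H,
      closed H,
      spectral_radius_on H T < rho,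
      finite_dimensional F
    & forall (z : R[i]) v, F v -> v != 0 -> T v = z *: v -> rho <= normc z].

Definition ess_spectral_radius T : R :=
  inf (spectral_radius T |`
       [set rho | 0 <= rho /\ exists F H, ess_decomposition T rho F H]).

Definition quasi_compact T := ess_spectral_radius T < spectral_radius T.

End spectral.

Section bounded_measurable.
Context (R : realType) d (E : measurableType d).

Definition cmeasurable (f : E -> R[i]) :=
  measurable_fun setT (fun x => Re (f x)) /\
  measurable_fun setT (fun x => Im (f x)).

Definition cbounded (f : E -> R[i]) := exists M : R, forall x, normc (f x) <= M.

(* [R[i]^o] selects the structure of [R[i]] as a vector space over itself. *)
Definition bmpred : {pred E -> R[i]^o} :=
  fun f => `[< cmeasurable f /\ cbounded f >].

Lemma bmpredP (f : E -> R[i]) :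
  reflect (cmeasurable f /\ cbounded f) (f \in bmpred).
Proof. exact: asboolP. Qed.

Lemma ReD (a b : R[i]) : Re (a + b) = Re a + Re b.
Proof. by case: a; case: b. Qed.

Lemma ImD (a b : R[i]) : Im (a + b) = Im a + Im b.
Proof. by case: a; case: b. Qed.

Lemma ReM (a b : R[i]) : Re (a * b) = Re a * Re b - Im a * Im b.
Proof. by case: a; case: b. Qed.

Lemma ImM (a b : R[i]) : Im (a * b) = Re a * Im b + Im a * Re b.
Proof. by case: a; case: b. Qed.

Lemma cmeasurable_cst (a : R[i]) : cmeasurable (fun=> a).
Proof. by split; exact: measurable_cst. Qed.

Lemma cmeasurableD f g : cmeasurable f -> cmeasurable g ->
  cmeasurable (fun x => f x + g x).
Proof.
move=> [f1 f2] [g1 g2]; split.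
- by under eq_fun do rewrite ReD; exact: measurable_funD.
- by under eq_fun do rewrite ImD; exact: measurable_funD.
Qed.

Lemma cmeasurableM f g : cmeasurable f -> cmeasurable g ->
  cmeasurable (fun x => f x * g x).
Proof.
move=> [f1 f2] [g1 g2]; split.
- by under eq_fun do rewrite ReM; apply: measurable_funB; exact: measurable_funM.
- by under eq_fun do rewrite ImM; apply: measurable_funD; exact: measurable_funM.
Qed.

Lemma normc_ge0 (z : R[i]) : 0 <= normc z.
Proof. by case: z => a b; exact: sqrtr_ge0. Qed.

Lemma cbounded_cst (a : R[i]) : cbounded (fun=> a).
Proof. by exists (normc a). Qed.

Lemma cboundedD f g : cbounded f -> cbounded g -> cbounded (fun x => f x + g x).
Proof.
move=> [M fM] [N gN]; exists (M + N) => x.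
by rewrite (le_trans (le_normcD _ _))// lerD.
Qed.

Lemma cboundedM f g : cbounded f -> cbounded g -> cbounded (fun x => f x * g x).
Proof.
move=> [M fM] [N gN]; exists (M * N) => x.
by rewrite normcM ler_pM// normc_ge0.
Qed.

Lemma bmpredD (f g : E -> R[i]) : f \in bmpred -> g \in bmpred ->
  (fun x => f x + g x) \in bmpred.
Proof.
move=> /bmpredP[mf bf] /bmpredP[mg bg]; apply/bmpredP.
by split; [exact: cmeasurableD|exact: cboundedD].
Qed.

Lemma bmpredM (f g : E -> R[i]) : f \in bmpred -> g \in bmpred ->
  (fun x => f x * g x) \in bmpred.
Proof.
move=> /bmpredP[mf bf] /bmpredP[mg bg]; apply/bmpredP.
by split; [exact: cmeasurableM|exact: cboundedM].
Qed.

Lemma bmpred_cst (a : R[i]) : (fun=> a) \in bmpred.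
Proof. by apply/bmpredP; split; [exact: cmeasurable_cst|exact: cbounded_cst]. Qed.

Lemma bmpred_submod : submod_closed bmpred.
Proof.
split=> [|a f g bf bg]; first exact: (bmpred_cst 0).
exact: bmpredD (bmpredM (bmpred_cst a) bf) bg.
Qed.

HB.instance Definition _ :=
  GRing.isSubmodClosed.Build R[i] (E -> R[i]^o) bmpred bmpred_submod.

Record bmfun := BMFun { bmval :> E -> R[i]^o ; bmvalP : bmval \in bmpred }.

HB.instance Definition _ := [isSub for bmval].
HB.instance Definition _ := [Choice of bmfun by <:].
HB.instance Definition _ := [SubChoice_isSubLmodule of bmfun by <:].

Definition supnorm (f : bmfun) : R := sup [set normc (f x) | x in setT].

Lemma supnorm_ub (f : bmfun) x : normc (f x) <= supnorm f.
Proof.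
have /bmpredP[_ [M fM]] := bmvalP f.
apply: ub_le_sup; last by exists x.
by exists M => _ [y _ <-].
Qed.

Lemma supnorm_le (f : bmfun) M : (forall x, normc (f x) <= M) -> supnorm f <= M.
Proof.
move=> fM; apply: ge_sup; first by exists (normc (f point)), point.
by move=> _ [x _ <-].
Qed.

Let norm (f : bmfun) : R[i] := (supnorm f)%:C.

Let ler_normD f g : norm (f + g) <= norm f + norm g.
Proof.
rewrite /norm -rmorphD/= lecR; apply: supnorm_le => x.
by rewrite (le_trans (le_normcD _ _))// lerD ?supnorm_ub.
Qed.

Let normrZ (a : R[i]) f : norm (a *: f) = `|a| * norm f.
Proof.
have -> : `|a| = (normc a)%:C by case: a.
rewrite /norm -rmorphM/=; congr _%:C; apply/eqP; rewrite eq_le; apply/andP; split.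
  apply: supnorm_le => x; rewrite [X in normc X](_ : _ = a * f x)//.
  by rewrite normcM ler_wpM2l ?normc_ge0 ?supnorm_ub.
have [->|a0] := eqVneq a 0.
  by rewrite normc0 mul0r (le_trans (normc_ge0 ((0 *: f) point)))// supnorm_ub.
have na0 : 0 < normc a.
  by rewrite lt_neqAle normc_ge0 eq_sym andbT; apply: contra a0 => /eqP/eq0_normc ->.
rewrite -ler_pdivlMl//; apply: supnorm_le => x.
by rewrite ler_pdivlMl// -normcM (supnorm_ub (a *: f) x).
Qed.

Let normr0_eq0 f : norm f = 0 -> f = 0.
Proof.
move=> /(congr1 (@Re R))/= f0; apply: val_inj; apply/funext => x.
apply: eq0_normc; apply/eqP; rewrite eq_le normc_ge0 andbT.
by rewrite -f0 (supnorm_ub f x).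
Qed.

HB.instance Definition _ :=
  Lmodule_isNormed.Build R[i] bmfun ler_normD normrZ normr0_eq0.

Lemma bmnormE (f : bmfun) : `|f| = (supnorm f)%:C.
Proof. by []. Qed.

End bounded_measurable.

Arguments bmpred {R d E}.

Section kernel_operator.
Context {R : realType} {d : measure_display} {E : measurableType d}.
Implicit Types (Q S : R.-fker E ~> E).

Definition cintegral (mu : {measure set E -> \bar R}) (f : E -> R[i]) : R[i] :=
  Complex (\int[mu]_y Re (f y)) (\int[mu]_y Im (f y)).

Lemma measurable_Rintegral_kernel Q (g : E * E -> R) : measurable_fun setT g ->
  measurable_fun setT (fun x => \int[Q x]_y g (x, y)).
Proof.
move=> mg; have mg' : measurable_fun setT (EFin \o g) by exact/measurable_EFinP.
apply: (@measurableT_comp _ _ _ _ _ _ (@fine R)) => //.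
under eq_fun do rewrite integralE.
apply: emeasurable_funB.
- rewrite [X in measurable_fun _ X](_ : _ =
      fun x => \int[Q x]_y (EFin \o g)^\+ (x, y))%E; last first.
    by apply/funext => x; apply: eq_integral => y _; rewrite !funeposE.
  have := measurable_fun_integral_finite_kernel (EFin \o g)^\+%E Q.
  by apply => //; exact: measurable_funepos.
- rewrite [X in measurable_fun _ X](_ : _ =
      fun x => \int[Q x]_y (EFin \o g)^\- (x, y))%E; last first.
    by apply/funext => x; apply: eq_integral => y _; rewrite !funenegE.
  have := measurable_fun_integral_finite_kernel (EFin \o g)^\-%E Q.
  by apply => //; exact: measurable_funeneg.
Qed.

Lemma bounded_Rintegral_kernel Q (g : E * E -> R) (M : R) :
  measurable_fun setT g -> (forall z, `|g z| <= M) ->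
  exists N : R, forall x, `|\int[Q x]_y g (x, y)| <= N.
Proof.
move=> mg gM; have [r Qr] := measure_uub Q; exists (M * r) => x.
have M0 : 0 <= M by exact: le_trans (gM (point, point)).
have mgx : measurable_fun setT (fun y => g (x, y)) by exact: measurableT_comp.
have : (`|\int[Q x]_y (g (x, y))%:E| <= (M * r)%:E)%E.
  apply: (@le_trans _ _ (M%:E * Q x setT)%E).
    have mgx' : measurable_fun setT (fun y => (g (x, y))%:E) by exact/measurable_EFinP.
    apply: le_trans (le_abse_integral _ measurableT mgx') _.
    apply: integral_le_bound => //.
    by apply: aeW => y _; rewrite lee_fin.
  by rewrite EFinM lee_wpmul2l// ltW.
rewrite /Rintegral; by case: integral => [s||] /=; rewrite ?lee_fin// leNgt ltry.
Qed.

(* For bounded measurable [h], [x |-> \int h(x,y) Q(x,dy)] is bounded and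
   measurable; this makes [kop] and [kopx] below operators on [bmfun]. *)
Lemma cintegral_kernel_bm Q (h : E * E -> R[i]) : h \in bmpred ->
  (fun x => cintegral (Q x) (fun y => h (x, y))) \in bmpred.
Proof.
move=> /bmpredP[[mr mi] [M hM]]; apply/bmpredP; split.
  by split; [exact: measurable_Rintegral_kernel Q _ mr|
            exact: measurable_Rintegral_kernel Q _ mi].
have lr z : `|Re (h z)| <= M.
  rewrite (le_trans _ (hM z))//; case: (h z) => a b /=.
  by rewrite -sqrtr_sqr ler_wsqrtr// lerDl sqr_ge0.
have li z : `|Im (h z)| <= M.
  rewrite (le_trans _ (hM z))//; case: (h z) => a b /=.
  by rewrite -sqrtr_sqr ler_wsqrtr// lerDr sqr_ge0.
have [N1 h1] := bounded_Rintegral_kernel Q mr lr.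
have [N2 h2] := bounded_Rintegral_kernel Q mi li.
exists (Num.sqrt (N1 ^+ 2 + N2 ^+ 2)) => x /=; rewrite ler_wsqrtr//.
by rewrite lerD// -[leLHS]real_normK ?num_real// ler_pXn2r ?nnegrE//
  (le_trans (normr_ge0 _) (h1 x), le_trans (normr_ge0 _) (h2 x)).
Qed.

Lemma bm_snd (f : bmfun R E) : (fun z : E * E => f z.2) \in bmpred.
Proof.
have /bmpredP[[mr mi] [M fM]] := bmvalP f; apply/bmpredP; split; last by exists M.
by split; [apply: (measurableT_comp mr)|apply: (measurableT_comp mi)].
Qed.

Definition kop Q (f : bmfun R E) : bmfun R E :=
  BMFun (cintegral_kernel_bm Q (bm_snd f)).

Definition kopx Q (chi : bmfun R (E * E)%type) (f : bmfun R E) : bmfun R E :=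
  BMFun (cintegral_kernel_bm Q (bmpredM (bm_snd f) (bmvalP chi))).

Lemma kopE Q f x : kop Q f x = cintegral (Q x) f.
Proof. by []. Qed.

Lemma kopxE Q chi f x :
  kopx Q chi f x = cintegral (Q x) (fun y => f y * chi (x, y)).
Proof. by []. Qed.

Local Open Scope ereal_scope.

(* The kernel Q^n, with Q^0 the Dirac kernel. *)
Fixpoint kpow Q (n : nat) (x : E) (A : set E) : \bar R :=
  if n is n'.+1 then \int[Q x]_y kpow Q n' y A else \d_x A.

(* [alpha] belongs to H_nu. *)
Definition unif_integrable (nu : probability E R) (alpha : E * E -> R) :=
  [/\ forall z, (0 <= alpha z)%R,
      measurable_fun setT alpha
    & ereal_sup [set \int[nu]_(y in [set y | (m%:R <= alpha (x, y))%R])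
                       (alpha (x, y))%:E | x in [set: E]] @[m --> \oo] --> 0].

(* The kernel T_{nu,alpha}. *)
Definition acker (nu : probability E R) (alpha : E * E -> R)
  (x : E) (A : set E) : \bar R := \int[nu]_(y in A) (alpha (x, y))%:E.

End kernel_operator.

Definition countably_generated d (E : measurableType d) :=
  exists2 G : set (set E), countable G & measurable = <<s G >>.

(* Main.v *)
Require Import Defs.
From HB Require Import structures.
From mathcomp Require Import all_boot all_order all_algebra.
From mathcomp Require Import all_classical all_reals all_analysis.
From mathcomp Require Import measurable_realfun complex ring lra.

(** Write [Q^l = S' + N], where [N] has the truncated density [beta = alpha 1_{alpha < m}]
    with respect to [nu] and [S' = S + (tail)].  If [r(S) < lam], then
    [h = (lam - S)^-1 1] satisfies [h >= lam^-1], and since the tail is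
    uniformly small, [S' h <= lam h]: the powers of [S'] grow at most like [lam^n].

    Let [T] be [Q] or [Q_chi], [U = T^l] and [V = Q^l]; then [|U f| <= c V
    |f|] with [c = 1] or [c = ||chi||^l]. Hence [U] is an integral operator [V
    (f q(x, .))(x)] for a density [q]; for countably generated [E] this [q] is
    the L^1 limit of the martingale of ratios [U 1_C / V 1_C] over finite
    partitions, and only the approximations are ever used as functions on [E *
    E]. Correspondingly [U = A + B] with [|A| <= c S'] and [|B| <= c N].

    The operators [B U^j B] are norm limits of finite-rank operators: for a kernel
    with bounded density with respect to the fixed measure [nu], approximation of
    the right-hand factor in mean is enough.  Hence [U^n] is, up to
    finite-rank operators and small errors, [A^n] plus the words
    [A^k B A^(n-1-k)], of norm [O(n (c lam)^(n-1))].  Finally, if [T^N] is a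
    finite-rank operator plus an operator of small norm, Fredholm theory and a
    counting argument for eigenvalues outside a disc give the decomposition
    defining the essential spectral radius. *)

Set Implicit Arguments.
Unset Strict Implicit.
Unset Printing Implicit Defensive.

Import Order.TTheory GRing.Theory Num.Theory.
Import numFieldNormedType.Exports.
Import Normc.

Local Notation Re := complex.Re.
Local Notation Im := complex.Im.

Local Open Scope classical_set_scope.
Local Open Scope ring_scope.
Local Open Scope complex_scope.

(** For the supremum norm, an operator with a bounded density against [nu] is in general not a norm
    limit of finite-rank operators, so a single letter [B] cannot be discarded. Two can: the left
    [B] bounds the supremum norm by one integral that does not depend on the point, and for that
    integral it is enough to approximate the right [B] in mean. Words with one [B] survive, but
    there are only [n] of them. A spectral radius gives asymptotic information, whereas truncating
    [alpha] perturbs [S] itself. The equation [lam h - S h = 1] makes the information pointwise and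
    leaves a slack of 1 for the tail. The inequality [S' h <= lam h] also passes to every operator
    dominated by [c S'], which a bare spectral radius of [S'] would not show so directly. The
    decomposition asks for a spectral radius strictly below [rho] on [H] and for eigenvalues of
    modulus at least [rho] on [F]. A radius therefore has to be found with a gap just below it; this
    is why the chains come with two radii [r1 < r2]. No contour integral is used: the projection
    comes from linear algebra on a polynomial in a power of [T]. *)

Section linear_maps.
Context {R : realType}.
Implicit Types U V W : normedModType R[i].

(* The norm of a normed space over [R[i]] is itself [R[i]]-valued. *)
Definition nm V (v : V) : R := Re `|v|.

Lemma nmE V (v : V) : `|v| = (nm v)%:C.
Proof.
by rewrite /nm; move: (normr_ge0 v); case: `|v| => a b; rewrite lecE/= => /andP[/eqP -> _].
Qed.

Lemma nm_ge0 V (v : V) : 0 <= nm v.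
Proof. by rewrite -(@lecR R) -nmE normr_ge0. Qed.

Lemma nmD V (u v : V) : nm (u + v) <= nm u + nm v.
Proof. by rewrite -lecR rmorphD/= -!nmE ler_normD. Qed.

Lemma nmZ V (a : R[i]) (v : V) : nm (a *: v) = normc a * nm v.
Proof.
have h : (nm (a *: v))%:C = (normc a * nm v)%:C.
  by rewrite rmorphM/= -!nmE normrZ; congr (_ * _); case: a.
exact: (congr1 (@Re R) h).
Qed.

Lemma nm0 V : nm (0 : V) = 0.
Proof. by rewrite /nm normr0. Qed.

Lemma nmN V (v : V) : nm (- v) = nm v.
Proof. by rewrite /nm normrN. Qed.

Lemma nmB V (u v : V) : nm (u - v) <= nm u + nm v.
Proof. by rewrite -(nmN v) nmD. Qed.

Lemma nm_eq0 V (v : V) : nm v = 0 -> v = 0.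
Proof. by move=> v0; apply/eqP; rewrite -normr_eq0 nmE v0. Qed.

Lemma nm_gt0 V (v : V) : v != 0 -> 0 < nm v.
Proof.
by move=> v0; rewrite lt_neqAle nm_ge0 andbT eq_sym; apply: contra v0 => /eqP/nm_eq0 ->.
Qed.

Lemma nm_sum V n (u : 'I_n -> V) : nm (\sum_(i < n) u i) <= \sum_(i < n) nm (u i).
Proof.
elim/big_ind2 : _ => [|x a y b xa yb|//]; first by rewrite nm0.
by rewrite (le_trans (nmD _ _))// lerD.
Qed.

Lemma normc_realC (a : R) : normc a%:C = `|a|.
Proof. by rewrite /= expr0n/= addr0 sqrtr_sqr. Qed.

Lemma normcX (z : R[i]) n : normc (z ^+ n) = normc z ^+ n.
Proof. by elim: n => [|n ih]; rewrite ?normc1// !exprS normcM ih. Qed.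

Definition lin V W (T : V -> W) :=
  forall (a : R[i]) u v, T (a *: u + v) = a *: T u + T v.

Section lin_theory.
Context V W (T : V -> W) (lT : lin T).

Lemma linD u v : T (u + v) = T u + T v.
Proof. by rewrite -[u in LHS]scale1r lT scale1r. Qed.

Lemma lin0 : T 0 = 0.
Proof. by apply: (addrI (T 0)); rewrite -linD !addr0. Qed.

Lemma linZ a u : T (a *: u) = a *: T u.
Proof. by rewrite -[a *: u]addr0 lT lin0 addr0. Qed.

Lemma linN u : T (- u) = - T u.
Proof. by rewrite -scaleN1r linZ scaleN1r. Qed.

Lemma linB u v : T (u - v) = T u - T v.
Proof. by rewrite linD linN. Qed.

Lemma lin_sum I (r : seq I) (P : pred I) (u : I -> V) :
  T (\sum_(i <- r | P i) u i) = \sum_(i <- r | P i) T (u i).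
Proof. by elim/big_rec2 : _ => [|i x y _ <-]; rewrite ?lin0 ?linD. Qed.

End lin_theory.

Lemma lin_comp U V W (S : V -> W) (T : U -> V) :
  lin S -> lin T -> lin (fun v => S (T v)).
Proof. by move=> lS lT a u v; rewrite lT lS. Qed.

Lemma lin_iter V (T : V -> V) n : lin T -> lin (iter n T).
Proof. by move=> lT a u v; elim: n => //= n ->; rewrite lT. Qed.

Definition bdlin V W (T : V -> W) :=
  lin T /\ exists M : R, forall v, nm (T v) <= M * nm v.

Lemma bdlin_ub V W (T : V -> W) : bdlin T ->
  exists2 M : R, 0 < M & forall v, nm (T v) <= M * nm v.
Proof.
move=> [_ [M TM]]; exists (`|M| + 1) => [|v]; first by rewrite ltr_wpDl.
rewrite (le_trans (TM v))// ler_wpM2r ?nm_ge0//.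
by rewrite (le_trans (ler_norm M))// lerDl.
Qed.

Lemma bdlin_id V : bdlin (@id V).
Proof. by split=> //; exists 1 => v; rewrite mul1r. Qed.

Lemma bdlin0 V W : bdlin (fun _ : V => 0 : W).
Proof.
split=> [a u v|]; first by rewrite scaler0 addr0.
by exists 0 => v; rewrite nm0 mul0r.
Qed.

Lemma bdlin_comp U V W (S : V -> W) (T : U -> V) :
  bdlin S -> bdlin T -> bdlin (fun v => S (T v)).
Proof.
move=> bS bT; split; first exact: lin_comp bS.1 bT.1.
have [M M0 SM] := bdlin_ub bS; have [N N0 TN] := bdlin_ub bT.
exists (M * N) => v; rewrite (le_trans (SM _))// -mulrA ler_wpM2l//.
exact: ltW.
Qed.

Lemma bdlinD V W (S T : V -> W) : bdlin S -> bdlin T -> bdlin (fun v => S v + T v).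
Proof.
move=> [lS [M SM]] [lT [N TN]]; split=> [a u v|].
  by rewrite lS lT scalerDr addrACA.
by exists (M + N) => v; rewrite mulrDl (le_trans (nmD _ _))// lerD.
Qed.

Lemma bdlinZ V W a (T : V -> W) : bdlin T -> bdlin (fun v => a *: T v).
Proof.
move=> [lT [M TM]]; split=> [b u v|].
  by rewrite lT scalerDr !scalerA mulrC.
exists (normc a * M) => v.
by rewrite nmZ -mulrA ler_wpM2l// Defs.normc_ge0.
Qed.

Lemma bdlinN V W (T : V -> W) : bdlin T -> bdlin (fun v => - T v).
Proof.
move=> bT; rewrite [X in bdlin X](_ : _ = fun v => -1 *: T v).
  exact: bdlinZ.
by apply/funext => v; rewrite scaleN1r.
Qed.

Lemma bdlinB V W (S T : V -> W) : bdlin S -> bdlin T -> bdlin (fun v => S v - T v).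
Proof. by move=> bS bT; apply: bdlinD => //; exact: bdlinN. Qed.

Lemma bdlin_sum V W n (T : 'I_n -> V -> W) :
  (forall i, bdlin (T i)) -> bdlin (fun v => \sum_(i < n) T i v).
Proof.
elim: n T => [T _|n ih T bT].
  rewrite [X in bdlin X](_ : _ = fun=> 0); first exact: bdlin0.
  by apply/funext => v; rewrite big_ord0.
rewrite [X in bdlin X](_ : _ = fun v => \sum_(i < n) T (widen_ord (leqnSn n) i) v
    + T ord_max v); first by apply: bdlinD => //; exact: ih.
by apply/funext => v; rewrite big_ord_recr.
Qed.

Lemma bdlin_iter V (T : V -> V) n : bdlin T -> bdlin (iter n T).
Proof.
move=> bT; elim: n => [|n ih]; first exact: bdlin_id.
exact: (bdlin_comp bT ih).
Qed.

Lemma bdlin_rank1 V W (phi : V -> R[i]^o) (e : W) :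
  bdlin phi -> bdlin (fun v => phi v *: e).
Proof.
move=> bphi; have [M M0 phiM] := bdlin_ub bphi; split=> [a u v|].
  by rewrite bphi.1 scalerDl -scalerA.
by exists (M * nm e) => v; rewrite nmZ mulrAC ler_wpM2r ?nm_ge0// phiM.
Qed.

End linear_maps.

(** * Finite-rank perturbations of invertible operators and the Neumann series *)

Section fredholm.
Context {R : realType} {V : normedModType R[i]}.
Implicit Types (A B F T W : V -> V).

Definition invertible A :=
  exists B, [/\ bdlin B, forall v, B (A v) = v & forall v, A (B v) = v].

Definition finite_rank F :=
  exists m (e : 'I_m -> V) (phi : 'I_m -> V -> R[i]^o),
    (forall i, bdlin (phi i)) /\ forall v, F v = \sum_(i < m) phi i v *: e i.

Definition fredholm A := exists A0 F,
  [/\ bdlin A0, invertible A0, finite_rank F & forall v, A v = A0 v + F v].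

Lemma finite_rank_bdlin F : finite_rank F -> bdlin F.
Proof.
move=> [m [e [phi [bphi FE]]]].
rewrite (_ : F = fun v => \sum_(i < m) phi i v *: e i); last exact/funext.
by apply: bdlin_sum => i; exact: bdlin_rank1.
Qed.

Lemma fredholm_bdlin A : fredholm A -> bdlin A.
Proof.
move=> [A0 [F [bA0 _ /finite_rank_bdlin bF AE]]].
by rewrite (_ : A = fun v => A0 v + F v); [exact: bdlinD|exact/funext].
Qed.

Lemma finite_rank0 : finite_rank (fun=> 0).
Proof.
exists 0%N, (fun=> 0), (fun=> fun=> 0); split=> [i|v]; first exact: bdlin0.
by rewrite big_ord0.
Qed.

Lemma finite_rankD F F' : finite_rank F -> finite_rank F' ->
  finite_rank (fun v => F v + F' v).
Proof.
move=> [m [e [phi [bphi FE]]]] [m' [e' [phi' [bphi' FE']]]].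
exists (m + m')%N.
exists (fun i => match fintype.split i with inl j => e j | inr j => e' j end).
exists (fun i => match fintype.split i with inl j => phi j | inr j => phi' j end).
split=> [i|v]; first by case: (fintype.split i).
rewrite big_split_ord/= FE FE'; congr (_ + _); apply: eq_bigr => i _.
  by rewrite (unsplitK (inl i)).
by rewrite (unsplitK (inr i)).
Qed.

Lemma finite_rank_compl B F : bdlin B -> finite_rank F ->
  finite_rank (fun v => B (F v)).
Proof.
move=> bB [m [e [phi [bphi FE]]]]; exists m, (B \o e), phi; split=> // v.
by rewrite FE (lin_sum bB.1); apply: eq_bigr => i _; rewrite (linZ bB.1).
Qed.

Lemma finite_rank_compr B F : bdlin B -> finite_rank F ->
  finite_rank (fun v => F (B v)).
Proof.
move=> bB [m [e [phi [bphi FE]]]].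
exists m, e, (fun i v => phi i (B v)); split=> // i.
exact: bdlin_comp.
Qed.

Lemma finite_rankN F : finite_rank F -> finite_rank (fun v => - F v).
Proof. by apply: (finite_rank_compl (B := fun v => - v)); exact: bdlinN (bdlin_id V). Qed.

Lemma invertible_id : invertible id.
Proof. by exists id; split=> //; exact: bdlin_id. Qed.

Lemma invertible_comp A B : invertible A -> invertible B ->
  invertible (fun v => A (B v)).
Proof.
move=> [A' [bA' AK AK']] [B' [bB' BK BK']]; exists (fun v => B' (A' v)); split.
- exact: bdlin_comp.
- by move=> v; rewrite AK BK.
- by move=> v; rewrite BK' AK'.
Qed.

Lemma fredholm_id : fredholm id.
Proof.
exists id, (fun=> 0); split; [exact: bdlin_id|exact: invertible_id|
  exact: finite_rank0|by move=> v; rewrite addr0].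
Qed.

Lemma fredholm_comp A B : fredholm A -> fredholm B -> fredholm (fun v => A (B v)).
Proof.
move=> [A0 [F [bA0 iA0 fF AE]]] [B0 [G [bB0 iB0 fG BE]]].
exists (fun v => A0 (B0 v)), (fun v => A0 (G v) + F (B0 v + G v)); split.
- exact: bdlin_comp.
- exact: invertible_comp.
- apply: finite_rankD; first exact: finite_rank_compl.
  by apply: (finite_rank_compr (B := fun v => B0 v + G v)) => //; apply: bdlinD => //;
    exact: finite_rank_bdlin.
- by move=> v; rewrite AE BE (linD bA0.1) addrA.
Qed.

(** The lower bound takes the place of the open mapping theorem: it gives injectivity and the bound
    [c^-1] for the inverse. *)
Lemma invertible_bij A (c : R) : lin A -> 0 < c ->
  (forall v, c * nm v <= nm (A v)) -> (forall w, exists v, A v = w) ->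
  invertible A.
Proof.
move=> lA c0 Ac sA; pose B w := projT1 (cid (sA w)).
have AB w : A (B w) = w by rewrite /B; case: cid.
have injA u v : A u = A v -> u = v.
  move=> uv; apply/eqP; rewrite -subr_eq0; apply/eqP/nm_eq0/eqP.
  rewrite eq_le nm_ge0 andbT -(ler_pM2l c0) mulr0.
  by rewrite (le_trans (Ac _))// (linB lA) uv subrr nm0.
exists B; split=> // [|v]; last exact: injA.
split=> [a u v|]; first by apply: injA; rewrite lA !AB.
exists c^-1 => v; rewrite -(ler_pM2l c0) mulrA divff ?gt_eqF// mul1r.
by rewrite (le_trans (Ac _))// AB.
Qed.

(** Completeness in the form that the Neumann series uses: a series with geometric terms has a sum,
    described by its tail bounds instead of a limit. *)
Definition geom_complete := forall (u : nat -> V) (C q : R), 0 <= q -> q < 1 ->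
  (forall n, nm (u n) <= C * q ^+ n) ->
  exists s, forall n, nm (s - \sum_(i < n) u i) <= C * q ^+ n / (1 - q).

Lemma le_geom0 (C q x : R) : 0 <= q -> q < 1 -> (forall n, x <= C * q ^+ n) -> x <= 0.
Proof.
move=> q0 q1 xC; have : (fun n => C * q ^+ n) @ \oo --> C * 0.
  by apply: cvgM; [exact: cvg_cst|apply: cvg_expr; rewrite ger0_norm].
rewrite mulr0 => cvgC; have <- := cvg_lim (@Rhausdorff R) cvgC.
apply: limr_ge; first exact: cvgP cvgC.
by apply: nearW.
Qed.

Lemma invertible_neumann W (w : R) (z : R[i]) : geom_complete -> lin W ->
  0 <= w -> (forall v, nm (W v) <= w * nm v) -> w < normc z ->
  invertible (fun v => z *: v - W v).
Proof.
move=> cV lW w0 Ww wz; have z0 : 0 < normc z := le_lt_trans w0 wz.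
have zn0 : z != 0 by apply: contraTneq z0 => ->; rewrite normc0 ltxx.
have bW : bdlin W by split=> //; exists w.
have lA : lin (fun v => z *: v - W v).
  exact: (bdlinB (bdlinZ z (bdlin_id V)) bW).1.
apply: (@invertible_bij _ (normc z - w)) => //; first by rewrite subr_gt0.
  move=> v; rewrite mulrBl lerBlDr (le_trans _ (lerD (lexx _) (Ww v)))//.
  by rewrite -nmZ -[X in nm X <= _](subrK (W v)) nmD.
move=> v; pose u n := z ^- n.+1 *: iter n W v.
have Wn n : nm (iter n W v) <= w ^+ n * nm v.
  elim: n => [|n ih] /=; first by rewrite expr0 mul1r.
  by rewrite (le_trans (Ww _))// exprS -mulrA ler_wpM2l.
have q0 : 0 <= w / normc z by rewrite divr_ge0// ltW.
have q1 : w / normc z < 1 by rewrite ltr_pdivrMr// mul1r.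
have un n : nm (u n) <= (normc z)^-1 * nm v * (w / normc z) ^+ n.
  rewrite nmZ normcV normcX exprS invfM.
  rewrite [leRHS](_ : _ = (normc z)^-1 * (normc z)^-1 ^+ n * (w ^+ n * nm v)).
    rewrite -exprVn ler_wpM2l// mulr_ge0 ?exprn_ge0// invr_ge0 ltW//.
  by rewrite exprMn; ring.
have [s sE] := cV u _ _ q0 q1 un; exists s.
(* Telescoping: [z - W] maps a partial sum of the Neumann series to [v] up to a remainder of
   geometric size. *)
have tele n : z *: (\sum_(i < n) u i) - W (\sum_(i < n) u i) =
    v - z ^- n *: iter n W v.
  elim: n => [|n ih].
    by rewrite big_ord0 scaler0 (lin0 lW) expr0 invr1 scale1r !subrr.
  rewrite big_ord_recr/= scalerDr (linD lW) opprD addrACA ih /u (linZ lW) scalerA.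
  by rewrite [z * _]mulrC exprSr invfM divfK// -addrA [X in _ + X]addrA addNr add0r.
apply/eqP; rewrite -subr_eq0; apply/eqP/nm_eq0/le_anti; rewrite nm_ge0 andbT.
pose C := (normc z)^-1 * nm v; set q := w / normc z in q0 q1 un sE.
(* The defect of [s] is the image of the tail [s - \sum_(i < n) u i] minus the remainder, hence
   below a fixed multiple of [q ^+ n] for every [n]. *)
apply: (@le_geom0 ((normc z + w) * (C / (1 - q)) + nm v) q) => // n.
rewrite mulrDl.
rewrite (_ : _ - v = (z *: (s - \sum_(i < n) u i) - W (s - \sum_(i < n) u i))
    - z ^- n *: iter n W v); last first.
  rewrite (_ : z ^- n *: _ = v - (z *: (\sum_(i < n) u i) - W (\sum_(i < n) u i))).
    by rewrite scalerBr (linB lW) !opprB addrA [X in _ = X - v]addrAC !subrKA.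
  by rewrite tele subKr.
rewrite (le_trans (nmB _ _))// lerD//.
  rewrite (le_trans (nmB _ _))// nmZ.
  rewrite (le_trans (lerD (lexx _) (Ww _)))// -mulrDl -mulrA ler_wpM2l//.
    by rewrite addr_ge0// ltW.
  by rewrite (le_trans (sE n))// mulrAC.
rewrite nmZ normcV normcX /q exprMn exprVn.
rewrite [leRHS](_ : _ = (normc z ^+ n)^-1 * (w ^+ n * nm v)); last by ring.
by rewrite ler_wpM2l// invr_ge0 exprn_ge0// ltW.
Qed.

End fredholm.

(** * The Fredholm alternative, reduced to square matrices *)

(** Kernel and cokernel of a square matrix have the same dimension; the common [k] expresses that
    finite-rank perturbations have index zero, and makes the matrix [G] of [projection_perturbation]
    square. *)
Lemma kermx_cokermx_bases (F : fieldType) m (M : 'M[F]_m) :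
  exists k (K : 'M[F]_(k, m)) (C : 'M[F]_(m, k)),
    [/\ row_free K, K *m M = 0, M *m C = 0,
        forall c : 'rV[F]_m, c *m M = 0 -> exists d, c = d *m K
      & forall c : 'rV[F]_m, c *m C = 0 -> exists d, c = d *m M].
Proof.
have : exists C : 'M[F]_(m, \rank (cokermx M)), M *m C = 0 /\
    forall c : 'rV[F]_m, c *m C = 0 -> exists d, c = d *m M.
  exists (col_base (cokermx M)); split=> [|c c0].
    apply: (row_free_inj (row_base_free (cokermx M))).
    by rewrite -mulmxA mulmx_base mulmx_coker mul0mx.
  by apply/submxP; rewrite submxE -(mulmx_base (cokermx M)) mulmxA c0 mul0mx.
rewrite mxrank_coker -mxrank_ker => -[C [MC cC]].
exists (\rank (kermx M)), (row_base (kermx M)), C; split=> //.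
- exact: row_base_free.
- by apply/sub_kermxP; rewrite eq_row_base.
- by move=> c /sub_kermxP; rewrite -(eq_row_base (kermx M)) => /submxP.
Qed.

Section fredholm_theory.
Context {R : realType} {V : normedModType R[i]}.
Implicit Types (A B F T W : V -> V).

Section finite_rank_perturbation.
Variables (A A0 B : V -> V) (m : nat) (e : 'I_m -> V) (phi : 'I_m -> V -> R[i]^o).
Hypotheses (bA0 : bdlin A0) (bB : bdlin B).
Hypotheses (A0K : forall v, B (A0 v) = v) (BK : forall v, A0 (B v) = v).
Hypotheses (bphi : forall i, bdlin (phi i)).
Hypothesis (AE : forall v, A v = A0 v + \sum_(i < m) phi i v *: e i).

(** With [A = A0 + Ev \o Phi] and [B] inverse to [A0], one has [A (B (Ev c)) = Ev (c *m M)] and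
    [Phi (B (A v)) = Phi v *m M]. Solving [A v = w] thus reduces to the matrix [M] of
    [1 + Phi B Ev], acting on rows. *)
Let Phi v : 'rV[R[i]]_m := \row_j phi j v.
Let Ev (c : 'rV[R[i]]_m) : V := \sum_(i < m) c 0 i *: e i.
Let N : 'M[R[i]]_m := \matrix_(i, j) phi j (B (e i)).
Let M : 'M[R[i]]_m := 1%:M + N.

Let AEv v : A v = A0 v + Ev (Phi v).
Proof. by rewrite AE /Ev; congr (_ + _); apply: eq_bigr => i _; rewrite mxE. Qed.

Let EvD c d : Ev (c + d) = Ev c + Ev d.
Proof. by rewrite /Ev -big_split/=; apply: eq_bigr => i _; rewrite mxE scalerDl. Qed.

Let EvZ a c : Ev (a *: c) = a *: Ev c.
Proof.
by rewrite /Ev scaler_sumr; apply: eq_bigr => i _; rewrite mxE scalerA.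
Qed.

Let EvN c : Ev (- c) = - Ev c.
Proof. by rewrite -scaleN1r EvZ scaleN1r. Qed.

Let Ev0 : Ev 0 = 0.
Proof. by rewrite -(scale0r (0 : 'rV[R[i]]_m)) EvZ scale0r. Qed.

Let PhiD u v : Phi (u + v) = Phi u + Phi v.
Proof. by apply/rowP => j; rewrite !mxE (linD (bphi j).1). Qed.

Let PhiZ a u : Phi (a *: u) = a *: Phi u.
Proof. by apply/rowP => j; rewrite !mxE (linZ (bphi j).1). Qed.

Let PhiN u : Phi (- u) = - Phi u.
Proof. by rewrite -scaleN1r PhiZ scaleN1r. Qed.

Let Phi0 : Phi 0 = 0.
Proof. by rewrite -(scale0r (0 : V)) PhiZ scale0r. Qed.

Let PhiBE c : Phi (B (Ev c)) = c *m N.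
Proof.
apply/rowP => j; rewrite !mxE /Ev (lin_sum bB.1) (lin_sum (bphi j).1).
by apply: eq_bigr => i _; rewrite (linZ bB.1) (linZ (bphi j).1) mxE.
Qed.

Let mulM (c : 'rV[R[i]]_m) : c *m M = c + c *m N.
Proof. by rewrite mulmxDr mulmx1. Qed.

Let ABE c : A (B (Ev c)) = Ev (c *m M).
Proof. by rewrite AEv BK PhiBE mulM EvD. Qed.

Let ran_sol w c : Phi (B w) = c *m M -> A (B (w - Ev c)) = w.
Proof.
move=> wc; rewrite AEv BK (linB bB.1) PhiD PhiN wc PhiBE mulM addrK.
by rewrite subrK.
Qed.

Let sol_ran v : Phi (B (A v)) = Phi v *m M.
Proof. by rewrite AEv (linD bB.1) A0K PhiD PhiBE mulM. Qed.

(** A row [c] with [c *m M = 0] yields [B (Ev c)] in the kernel of [A], and [c] is recovered as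
    [- Phi (B (Ev c))]; injectivity of [A] therefore makes [M] invertible. *)
Lemma invertible_perturbation : (forall v, A v = 0 -> v = 0) -> invertible A.
Proof.
move=> injA; have uM : M \in unitmx.
  rewrite -row_free_unit -kermx_eq0; apply/eqP/row_matrixP => i; rewrite row0.
  have : row i (kermx M) *m M = 0 by rewrite -row_mul mulmx_ker row0.
  move: (row i _) => c cM; have := injA (B (Ev c)); rewrite ABE cM Ev0 => /(_ erefl) v0.
  by move: cM; rewrite mulM -PhiBE v0 Phi0 addr0.
(* The Sherman-Morrison-Woodbury formula for the inverse. *)
pose X w := B (w - Ev (Phi (B w) *m invmx M)).
have AX w : A (X w) = w by apply: ran_sol; rewrite mulmxKV.
have bA : bdlin A.
  rewrite (_ : A = fun v => A0 v + \sum_(i < m) phi i v *: e i); last exact/funext.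
  by apply: bdlinD => //; apply: bdlin_sum => i; exact: bdlin_rank1.
exists X; split=> // [|v].
  apply: (bdlin_comp bB); apply: bdlinB; first exact: bdlin_id.
  rewrite [X in bdlin X](_ : _ = fun w =>
      \sum_(i < m) (\sum_(j < m) invmx M j i *: phi j (B w) : R[i]^o) *: e i).
    apply: bdlin_sum => i; apply: bdlin_rank1; apply: bdlin_sum => j.
    by apply: bdlinZ; exact: bdlin_comp.
  apply/funext => w; apply: eq_bigr => i _; rewrite mxE; congr (_ *: _).
  by apply: eq_bigr => j _; rewrite mxE mulrC.
by apply/eqP; rewrite -subr_eq0; apply/eqP/injA; rewrite (linB bA.1) AX subrr.
Qed.

(** The hypothesis says that [A] has ascent at most one. As the index is zero, kernel and range are
    then complementary, and [pi] is the projection onto the kernel along the range. *)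
Lemma projection_perturbation : (forall v, A (A v) = 0 -> A v = 0) ->
  exists k (J : 'I_k -> V) (psi : 'I_k -> V -> R[i]^o),
  [/\ forall i, bdlin (psi i), forall i, A (J i) = 0
    & let pi v := \sum_(i < k) psi i v *: J i in
      [/\ forall v, A v = 0 -> pi v = v, forall v, pi (A v) = 0
        & forall v, exists w, v - pi v = A w]].
Proof.
move=> kerA; have [k [K [C [freeK KM MC cK cC]]]] := kermx_cokermx_bases M.
(* [Jv] parametrizes the kernel of [A], and [psi0] vanishes exactly on its range. *)
pose Jv (d : 'rV[R[i]]_k) := B (Ev (d *m K)).
pose psi0 v := Phi (B v) *m C.
have AJ d : A (Jv d) = 0 by rewrite ABE -mulmxA KM mulmx0 Ev0.
have JvD a c d : Jv (a *: c + d) = a *: Jv c + Jv d.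
  by rewrite /Jv mulmxDl -scalemxAl EvD EvZ bB.1.
have psi0D a u v : psi0 (a *: u + v) = a *: psi0 u + psi0 v.
  by rewrite /psi0 bB.1 PhiD PhiZ mulmxDl scalemxAl.
have psi0_ran v : psi0 v = 0 -> exists w, v = A w.
  move=> /cC[d vd]; exists (B (v - Ev d)); apply/esym; exact: ran_sol.
have psi0A v : psi0 (A v) = 0 by rewrite /psi0 sol_ran -mulmxA MC mulmx0.
pose G := \matrix_(i < k) psi0 (Jv (delta_mx 0 i)).
have Jv_sum (d : 'rV[R[i]]_k) : Jv d = \sum_(i < k) d 0 i *: Jv (delta_mx 0 i).
  rewrite {1}(row_sum_delta d).
  elim/big_rec2 : _ => [|i x y _ <-]; last by rewrite JvD.
  by rewrite /Jv mul0mx Ev0 (lin0 bB.1).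
have psiJ d : psi0 (Jv d) = d *m G.
  rewrite mulmx_sum_row Jv_sum.
  elim/big_rec2 : _ => [|i x y _ <-]; last by rewrite psi0D rowK.
  by rewrite /psi0 (lin0 bB.1) Phi0 mul0mx.
have uG : G \in unitmx.
  rewrite -row_free_unit -kermx_eq0; apply/eqP/row_matrixP => i; rewrite row0.
  have : row i (kermx G) *m G = 0 by rewrite -row_mul mulmx_ker row0.
  (* A row killed by [G] gives [Jv d] in both the kernel and the range of [A], hence zero by the
     hypothesis on the ascent. *)
  move: (row i _) => d; rewrite -psiJ => /psi0_ran[w Jw].
  have J0 : Jv d = 0 by rewrite Jw; apply: kerA; rewrite -Jw AJ.
  apply: (row_free_inj freeK); rewrite mul0mx.
  have : (d *m K) *m M = 0 by rewrite -mulmxA KM mulmx0.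
  by rewrite mulM -PhiBE -/(Jv d) J0 Phi0 addr0.
exists k, (fun i => Jv (delta_mx 0 i)), (fun i v => (psi0 v *m invmx G) 0 i).
split=> [i|i|pi]; [|exact: AJ|].
  rewrite [X in bdlin X](_ : _ = fun v => \sum_(l < k) invmx G l i *:
      (\sum_(j < m) C j l *: phi j (B v) : R[i]^o)).
    apply: bdlin_sum => l; apply: bdlinZ; apply: bdlin_sum => j.
    by apply: bdlinZ; exact: bdlin_comp.
  apply/funext => v; rewrite mxE; apply: eq_bigr => l _; rewrite mulrC; congr (_ * _).
  by rewrite mxE; apply: eq_bigr => j _; rewrite mxE mulrC.
have piE v : pi v = Jv (psi0 v *m invmx G) by rewrite Jv_sum.
split=> [v Av|v|v].
- have : Phi v *m M = 0 by rewrite -sol_ran Av (lin0 bB.1) Phi0.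
  move=> /cK[d vd]; have -> : v = Jv (- d).
    rewrite /Jv mulNmx -vd EvN (linN bB.1).
    by apply/eqP; rewrite -addr_eq0 -{1}(A0K v) -(linD bB.1) -AEv Av (lin0 bB.1).
  by rewrite piE psiJ mulmxK.
- by rewrite piE psi0A mul0mx -(scale0r (0 : 'rV[R[i]]_k)) -[X in Jv X]addr0 JvD scale0r
    add0r /Jv mul0mx Ev0 (lin0 bB.1).
- apply: psi0_ran; rewrite addrC -scaleN1r psi0D piE psiJ mulmxKV// scaleN1r.
  by rewrite addNr.
Qed.

End finite_rank_perturbation.

Lemma fredholm_injective A : fredholm A -> (forall v, A v = 0 -> v = 0) ->
  invertible A.
Proof.
move=> [A0 [F [bA0 [B [bB A0K BK]] [m [e [phi [bphi FE]]]] AE]]].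
apply: (invertible_perturbation bA0 bB BK bphi (e := e)) => v.
by rewrite AE FE.
Qed.

Lemma fredholm_projection A : fredholm A -> (forall v, A (A v) = 0 -> A v = 0) ->
  exists k (J : 'I_k -> V) (psi : 'I_k -> V -> R[i]^o),
  [/\ forall i, bdlin (psi i), forall i, A (J i) = 0
    & let pi v := \sum_(i < k) psi i v *: J i in
      [/\ forall v, A v = 0 -> pi v = v, forall v, pi (A v) = 0
        & forall v, exists w, v - pi v = A w]].
Proof.
move=> [A0 [F [bA0 [B [bB A0K BK]] [m [e [phi [bphi FE]]]] AE]]].
apply: (projection_perturbation bB A0K BK bphi (e := e)) => v.
by rewrite AE FE.
Qed.

End fredholm_theory.

(** * Separated families of vectors: pigeonhole and Riesz's lemma *)

Section separated.
Context {R : realType} {V : normedModType R[i]}.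
Implicit Types (F P Y T W : V -> V) (z : R[i]) (zs : seq R[i]).

Lemma normc_le_ReIm z : normc z <= `|Re z| + `|Im z|.
Proof.
case: z => a b /=; rewrite -[leRHS]ger0_norm ?addr_ge0// -sqrtr_sqr ler_wsqrtr//.
by rewrite sqrrD -!normrX !(ger0_norm (sqr_ge0 _)) addrAC lerDl mulrn_wge0// mulr_ge0.
Qed.

Lemma Re_le_normc z : `|Re z| <= normc z.
Proof. by case: z => a b /=; rewrite -sqrtr_sqr ler_wsqrtr// lerDl sqr_ge0. Qed.

Lemma Im_le_normc z : `|Im z| <= normc z.
Proof. by case: z => a b /=; rewrite -sqrtr_sqr ler_wsqrtr// lerDr sqr_ge0. Qed.

Lemma truncn_eq_dist (x y : R) : 0 <= x -> 0 <= y ->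
  Num.truncn x = Num.truncn y -> `|x - y| < 1.
Proof.
move=> /truncn_itv/andP[h1 h2] /truncn_itv/andP[h3 h4] h; rewrite h in h1 h2.
move: h2 h4; rewrite -!natr1; set k := _%:R in h1 h3 *; move=> h2 h4.
by rewrite ltr_norml; apply/andP; split; lra.
Qed.

(* Pigeonhole on a grid in the coordinates of the finite-rank map. *)
Lemma finite_rank_separated F (delta : R) : finite_rank F -> 0 < delta ->
  exists D : nat, forall vs : seq V, (forall v, v \in vs -> nm v <= 1) ->
    pairwise (fun u v => delta <= nm (F u - F v)) vs -> (size vs <= D)%N.
Proof.
move=> [m [e [phi [bphi FE]]]] d0.
have /choice[Mf MfP] : forall i, exists M : R,
    0 < M /\ forall v, normc (phi i v) <= M * nm v.
  by move=> i; have [M M0 h] := bdlin_ub (bphi i); exists M.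
pose M := \sum_(i < m) Mf i; pose s := \sum_(i < m) nm (e i).
have s0 : 0 <= s by apply: sumr_ge0 => i _; exact: nm_ge0.
have phiM i v : nm v <= 1 -> normc (phi i v) <= M.
  move=> v1; apply: (@le_trans _ _ (Mf i)).
    rewrite (le_trans ((MfP i).2 v))// -[leRHS]mulr1 ler_wpM2l//.
    by rewrite ltW//; have [] := MfP i.
  rewrite /M (bigD1 i)//= lerDl sumr_ge0// => j _; apply/ltW.
  by have [] := MfP j.
(* Cells of side [t] for real and imaginary parts let [F v] vary by at most [2 * t * s = delta * (s
   / (s + 1)) < delta]; the added 1 covers [s = 0]. *)
pose t := delta / (2 * (s + 1)).
have t0 : 0 < t by rewrite divr_gt0// mulr_gt0// ltr_wpDl.
pose L := Num.truncn (2 * M / t).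
pose cell (x : R) : 'I_L.+1 := inord (Num.truncn ((x + M) / t)).
have cellP x y : `|x| <= M -> `|y| <= M -> cell x = cell y -> `|x - y| < t.
  move=> xM yM /(congr1 (@nat_of_ord _)); rewrite /cell !inordK; last 2 first.
  - rewrite ltnS le_truncn// ler_pM2r ?invr_gt0//.
    by move: yM; rewrite ler_norml => /andP[_ h]; lra.
  - rewrite ltnS le_truncn// ler_pM2r ?invr_gt0//.
    by move: xM; rewrite ler_norml => /andP[_ h]; lra.
  have ge u : `|u| <= M -> 0 <= (u + M) / t.
    by rewrite ler_norml => /andP[h _]; rewrite divr_ge0 ?(ltW t0)//; lra.
  move=> /(truncn_eq_dist (ge _ xM) (ge _ yM)).
  rewrite -mulrBl opprD addrACA subrr addr0 normrM [`|t^-1|]ger0_norm ?invr_ge0 ?(ltW t0)//.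
  by rewrite ltr_pdivrMr// mul1r.
pose code v := [ffun i => (cell (Re (phi i v)), cell (Im (phi i v)))].
have codeP u v : nm u <= 1 -> nm v <= 1 -> code u = code v -> nm (F u - F v) < delta.
  move=> u1 v1 /ffunP uv; rewrite !FE -sumrB (le_lt_trans (nm_sum _))//.
  apply: (@le_lt_trans _ _ (\sum_(i < m) 2 * t * nm (e i))).
    apply: ler_sum => i _; rewrite -scalerBl nmZ ler_wpM2r ?nm_ge0//.
    rewrite (le_trans (normc_le_ReIm _))//.
    have := uv i; rewrite !ffunE => -[/cellP cr /cellP ci].
    have pu := phiM i u u1; have pv := phiM i v v1.
    have := cr (le_trans (Re_le_normc _) pu) (le_trans (Re_le_normc _) pv).
    have := ci (le_trans (Im_le_normc _) pu) (le_trans (Im_le_normc _) pv).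
    case: (phi i u) (phi i v) => [a b] [a' b'] /=; lra.
  rewrite -mulr_sumr -/s /t.
  rewrite [X in X < _](_ : _ = delta * (s / (s + 1))); last by field; lra.
  by rewrite gtr_pMr// ltr_pdivrMr ?ltr_wpDl// mul1r ltrDl.
exists #|{: {ffun 'I_m -> 'I_L.+1 * 'I_L.+1}}| => vs vs1 sep.
rewrite -(size_map code) -(card_uniqP _) ?max_card//.
rewrite uniq_pairwise pairwise_map.
elim: vs vs1 sep => //= v vs ih vs1 /andP[/allP vvs sep].
rewrite ih ?andbT//; last by move=> u uvs; apply: vs1; rewrite inE uvs orbT.
apply/allP => u uvs; apply/eqP => /codeP; rewrite ltNge vvs// => H.
by apply: (notF); apply: H; apply: vs1; rewrite inE ?eqxx ?uvs ?orbT.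
Qed.

(** Riesz's lemma for the kernel of [P]. The distance from [u] to that kernel is positive because it
    is at least [nm (P u) / M]. *)
Lemma riesz_vector P u : bdlin P -> P u <> 0 ->
  exists (a : R[i]) k, [/\ P k = 0, nm (a *: (u - k)) = 1
    & forall k', P k' = 0 -> 2^-1 <= nm (a *: (u - k) - k')].
Proof.
move=> bP Pu; have [M M0 PM] := bdlin_ub bP.
pose D := [set nm (u - k) | k in [set k | P k = 0]].
have D0 : D !=set0 by exists (nm (u - 0)), 0 => //; exact: (lin0 bP.1).
have Pu0 : 0 < nm (P u) by apply: nm_gt0; exact/eqP.
have Dlb x : D x -> nm (P u) / M <= x.
  by move=> [k /= Pk <-]; rewrite ler_pdivrMr// mulrC -[P u]subr0 -Pk -(linB bP.1).
have hD : has_inf D by split=> //; exists (nm (P u) / M).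
have dge : nm (P u) / M <= inf D by apply: lb_le_inf.
have d0 : 0 < inf D by rewrite (lt_le_trans _ dge)// divr_gt0.
(* The margin is the distance itself, so [nm (u - k) < 2 * inf D]; this is the constant one half. *)
have [_ [k /= Pk <-] kd] := inf_adherent d0 hD.
set n := nm (u - k) in kd.
have n0 : 0 < n by rewrite (lt_le_trans d0)//; apply: ge_inf; [exact: hD.2|exists k].
have nn0 : n%:C != 0 by rewrite fmorph_eq0 gt_eqF.
exists n^-1%:C, k; split=> // [|k' Pk'].
  by rewrite nmZ normc_realC ger0_norm ?invr_ge0 ?ltW// mulVf// gt_eqF.
rewrite (_ : _ - k' = n^-1%:C *: (u - (k + n%:C *: k'))); last first.
  rewrite opprD addrA [in RHS]scalerBr [in RHS]scalerA -rmorphM/= mulVf ?gt_eqF//.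
  by rewrite rmorph1 scale1r.
rewrite nmZ normc_realC ger0_norm ?invr_ge0 ?(ltW n0)// ler_pdivlMl//.
have : inf D <= nm (u - (k + n%:C *: k')).
  apply: ge_inf; [exact: hD.2|exists (k + n%:C *: k') => //=].
  by rewrite (linD bP.1) (linZ bP.1) Pk Pk' scaler0 addr0.
by move: kd; lra.
Qed.

End separated.

(** * Increasing kernels of products of factors [Y - z] *)

Section chains.
Context {R : realType} {V : normedModType R[i]}.
Implicit Types (F P Y T W : V -> V) (z : R[i]) (zs : seq R[i]).

Definition polyop Y zs v := foldr (fun z u => Y u - z *: u) v zs.

(** Each new factor, added at the head, must enlarge the kernel strictly. Repetitions in [zs] are
    allowed and account for generalized eigenvectors. *)
Fixpoint strict_chain Y zs : Prop :=
  if zs is z :: zs' then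
    strict_chain Y zs' /\ exists v, polyop Y zs v = 0 /\ polyop Y zs' v <> 0
  else True.

Lemma polyop_bdlin Y zs : bdlin Y -> bdlin (polyop Y zs).
Proof.
move=> bY; elim: zs => [|z zs ih]; first exact: bdlin_id.
exact: (bdlinB (bdlin_comp bY ih) (bdlinZ z ih)).
Qed.

Lemma polyop_comm Y T zs v : lin T -> (forall u, Y (T u) = T (Y u)) ->
  polyop Y zs (T v) = T (polyop Y zs v).
Proof.
move=> lT YT; elim: zs => //= z zs ->.
by rewrite YT (linB lT) (linZ lT).
Qed.

Lemma polyop_shift Y z zs v : lin Y ->
  polyop Y (z :: zs) v = polyop Y zs (Y v - z *: v).
Proof.
move=> lY; rewrite (polyop_comm (T := fun u => Y u - z *: u))//.
  by move=> a u w; rewrite lY scalerDr opprD addrACA !scalerBr !scalerA [z * a]mulrC.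
by move=> u; rewrite (linB lY) (linZ lY).
Qed.

Lemma polyop_polyop Y ys zs v : lin Y ->
  polyop Y ys (polyop Y zs v) = polyop Y zs (polyop Y ys v).
Proof.
move=> lY; elim: ys v => //= y ys ih v.
by rewrite -/(polyop Y _ _) ih -[RHS]polyop_shift.
Qed.

Lemma polyop_eigen Y z zs v : lin Y -> Y v = z *: v ->
  polyop Y zs v = (\prod_(y <- zs) (z - y)) *: v.
Proof.
move=> lY Yv; elim: zs => [|y zs ih]; first by rewrite big_nil scale1r.
rewrite big_cons /= ih (linZ lY) Yv !scalerA -scalerBl.
by congr (_ *: _); rewrite mulrBl [z * _]mulrC.
Qed.

(** Riesz's argument: for [v] in the enlarged kernel and [w] in the previous one, [Y v - z *: v] and
    [Y w] both lie in the previous kernel. So [Y v - Y w] is [z] times the difference of [v] and an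
    element of that kernel, of norm at least [normc z / 2]. *)
Lemma strict_chain_vectors Y (r : R) zs : bdlin Y -> 0 < r ->
  (forall z, z \in zs -> r <= normc z) -> strict_chain Y zs ->
  exists vs : seq V, [/\ size vs = size zs,
    forall v, v \in vs -> nm v = 1 /\ polyop Y zs v = 0
    & pairwise (fun u v => r / 2 <= nm (Y u - Y v)) vs].
Proof.
move=> bY r0; elim: zs => [_ _|z zs ih zsr [/ih]]; first by exists [::].
case=> [y yzs|vs [sz vsP sep] [u [u0 /(riesz_vector (polyop_bdlin zs bY))]]].
  by apply: zsr; rewrite inE yzs orbT.
move=> [a [k [k0 n1 dist]]]; set v := a *: (u - k) in n1 dist.
have rz : r <= normc z by apply: zsr; rewrite inE eqxx.
have z0 : z != 0 by apply: contraTneq rz => ->; rewrite normc0 -ltNge.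
have kerS w : polyop Y zs w = 0 -> polyop Y (z :: zs) w = 0.
  by move=> /= ->; rewrite (lin0 bY.1) scaler0 subrr.
have v0 : polyop Y (z :: zs) v = 0.
  have l := (polyop_bdlin (z :: zs) bY).1.
  by rewrite (linZ l) (linB l) u0 kerS// subrr scaler0.
exists (v :: vs); split; first by rewrite /= sz.
  move=> w; rewrite inE => /orP[/eqP ->//|/vsP[-> w0]]; split=> //; exact: kerS.
rewrite /= sep andbT; apply/allP => w /vsP[_ w0].
have l := (polyop_bdlin zs bY).1.
have := dist (z^-1 *: (Y w - (Y v - z *: v))).
rewrite (linZ l) (linB l) -polyop_shift ?v0; last exact: bY.1.
rewrite subr0 (polyop_comm zs w bY.1)// w0 (lin0 bY.1) scaler0 => /(_ erefl) h.
have -> : Y v - Y w = z *: (v - z^-1 *: (Y w - (Y v - z *: v))).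
  by rewrite scalerBr [z *: (z^-1 *: _)]scalerA divff// scale1r opprB addrA [z *: v + _]addrC subrK.
by rewrite nmZ ler_pM// ltW.
Qed.

(** The images under [Y] are [r / 2] apart; replacing [Y] by [F] loses at most [2 * w <= r / 4]. The
    separation [r / 4] that remains is possible for boundedly many unit vectors only. This is the
    origin of the 8. *)
Lemma strict_chain_bounded Y F (w r : R) : bdlin Y -> finite_rank F ->
  (forall v, nm (Y v - F v) <= w * nm v) -> 8 * w <= r -> 0 < r ->
  exists D, forall zs, (forall z, z \in zs -> r <= normc z) ->
    strict_chain Y zs -> (size zs <= D)%N.
Proof.
move=> bY fF YF wr r0.
have [|D DP] := finite_rank_separated fF (delta := r / 4); first by lra.
exists D => zs zsr /(strict_chain_vectors bY r0 zsr)[vs [<- vsP sep]].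
apply: DP => [v /vsP[->]//|].
apply: (sub_in_pairwise (P := fun v => nm v == 1)) sep; last first.
  by apply/allP => v /vsP[->].
move=> u v; rewrite !unfold_in => /eqP u1 /eqP v1 h.
have -> : F u - F v = (Y u - Y v) - ((Y u - F u) - (Y v - F v)).
  have -> : (Y u - F u) - (Y v - F v) = (Y u - Y v) - (F u - F v).
    by rewrite !opprD addrACA.
  by rewrite subKr.
have := nmD ((Y u - Y v) - ((Y u - F u) - (Y v - F v))) ((Y u - F u) - (Y v - F v)).
rewrite subrK => h1.
have := nmB (Y u - F u) (Y v - F v); have := YF u; have := YF v.
by rewrite u1 v1 !mulr1; lra.
Qed.

(** If no chain were maximal, lowering the radius a little would always allow one more factor, and
    chains of every length would exist with factors of modulus at least [rho1 ^+ N]. The gap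
    [r1 < r2] separates the collected factors from the radius at which the kernel has stopped
    growing. *)
Lemma maximal_chain Y F (w rho1 rho0 : R) N : bdlin Y -> finite_rank F ->
  (forall v, nm (Y v - F v) <= w * nm v) -> 8 * w <= rho1 ^+ N ->
  0 < rho1 -> rho1 < rho0 ->
  exists (r1 r2 : R) zs, [/\ rho1 <= r1, r1 < r2, r2 < rho0,
    forall z, z \in zs -> r2 ^+ N <= normc z
    & forall z v, r1 ^+ N <= normc z -> polyop Y (z :: zs) v = 0 ->
        polyop Y zs v = 0].
Proof.
move=> bY fF YF wr r0 rho10; apply: contrapT => nex.
have [D DP] := strict_chain_bounded bY fF YF wr (exprn_gt0 N r0).
have H n r : rho1 <= r -> r < rho0 -> exists zs,
    [/\ strict_chain Y zs, size zs = n & forall z, z \in zs -> r ^+ N <= normc z].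
  elim: n r => [|n ih] r r1 r2; first by exists [::].
  (* The shorter chain is taken at a larger radius, halfway to [rho0]; non-maximality between the
     two radii supplies the next factor. *)
  have [||zs [szs <- zsr]] := ih ((r + rho0) / 2); [lra|lra|].
  apply: contrapT => nn; apply: nex; exists r, ((r + rho0) / 2), zs; split=> //; [lra|lra|].
  move=> z v zr pv; apply: contrapT => pv'; apply: nn; exists (z :: zs); split=> //.
    by split=> //; exists v.
  move=> y; rewrite inE => /orP[/eqP ->//|/zsr]; apply: le_trans.
  by apply: lerXn2r; rewrite ?nnegrE; lra.
have [zs [szs zsD zsr]] := H D.+1 rho1 (lexx _) rho10.
by have := DP _ zsr szs; rewrite zsD ltnn.
Qed.

End chains.

(** * The spectral decomposition of an operator with a power close to finite rank *)

Section essential_spectral_radius.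
Context {R : realType} {V : normedModType R[i]}.
Implicit Types (F P Y T W : V -> V) (z : R[i]) (zs : seq R[i]).

Lemma invertible_sub_lt Y F (w : R) z : @geom_complete R V -> bdlin Y ->
  finite_rank F -> 0 <= w -> (forall v, nm (Y v - F v) <= w * nm v) ->
  w < normc z -> invertible (fun v => z *: v - (Y v - F v)).
Proof.
move=> cV bY fF w0 YF wz; apply: (invertible_neumann (W := fun v => Y v - F v) cV _ w0) => //.
exact: (bdlinB bY (finite_rank_bdlin fF)).1.
Qed.

Lemma fredholm_polyop Y F (w : R) zs : @geom_complete R V -> bdlin Y ->
  finite_rank F -> 0 <= w -> (forall v, nm (Y v - F v) <= w * nm v) ->
  (forall z, z \in zs -> w < normc z) -> fredholm (polyop Y zs).
Proof.
move=> cV bY fF w0 YF; have bF := finite_rank_bdlin fF.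
elim: zs => [_|z zs ih zsw]; first exact: fredholm_id.
apply: (fredholm_comp (A := fun u => Y u - z *: u)); last first.
  by apply: ih => y yzs; apply: zsw; rewrite inE yzs orbT.
have wz : w < normc z by apply: zsw; rewrite inE eqxx.
have [B [bB AK BK]] := invertible_sub_lt cV bY fF w0 YF wz.
exists (fun v => (Y v - F v) - z *: v), F; split=> //.
- by apply: bdlinB; [exact: bdlinB|exact: bdlinZ (bdlin_id V)].
- exists (fun v => - B v); split=> [|v|v]; first exact: bdlinN.
    by rewrite -(linN bB.1) opprB AK.
  rewrite -[RHS](BK v) (linN bY.1) (linN bF.1) scalerN opprK addrC opprK.
  by rewrite opprB [- Y _ + _]addrC.
- by move=> v; rewrite addrAC subrK.
Qed.

(** The quotient of [z ^+ n - iter n T] by [z - T]; composed with an inverse of the former it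
    inverts the latter. *)
Definition gsum z T n v := \sum_(j < n) z ^+ (n.-1 - j) *: iter j T v.

Lemma gsumS z T n v : gsum z T n.+1 v = z *: gsum z T n v + iter n T v.
Proof.
rewrite /gsum big_ord_recr/= subnn expr0 scale1r scaler_sumr; congr (_ + _).
apply: eq_bigr => j _; rewrite scalerA -exprS; congr (_ ^+ _ *: _).
by case: n j => [[]//|n] j; rewrite subSn// -ltnS.
Qed.

Lemma gsumE z T n v : lin T ->
  z *: gsum z T n v - T (gsum z T n v) = z ^+ n *: v - iter n T v.
Proof.
move=> lT; elim: n => [|n ih].
  by rewrite /gsum big_ord0 scaler0 (lin0 lT) expr0 scale1r !subrr.
rewrite gsumS scalerDr (linD lT) (linZ lT) opprD addrACA -scalerBr ih.
by rewrite scalerBr scalerA -exprS addrA subrK.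
Qed.

Lemma bdlin_gsum z T n : bdlin T -> bdlin (gsum z T n).
Proof. by move=> bT; apply: bdlin_sum => j; apply: bdlinZ; exact: bdlin_iter. Qed.

Lemma closed_bdlin_ker T : bdlin T -> closed [set v | T v = 0].
Proof.
move=> bT; have [M M0 TM] := bdlin_ub bT.
suff cT : continuous T.
  rewrite (_ : [set v | _] = T @^-1` [set 0])//.
  apply: closed_comp => [v _|]; first exact: cT.
  by apply: accessible_closed_set1; apply: hausdorff_accessible; exact: norm_hausdorff.
move=> v; apply/cvgrPdist_lt => e e0.
have e1 : 0 < e / M%:C by rewrite divr_gt0// ltcR.
near=> u.
rewrite -(linB bT.1) nmE (le_lt_trans (y := (M * nm (v - u))%:C)) ?lecR//.
rewrite rmorphM/= -nmE mulrC -ltr_pdivlMr ?ltcR//.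
Unshelve. all: by end_near. Qed.

Lemma spectral_radius_ge0 T : 0 <= spectral_radius T.
Proof.
rewrite /spectral_radius /spectral_radius_on.
set A := (X in sup X); case: (pselect (has_sup A)) => [[[x Ax] ubA]|nA].
  rewrite (@le_trans _ _ x)//; last exact: ub_le_sup.
  by case: Ax => z _ <-; exact: Defs.normc_ge0.
by rewrite sup_out.
Qed.

(* [Y = T^N] has finitely many eigenvalues (with multiplicity) far from the
   origin: take for [F] the kernel and for [H] the range of the polynomial
   [p(Y)] given by a maximal chain. *)
Lemma ess_spectral_radius_le T F N (w rho1 rho0 : R) :
  @geom_complete R V -> bdlin T -> (0 < N)%N -> finite_rank F -> 0 <= w ->
  (forall v, nm (iter N T v - F v) <= w * nm v) -> 8 * w <= rho1 ^+ N ->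
  0 < rho1 -> rho1 < rho0 -> ess_spectral_radius T <= rho0.
Proof.
move=> cV bT N0 fF w0 YF wr r10 rho10; pose Y := iter N T.
have bY : bdlin Y by exact: bdlin_iter.
have [r1 [r2 [zs [r1r r12 r2r zsr max]]]] := maximal_chain bY fF YF wr r10 rho10.
have r1N : w < r1 ^+ N.
  have : rho1 ^+ N <= r1 ^+ N by apply: lerXn2r => //; rewrite nnegrE; lra.
  by have := exprn_gt0 N r10; lra.
have r2N : r1 ^+ N < r2 ^+ N by rewrite ltrXn2r ?gtn_eqF//; lra.
have fp : fredholm (polyop Y zs).
  apply: (fredholm_polyop cV bY fF w0 YF) => z /zsr; apply: lt_le_trans.
  exact: lt_trans r2N.
set p := polyop Y zs in fp; have bp : bdlin p by exact: fredholm_bdlin.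
(* By maximality no factor of [p] enlarges the kernel of [p], so the factors of the outer [p] can be
   removed one at a time. *)
have pp v : p (p v) = 0 -> p v = 0.
  have H us : (forall z, z \in us -> r1 ^+ N <= normc z) ->
      polyop Y us (p v) = 0 -> p v = 0.
    elim: us => // z us ih usr h; apply: ih => [y yus|].
      by apply: usr; rewrite inE yus orbT.
    rewrite polyop_polyop; last exact: bY.1.
    apply: (max z); first by apply: usr; rewrite inE eqxx.
    by move: h; rewrite /= polyop_polyop//; exact: bY.1.
  by apply: H => z /zsr; apply: le_trans; exact: ltW.
have [k [J [psi [bpsi pJ]]]] := fredholm_projection fp pp.
pose pi v := \sum_(i < k) psi i v *: J i.
rewrite -[let _ := _ in _]/([/\ forall v, p v = 0 -> pi v = v,
  forall v, pi (p v) = 0 & forall v, exists w, v - pi v = p w]).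
move=> [pi_ker pi_ran ran_pi].
have bpi : bdlin pi by apply: bdlin_sum => i; exact: bdlin_rank1.
have ppi v : p (pi v) = 0.
  rewrite (lin_sum bp.1) big1// => i _.
  by rewrite (linZ bp.1) pJ scaler0.
have YT v : Y (T v) = T (Y v) by rewrite /Y -iterSr -iterS.
have pT v : p (T v) = T (p v) by rewrite /p polyop_comm//; exact: bT.1.
have pY v : p (Y v) = Y (p v) by rewrite /p polyop_comm//; exact: bY.1.
pose G := [set v | p v = 0]; pose H := [set v | pi v = 0].
have HP v : H v -> exists w, v = p w.
  by rewrite /H/= => v0; have [u] := ran_pi v; rewrite v0 subr0 => ->; exists u.
have Hpi v : H (v - pi v) by have [u vu] := ran_pi v; rewrite /H/= vu pi_ran.
have HT v : H v -> H (T v) by move=> /HP[u ->]; rewrite /H/= -pT pi_ran.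
have HY v : H v -> H (Y v) by move=> /HP[u ->]; rewrite /H/= -pY pi_ran.
have HD (a : R[i]) u v : H u -> H v -> H (a *: u + v).
  by rewrite /H/= => u0 v0; rewrite bpi.1 u0 v0 scaler0 addr0.
have H0 : H 0 by exact: (lin0 bpi.1).
have HZ (a : R[i]) u : H u -> H (a *: u).
  by move=> Hu; rewrite -[_ *: _]addr0; apply: HD.
have HA u v : H u -> H v -> H (u + v).
  by move=> Hu Hv; rewrite -[u]scale1r; apply: HD.
have HB0 u v : H u -> H v -> H (u - v).
  by move=> Hu Hv; rewrite -scaleN1r; apply: HA => //; exact: HZ.
(* If [p u] is an eigenvector of [Y], then [u] is in the kernel of [(Y - z) p], hence in that of
   [p]. *)
have injH z v : r1 ^+ N <= normc z -> H v -> Y v = z *: v -> v = 0.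
  move=> zr /HP[u ->] Yu; apply: (max z) => //=.
  by rewrite -/(polyop Y zs u) -/(p u) Yu subrr.
(* The operator [z ^+ N - Y (1 - pi)] agrees with [z ^+ N - Y] on [H], is Fredholm on the whole
   space, and has its kernel inside [H], where [injH] applies. It is therefore invertible, and
   [gsum] converts its inverse into a resolvent of [T] on [H]. *)
have res z : r1 <= normc z -> exists U, bounded_linear_on H U /\
    forall v, H v -> U (z *: v - T v) = v /\ z *: U v - T (U v) = v.
  move=> zr; have zN : r1 ^+ N <= normc (z ^+ N).
    by rewrite normcX lerXn2r// ?nnegrE; lra.
  have zN0 : z ^+ N != 0.
    apply: contraTneq zN => ->; rewrite normc0 -ltNge.
    exact: le_lt_trans r1N.
  have [B [bB AK BK]] : invertible (fun v => z ^+ N *: v - Y (v - pi v)).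
    apply: fredholm_injective => [|v /eqP].
      exists (fun v => z ^+ N *: v - (Y v - F v)), (fun v => Y (pi v) - F v); split.
      - by apply: bdlinB; [exact: bdlinZ (bdlin_id V)|
          exact: bdlinB (finite_rank_bdlin fF)].
      - by apply: (invertible_sub_lt cV bY fF w0 YF); exact: lt_le_trans zN.
      - apply: finite_rankD (finite_rankN fF).
        by apply: (finite_rank_compl bY); exists k, J, psi.
      - by move=> v; rewrite (linB bY.1) !opprB -addrA; congr (_ + _);
          rewrite [RHS]addrC subrKA.
    rewrite subr_eq0 => /eqP zv; apply: (injH (z ^+ N)) => //.
      have -> : v = (z ^+ N)^-1 *: Y (v - pi v) by rewrite -zv scalerA mulVf// scale1r.
      by apply/HZ/HY.
    have Hv : H v.
      have -> : v = (z ^+ N)^-1 *: Y (v - pi v) by rewrite -zv scalerA mulVf// scale1r.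
      by apply/HZ/HY.
    by rewrite zv (_ : pi v = 0) ?subr0.
  have HB v : H v -> H (B v).
    move=> Hv; have /eqP := BK v; rewrite subr_eq => /eqP zB.
    have -> : B v = (z ^+ N)^-1 *: (z ^+ N *: B v) by rewrite scalerA mulVf// scale1r.
    by apply: HZ; rewrite zB; apply: HA => //; exact: HY.
  pose U v := gsum z T N (B v).
  have bU : bdlin U by exact: bdlin_comp (bdlin_gsum z N bT) bB.
  have HU v : H v -> H (U v).
    move=> /HB; rewrite /U /gsum; move: (B v) => b Hb.
    elim/big_ind : _ => // j _; apply: HZ.
    by elim: (nat_of_ord j) => //= m ih; exact: HT.
  have zU v : H v -> z *: U v - T (U v) = v.
    move=> Hv; rewrite gsumE -/(Y _); last exact: bT.1.
    by rewrite -[RHS](BK v) (HB _ Hv : pi (B v) = 0) subr0.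
  exists U; split; [split=> //|].
  - by move=> a u v _ _; rewrite bU.1.
  - have [M _ UM] := bdlin_ub bU; exists M => v _.
    by rewrite !nmE -rmorphM/= lecR.
  (* [U (z *: v - T v)] and [v] have the same image under [z - T]; their difference [u] satisfies
     [Y u = z ^+ N *: u], so it vanishes by [injH]. *)
  - move=> v Hv; split; last exact: zU.
    have HzT : H (z *: v - T v) by apply: HB0; [exact: HZ|exact: HT].
    have := zU _ HzT; set u := U _ => zu.
    have Hu : H u by exact: HU.
    have Tuv : T (u - v) = z *: (u - v).
      rewrite (linB bT.1) scalerBr; apply/eqP; rewrite -subr_eq0 -oppr_eq0 opprB.
      by rewrite opprD addrACA zu -opprD subrr.
    have Yuv : Y (u - v) = z ^+ N *: (u - v).
      rewrite /Y; elim: (N) => [|n ih]; first by rewrite expr0 scale1r.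
      by rewrite iterS ih (linZ bT.1) Tuv scalerA -exprSr.
    apply/eqP; rewrite -subr_eq0; apply/eqP; apply: (injH (z ^+ N)) => //.
    exact: HB0.
have dec : ess_decomposition T r2 G H.
  split; split=> //.
  - split=> [|a u v]; first exact: (lin0 bp.1).
    by rewrite /G/= => u0 v0; rewrite bp.1 u0 v0 scaler0 addr0.
  - by move=> v; rewrite /G/= pT => ->; exact: (lin0 bT.1).
  - split=> [v|]; first by exists (pi v), (v - pi v); split=> //; rewrite addrC subrK.
    apply/seteqP; split=> v /=; first by move=> [pv]; rewrite /H/= pi_ker.
    by move=> ->; split; [exact: (lin0 bp.1)|].
  - exact: closed_bdlin_ker.
  - apply: (@le_lt_trans _ _ r1) => //; rewrite /spectral_radius_on.
    set A := [set _ | _ in _].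
    have Ar x : A x -> x <= r1.
      by move=> [z zs' <-]; rewrite leNgt; apply/negP => /ltW/res.
    have [A0|/set0P A0] := eqVneq A set0; last exact: ge_sup.
    by rewrite A0 sup0; lra.
  - exists k, J; apply/seteqP; split=> v /=.
      by move=> pv; exists (psi^~ v); rewrite -[LHS]pi_ker.
    move=> [c ->]; rewrite /G/= (lin_sum bp.1) big1// => i _.
    by rewrite (linZ bp.1) pJ scaler0.
  - move=> z v Gv v0 Tv.
    have Yv : Y v = z ^+ N *: v.
      rewrite /Y; elim: (N) => [|n ih]; first by rewrite expr0 scale1r.
      by rewrite iterS ih (linZ bT.1) Tv scalerA -exprSr.
    (* On [v] the operator [p] is the scalar [\prod_(y <- zs) (z ^+ N - y)]; it has to vanish, so
       [z ^+ N] is one of the [zs]. *)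
    move: Gv; rewrite /G/= /p (polyop_eigen zs bY.1 Yv) => /eqP.
    rewrite scaler_eq0 (negbTE v0) orbF prodf_seq_eq0 => /hasP[y yzs /=].
    rewrite subr_eq0 => /eqP zy; have := zsr _ yzs; rewrite -zy normcX.
    by rewrite ler_pXn2r// nnegrE ?Defs.normc_ge0//; lra.
apply: (@le_trans _ _ r2); last exact: ltW.
apply: ge_inf; last by right; split; [lra|exists G, H].
exists 0 => _ [->|[h _]//]; exact: spectral_radius_ge0.
Qed.

End essential_spectral_radius.

(** * Null sequences and the complex modulus *)

Section real_sequences.
Context {R : realType}.
Implicit Types u v : nat -> R.

Lemma cvg0_le u v : (forall n, 0 <= u n <= v n) -> v @ \oo --> (0 : R) ->
  u @ \oo --> (0 : R).
Proof.
move=> uv v0; apply: squeeze_cvgr v0; last exact: cvg_cst.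
exact: nearW.
Qed.

Lemma cvg0D u v : u @ \oo --> (0 : R) -> v @ \oo --> (0 : R) ->
  (fun n => u n + v n) @ \oo --> (0 : R).
Proof. by move=> u0 v0; rewrite -[X in _ --> X]addr0; exact: cvgD. Qed.

Lemma cvg0Ml c u : u @ \oo --> (0 : R) -> (fun n => c * u n) @ \oo --> (0 : R).
Proof. by move=> u0; rewrite -(mulr0 c); apply: cvgM => //; exact: cvg_cst. Qed.

Lemma le0_cvg0 (x : R) v : (forall n, x <= v n) -> v @ \oo --> (0 : R) -> x <= 0.
Proof.
move=> xv v0; have <- := cvg_lim (@Rhausdorff R) v0.
by apply: limr_ge; [exact: cvgP v0|exact: nearW].
Qed.

Lemma near_le0_cvg0 (x : R) v n0 : (forall n, (n0 <= n)%N -> x <= v n) ->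
  v @ \oo --> (0 : R) -> x <= 0.
Proof.
move=> xv v0; have <- := cvg_lim (@Rhausdorff R) v0.
by apply: limr_ge; [exact: cvgP v0|exists n0].
Qed.

Lemma cvg0_lt (v : nat -> R) e : v @ \oo --> (0 : R) -> 0 < e -> exists n, v n < e.
Proof.
move=> /cvgrPdist_lt v0 e0; have [n _ /(_ n (leqnn n))] := v0 _ e0.
by rewrite sub0r normrN => h; exists n; exact: le_lt_trans (ler_norm _) h.
Qed.

Lemma cauchy_ub_cvg u v : (forall n k, (k <= n)%N -> `|u n - u k| <= v k) ->
  v @ \oo --> (0 : R) -> exists l, (u @ \oo --> l) /\ forall k, `|l - u k| <= v k.
Proof.
move=> uv v0; have cu : cvg (u @ \oo).
  apply/cauchy_cvgP/cauchy_exP => e e0; have [k vk] := cvg0_lt v0 e0.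
  exists (u k); rewrite /fmapE -ball_normE /ball_/=.
  by exists k => // n /= kn; rewrite distrC; exact: le_lt_trans (uv _ _ kn) vk.
exists (lim (u @ \oo)); split=> // k.
have : (fun n => `|u n - u k|) @ \oo --> `|lim (u @ \oo) - u k|.
  by apply: cvg_norm; apply: cvgB => //; exact: cvg_cst.
move=> h; have <- := cvg_lim (@Rhausdorff R) h.
apply: limr_le; first exact: cvgP h.
by exists k => // n /= /uv.
Qed.

End real_sequences.

Section complex_modulus.
Context {R : realType}.
Implicit Types z : R[i].

Lemma normc_def z : `|z| = (normc z)%:C.
Proof. by case: z. Qed.

Lemma ReZ (a : R) z : Re (a%:C * z) = a * Re z.
Proof. by rewrite Defs.ReM/= mul0r subr0. Qed.

Lemma ImZ (a : R) z : Im (a%:C * z) = a * Im z.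
Proof. by rewrite Defs.ImM/= mul0r addr0. Qed.

Lemma ReB z z' : Re (z - z') = Re z - Re z'.
Proof. by case: z; case: z'. Qed.

Lemma ImB z z' : Im (z - z') = Im z - Im z'.
Proof. by case: z; case: z'. Qed.

Lemma ge0_realE z : 0 <= z -> z = (Re z)%:C.
Proof. by case: z => a b; rewrite lecE/= => /andP[/eqP -> _]. Qed.

Lemma ge0_Re z : 0 <= z -> 0 <= Re z.
Proof. by case: z => a b; rewrite lecE/= => /andP[]. Qed.

Lemma ge0_normc z : 0 <= z -> normc z = Re z.
Proof.
by move=> z0; rewrite {1}(ge0_realE z0) normc_realC ger0_norm// ge0_Re.
Qed.

Lemma realC_ge0 (a : R) : (0 <= a%:C) = (0 <= a).
Proof. by rewrite lecR. Qed.

Lemma normcB z z' : normc (z - z') = normc (z' - z).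
Proof. by have := normrN (z' - z); rewrite opprB !normc_def => -[]. Qed.

Lemma normc_le_dist z z' : normc z <= normc z' + normc (z - z').
Proof. by rewrite -{1}(subrK z' z) [leRHS]addrC le_normcD. Qed.

End complex_modulus.

Lemma sum_ltn_ord K m : (\sum_(i < K) (i < m) = minn K m)%N.
Proof.
elim: K => [|K ih]; first by rewrite big_ord0 min0n.
rewrite big_ord_recr/= ih; have [Km|mK] := ltnP K m.
  by rewrite (minn_idPl Km) addn1.
by rewrite (minn_idPr (leqW mK)) addn0.
Qed.

(** * Bounded measurable functions and bounded pointwise convergence *)

Section bounded_functions.
Context {R : realType} {d} {E : measurableType d}.
Implicit Types (f g : bmfun R E) (A : set E).

Lemma bm_cmeas f : cmeasurable f.
Proof. by have /bmpredP[] := bmvalP f. Qed.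

Lemma bm_bounded f : exists2 M, 0 <= M & forall x, normc (f x) <= M.
Proof.
exists (supnorm f); last exact: supnorm_ub.
exact: le_trans (Defs.normc_ge0 _) (supnorm_ub f point).
Qed.

Lemma nm_bm f : nm f = supnorm f.
Proof. by []. Qed.

Lemma bm_ext f g : (forall x, f x = g x) -> f = g.
Proof. by move=> fg; apply: val_inj; apply/funext. Qed.

Lemma bmDE f g x : (f + g) x = f x + g x. Proof. by []. Qed.
Lemma bmBE f g x : (f - g) x = f x - g x. Proof. by []. Qed.
Lemma bmZE (a : R[i]) f x : (a *: f) x = a * f x. Proof. by []. Qed.
Lemma bm0E x : (0 : bmfun R E) x = 0. Proof. by []. Qed.

Lemma bm_sumE n (F : 'I_n -> bmfun R E) x :
  (\sum_(i < n) F i) x = \sum_(i < n) F i x.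
Proof. by elim/big_rec2 : _ => // i y z _ <-. Qed.

Definition bmcst (a : R[i]) : bmfun R E := BMFun (bmpred_cst E a).

Definition bmmul f g : bmfun R E := BMFun (bmpredM (bmvalP f) (bmvalP g)).

Lemma bmcstE a x : bmcst a x = a. Proof. by []. Qed.

Lemma bmmulE f g x : bmmul f g x = f x * g x. Proof. by []. Qed.

Lemma real_bmpred (u : E -> R) (M : R) : measurable_fun setT u ->
  (forall x, `|u x| <= M) -> (fun x => (u x)%:C) \in bmpred.
Proof.
move=> mu uM; apply/bmpredP; split; first by split => //; exact: measurable_cst.
by exists M => x; rewrite normc_realC.
Qed.

Lemma measurable_normc f : measurable_fun setT (fun x => normc (f x)).
Proof.
have [mr mi] := bm_cmeas f.
rewrite (_ : (fun _ => _) = fun x => Num.sqrt (Re (f x) ^+ 2 + Im (f x) ^+ 2)).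
  apply: (measurableT_comp (continuous_measurable_fun (@sqrt_continuous R))).
  by apply: measurable_funD; exact: measurable_funX.
by apply/funext => x; case: (f x).
Qed.

Lemma bmabs_subproof f : (fun x => (normc (f x))%:C) \in bmpred.
Proof.
apply: (@real_bmpred _ (supnorm f)); first exact: measurable_normc.
by move=> x; rewrite ger0_norm ?Defs.normc_ge0// supnorm_ub.
Qed.

Definition bmabs f := BMFun (bmabs_subproof f).

Lemma bmabsE f x : bmabs f x = (normc (f x))%:C. Proof. by []. Qed.

Lemma bmre_subproof f : (fun x => (Re (f x))%:C) \in bmpred.
Proof.
apply: (@real_bmpred _ (supnorm f)); first by have [] := bm_cmeas f.
by move=> x; rewrite (le_trans (Re_le_normc _))// supnorm_ub.
Qed.

Definition bmre f := BMFun (bmre_subproof f).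

Lemma bmreE f x : bmre f x = (Re (f x))%:C. Proof. by []. Qed.

Lemma bmim_subproof f : (fun x => (Im (f x))%:C) \in bmpred.
Proof.
apply: (@real_bmpred _ (supnorm f)); first by have [] := bm_cmeas f.
by move=> x; rewrite (le_trans (Im_le_normc _))// supnorm_ub.
Qed.

Definition bmim f := BMFun (bmim_subproof f).

Lemma bm_ReIm f : f = bmre f + 'i *: bmim f.
Proof. by apply: bm_ext => x; rewrite bmDE bmZE [LHS]complexE. Qed.

Lemma bmind_subproof A : (fun x => (\1_(if `[< measurable A >] then A else set0) x : R)%:C)
  \in bmpred.
Proof.
apply: (@real_bmpred _ 1).
  by apply: measurable_indic; case: asboolP => // _; exact: measurable0.
by move=> x; rewrite indicE; case: (_ \in _); rewrite ?normr0 ?normr1.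
Qed.

(* Zero when [A] is not measurable. *)
Definition bmind A := BMFun (bmind_subproof A).

Lemma bmindE A x : measurable A -> bmind A x = (x \in A)%:R.
Proof.
by move=> mA; rewrite /bmind/= asboolT// indicE; case: (_ \in _); rewrite ?rmorph1 ?rmorph0.
Qed.

Lemma bmind_ge0 A x : 0 <= bmind A x.
Proof. by rewrite /= realC_ge0 indicE. Qed.

(** The mode of convergence under which integrals against finite measures pass to the limit, by
    dominated convergence. *)
Definition bpcvg (f_ : nat -> bmfun R E) f :=
  (exists M, forall n x, normc (f_ n x) <= M) /\
  forall x, (fun n => normc (f_ n x - f x)) @ \oo --> (0 : R).

(* [n.+1^-1 * floor (n.+1 * u)] is a sum of indicators of [{k+1 <= n.+1 * u}]. *)
Lemma bm_approx f : (forall x, 0 <= f x) ->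
  exists (c : nat -> R) (K : nat -> nat) (A : nat -> nat -> set E),
  [/\ forall n, 0 <= c n, forall n k, measurable (A n k)
    & bpcvg (fun n => \sum_(k < K n) (c n)%:C *: bmind (A n k)) f].
Proof.
move=> f0; pose u x := Re (f x); have u0 x : 0 <= u x by exact: ge0_Re.
have fu x : f x = (u x)%:C by exact: ge0_realE.
have [M M0 fM] := bm_bounded f.
have uM x : u x <= M by rewrite (le_trans _ (fM x))// ge0_normc.
pose c n : R := n.+1%:R^-1; have c0 n : 0 <= c n by rewrite invr_ge0.
pose K n := Num.truncn (n.+1%:R * M).
pose A n k := [set x | k.+1%:R <= n.+1%:R * u x].
have mA n k : measurable (A n k).
  have mu : measurable_fun setT (fun x => n.+1%:R * u x).
    by apply: measurable_funM => //; exact: (bm_cmeas f).1.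
  rewrite (_ : A n k = setT `&` (fun x => n.+1%:R * u x) @^-1` `[k.+1%:R, +oo[%classic).
    by apply: mu => //; exact: measurable_itv.
  by rewrite setTI; apply/seteqP; split=> x /=; rewrite in_itv/= andbT.
exists c, K, A; split=> //.
have sE n x : (\sum_(k < K n) (c n)%:C *: bmind (A n k)) x =
    (c n * (Num.truncn (n.+1%:R * u x))%:R)%:C.
  rewrite bm_sumE (eq_bigr (fun k : 'I_(K n) =>
      (c n)%:C * ((k < Num.truncn (n.+1%:R * u x))%N)%:R)); last first.
    move=> k _; rewrite bmZE bmindE//; congr (_ * (nat_of_bool _)%:R).
    by rewrite truncn_gt_nat; apply/idP/idP => [/set_mem//|h]; apply/mem_set.
  rewrite -mulr_sumr rmorphM/=; congr (_ * _); rewrite -natr_sum rmorph_nat.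
  congr (_%:R); rewrite sum_ltn_ord; apply/minn_idPr; apply: le_truncn.
  exact: ler_wpM2l.
split.
- exists M => n x; rewrite sE normc_realC ger0_norm ?mulr_ge0//.
  rewrite -ler_pdivlMl ?invr_gt0// invrK.
  rewrite (le_trans (y := n.+1%:R * u x))// ?truncn_le ?mulr_ge0//.
  by rewrite ler_wpM2l.
- move=> x; apply: (@cvg0_le _ _ c); last first.
    by rewrite /c; exact: cvg_harmonic.
  move=> n; rewrite Defs.normc_ge0/= sE fu -rmorphB normc_realC.
  have := truncn_itv (mulr_ge0 (ler0n R n.+1) (u0 x)).
  rewrite -natr1; set t := _%:R; set m : R := n.+1%:R => /andP[h1 h2].
  have m0 : 0 < m by rewrite ltr0n.
  rewrite -[leRHS]mulr1 [u x](_ : _ = c n * (m * u x)); last first.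
    by rewrite mulrA mulVf ?mul1r// gt_eqF.
  rewrite -mulrBr normrM (ger0_norm (c0 n)) ler_wpM2l//.
  by rewrite ler_norml; apply/andP; split; lra.
Qed.

End bounded_functions.

(** * Positive operators continuous for bounded pointwise convergence *)

Section positive_operators.
Context {R : realType} {d} {E : measurableType d}.
Local Notation B := (bmfun R E).
Implicit Types (f g h : B) (V W : B -> B).

Definition posop V := lin V /\ forall f, (forall x, 0 <= f x) -> forall x, 0 <= V f x.

(** For a positive operator this encodes countable additivity. It is stable under composition, so
    powers of a kernel operator are handled without constructing the kernel of the power. *)
Definition bpcont V := forall (f_ : nat -> B) f, bpcvg f_ f -> bpcvg (fun n => V (f_ n)) (V f).

Lemma posop_le V f g : posop V -> (forall x, f x <= g x) -> forall x, V f x <= V g x.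
Proof.
move=> [lV pV] fg x; rewrite -subr_ge0 -bmBE -(linB lV); apply: pV => y.
by rewrite bmBE subr_ge0.
Qed.

Lemma posop_le_Re V f g : posop V -> (forall x, f x <= g x) -> forall x,
  Re (V f x) <= Re (V g x).
Proof. by move=> pV fg x; have := posop_le pV fg x; rewrite lecE => /andP[]. Qed.

Lemma bmabs_ge0 f x : 0 <= bmabs f x.
Proof. by rewrite bmabsE realC_ge0 Defs.normc_ge0. Qed.

Lemma posop_abs_ge0 V f x : posop V -> 0 <= Re (V (bmabs f) x).
Proof. by move=> pV; apply/ge0_Re/pV.2 => y; exact: bmabs_ge0. Qed.

Lemma Im_ge0 (z : R[i]) : 0 <= z -> Im z = 0.
Proof. by case: z => a b; rewrite lecE/= => /andP[/eqP]. Qed.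

Lemma posop_real V f x : posop V -> (forall y, Im (f y) = 0) -> Im (V f x) = 0.
Proof.
move=> pV f0; have -> : f = (bmabs f + f) - bmabs f by rewrite addrC addKr.
rewrite (linB pV.1) bmBE ImB (Im_ge0 (pV.2 (bmabs f) (bmabs_ge0 f) x)) subr0.
apply: Im_ge0; apply: pV.2 => y; rewrite bmDE bmabsE.
have := f0 y; case: (f y) => a b /= ->.
by rewrite lecE/= addr0 eqxx/= expr0n/= addr0 sqrtr_sqr -lerBlDr sub0r -normrN ler_norm.
Qed.

Lemma posop_Re V f x : posop V -> Re (V f x) = Re (V (bmre f) x).
Proof.
move=> pV; rewrite {1}(bm_ReIm f) (linD pV.1) (linZ pV.1) bmDE bmZE.
rewrite ReD ['i * _]mulrC ReiNIm (posop_real (f := bmim f))// oppr0 addr0//.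
Qed.

Lemma posop_abs V f x : posop V -> normc (V f x) <= Re (V (bmabs f) x).
Proof.
move=> pV; have [->|z0] := eqVneq (V f x) 0; first by rewrite normc0 posop_abs_ge0.
set z := V f x in z0 *; have nz0 : normc z != 0 by apply: contra z0 => /eqP/eq0_normc ->.
(* A rotation making [a * V f x] equal to the modulus of [V f x]; after it, comparing real parts is
   enough. *)
pose a := conjc z / (normc z)%:C.
have az : a * z = (normc z)%:C.
  rewrite /a mulrAC [conjc z * z](_ : _ = (normc z)%:C * (normc z)%:C).
    by rewrite mulfK// fmorph_eq0.
  rewrite -rmorphM/= -expr2; case: (z) => u v /=.
  rewrite sqr_sqrtr ?addr_ge0 ?sqr_ge0//; simpc.
  by rewrite -!expr2 [v * u]mulrC subrr.
have na : normc a = 1.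
  apply: (mulIf nz0); rewrite mul1r -normcM az normc_realC ger0_norm//.
  exact: Defs.normc_ge0.
rewrite -[normc z]/(Re (normc z)%:C) -az -bmZE -(linZ pV.1) (posop_Re (a *: f) x pV).
apply: posop_le_Re => // y; rewrite bmreE bmabsE lecR bmZE.
by rewrite (le_trans (ler_norm _))// (le_trans (Re_le_normc _))// normcM na mul1r.
Qed.

Lemma posop_dom V f g x : posop V -> (forall y, (normc (f y))%:C <= g y) ->
  normc (V f x) <= Re (V g x).
Proof.
by move=> pV fg; rewrite (le_trans (posop_abs _ _ pV))//; exact: posop_le_Re.
Qed.

Lemma bmcst_scale (a : R[i]) : bmcst a = a *: (bmcst 1 : B).
Proof. by apply: bm_ext => x; rewrite bmZE mulr1. Qed.

Lemma posop_supnorm V f x (M : R) : posop V -> (forall y, normc (f y) <= M) ->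
  normc (V f x) <= M * Re (V (bmcst 1) x).
Proof.
move=> pV fM; rewrite -ReZ -bmZE -(linZ pV.1) -bmcst_scale.
by apply: posop_dom => // y; rewrite bmcstE lecR.
Qed.

Lemma posop_bdlin V : posop V -> bdlin V.
Proof.
move=> pV; split; first exact: pV.1.
have [M M0 VM] := bm_bounded (V (bmcst 1)).
exists M => f; rewrite !nm_bm; apply: supnorm_le => x.
rewrite (le_trans (posop_supnorm x pV (supnorm_ub f)))// mulrC.
rewrite ler_wpM2r ?nm_ge0// -?nm_bm ?nm_ge0//.
by rewrite (le_trans (ler_norm _))// (le_trans (Re_le_normc _)).
Qed.

Lemma posop_comp V W : posop V -> posop W -> posop (fun f => V (W f)).
Proof.
move=> pV pW; split; first exact: lin_comp pV.1 pW.1.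
by move=> f f0; apply: pV.2; exact: pW.2.
Qed.

Lemma posop_iter V n : posop V -> posop (iter n V).
Proof.
move=> pV; elim: n => [|n ih]; first by split.
exact: (posop_comp pV ih).
Qed.

Lemma bpcont_comp V W : bpcont V -> bpcont W -> bpcont (fun f => V (W f)).
Proof. by move=> cV cW f_ f /cW/cV. Qed.

Lemma bpcont_iter V n : bpcont V -> bpcont (iter n V).
Proof. by move=> cV; elim: n => [f_ f//|n ih f_ f /ih/cV]. Qed.

Lemma bpcvgD (f_ : nat -> B) f (g_ : nat -> B) g : bpcvg f_ f -> bpcvg g_ g -> bpcvg (fun n => f_ n + g_ n) (f + g).
Proof.
move=> [[M fM] cf] [[N gN] cg]; split.
  by exists (M + N) => n x; rewrite bmDE (le_trans (le_normcD _ _))// lerD.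
move=> x; have h := cvg0D (cf x) (cg x).
apply: cvg0_le h => n; rewrite Defs.normc_ge0 andTb !bmDE opprD addrACA.
exact: le_normcD.
Qed.

Lemma bpcvgZ (a : R[i]) (f_ : nat -> B) f : bpcvg f_ f -> bpcvg (fun n => a *: f_ n) (a *: f).
Proof.
move=> [[M fM] cf]; split.
  by exists (normc a * M) => n x; rewrite bmZE normcM ler_wpM2l// Defs.normc_ge0.
move=> x; have h := cvg0Ml (normc a) (cf x).
apply: cvg0_le h => n; rewrite Defs.normc_ge0 andTb !bmZE -mulrBr.
by rewrite normcM.
Qed.

Lemma bpcvgM (f_ : nat -> B) f g : bpcvg f_ f -> bpcvg (fun n => bmmul (f_ n) g) (bmmul f g).
Proof.
move=> [[M fM] cf]; split.
  exists (M * supnorm g) => n x; rewrite bmmulE normcM ler_pM ?Defs.normc_ge0//.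
  exact: supnorm_ub.
move=> x; have h := cvg0Ml (normc (g x)) (cf x).
apply: cvg0_le h => n; rewrite Defs.normc_ge0 andTb !bmmulE -mulrBl.
by rewrite normcM mulrC.
Qed.

Lemma bpcontB V W : bpcont V -> bpcont W -> bpcont (fun f => V f - W f).
Proof.
move=> cV cW f_ f ff; have h := bpcvgD (cV _ _ ff) (bpcvgZ (-1) (cW _ _ ff)).
rewrite [X in bpcvg X _](_ : _ = fun n => V (f_ n) + (- 1) *: W (f_ n)).
  by rewrite -(scaleN1r (W f)).
by apply/funext => n; rewrite scaleN1r.
Qed.

Lemma bpcvg_abs (f_ : nat -> B) f : bpcvg f_ f -> bpcvg (fun n => bmabs (f_ n - f)) 0.
Proof.
move=> [[M fM] cf]; split.
  exists (M + supnorm f) => n x; rewrite bmabsE normc_realC ger0_norm ?Defs.normc_ge0//.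
  rewrite bmBE (le_trans (le_normcD _ _))// lerD//.
  have -> : normc (- f x) = normc (f x) by rewrite -(sub0r (f x)) normcB subr0.
  exact: supnorm_ub.
move=> x; apply: cvg0_le (cf x) => n.
by rewrite Defs.normc_ge0 andTb bm0E subr0 bmabsE normc_realC ger0_norm ?Defs.normc_ge0.
Qed.

Lemma posop_bpcont V : posop V ->
  (forall g_ : nat -> B, (exists M, forall n x, normc (g_ n x) <= M) ->
    (forall x, (fun n => Re (g_ n x)) @ \oo --> (0 : R)) ->
    forall x, (fun n => Re (V (g_ n) x)) @ \oo --> (0 : R)) -> bpcont V.
Proof.
move=> pV cV f_ f ff; have [[M fM] cf] := ff; split.
  have [N N0 VN] := bm_bounded (V (bmcst 1)).
  exists (M * N) => n x; rewrite (le_trans (posop_supnorm x pV (fM n)))//.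
  rewrite ler_wpM2l//; first exact: le_trans (Defs.normc_ge0 _) (fM 0%N point).
  by rewrite (le_trans (ler_norm _))// (le_trans (Re_le_normc _)).
move=> x; have [[K bK] cK] := bpcvg_abs ff.
apply: (@cvg0_le _ _ (fun n => Re (V (bmabs (f_ n - f)) x))).
  by move=> n; rewrite Defs.normc_ge0 andTb -bmBE -(linB pV.1) posop_abs.
apply: cV; first by exists K.
move=> y; apply: cvg0_le (cK y) => n.
by rewrite bm0E subr0 bmabsE normc_realC ger0_norm ?Defs.normc_ge0//= Defs.normc_ge0 lexx.
Qed.

End positive_operators.

(** * Kernel operators are positive and continuous *)

Section kernel_operators.
Context {R : realType} {d} {E : measurableType d}.
Local Notation B := (bmfun R E).
Implicit Types (f g h : B) (Q : R.-fker E ~> E).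

Lemma fker_lty Q x : (Q x setT < +oo)%E.
Proof. by have [r Qr] := measure_uub Q; rewrite (lt_trans (Qr x))// ltry. Qed.

Lemma bounded_integrable (mu : {measure set E -> \bar R}) (u : E -> R) (M : R) :
  (mu setT < +oo)%E -> measurable_fun setT u -> (forall x, `|u x| <= M) ->
  mu.-integrable setT (EFin \o u).
Proof.
move=> muoo mu_ uM; apply: measurable_bounded_integrable => //.
by exists M; split=> [|N MN x _]; [exact: num_real|exact: le_trans (uM x) (ltW MN)].
Qed.

Lemma Re_integrable Q x f : (Q x).-integrable setT (EFin \o (fun y => Re (f y))).
Proof.
apply: (@bounded_integrable _ _ (supnorm f)); first exact: fker_lty.
  exact: (bm_cmeas f).1.
by move=> y; rewrite (le_trans (Re_le_normc _))// supnorm_ub.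
Qed.

Lemma Im_integrable Q x f : (Q x).-integrable setT (EFin \o (fun y => Im (f y))).
Proof.
apply: (@bounded_integrable _ _ (supnorm f)); first exact: fker_lty.
  exact: (bm_cmeas f).2.
by move=> y; rewrite (le_trans (Im_le_normc _))// supnorm_ub.
Qed.

Lemma kop_Re Q f x : Re (kop Q f x) = \int[Q x]_y Re (f y).
Proof. by []. Qed.

Lemma kop_Im Q f x : Im (kop Q f x) = \int[Q x]_y Im (f y).
Proof. by []. Qed.

Lemma complex_ext (z w : R[i]) : Re z = Re w -> Im z = Im w -> z = w.
Proof. by case: z; case: w => a b a' b' /= -> ->. Qed.

Lemma kop_posop Q : posop (kop Q).
Proof.
have lD f g x (F : R[i] -> R) : (forall z w, F (z + w) = F z + F w) ->
    (forall f, (Q x).-integrable setT (EFin \o (fun y => F (f y)))) ->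
    \int[Q x]_y F ((f + g) y) = \int[Q x]_y F (f y) + \int[Q x]_y F (g y).
  by move=> FD Fi; under eq_Rintegral do rewrite bmDE FD; exact: RintegralD.
split=> [a f g|f f0 x].
  have D u v x : kop Q (u + v) x = kop Q u x + kop Q v x.
    apply: complex_ext; rewrite ?ReD ?ImD ?kop_Re ?kop_Im.
      by apply: lD => [z w|h]; [exact: ReD|exact: Re_integrable].
    by apply: lD => [z w|h]; [exact: ImD|exact: Im_integrable].
  have rI (u : B) (c : R) x : (Q x).-integrable setT (EFin \o (fun y => c * Re (u y))).
    by have := integrableZl measurableT c (Re_integrable Q x u).
  have iI (u : B) (c : R) x : (Q x).-integrable setT (EFin \o (fun y => c * Im (u y))).
    by have := integrableZl measurableT c (Im_integrable Q x u).
  have Z (u : B) x : kop Q (a *: u) x = a * kop Q u x.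
    apply: complex_ext.
      rewrite Defs.ReM !kop_Re kop_Im; under eq_Rintegral do rewrite bmZE Defs.ReM.
      rewrite RintegralB// !RintegralZl//; [exact: Im_integrable|exact: Re_integrable].
    rewrite Defs.ImM !kop_Im kop_Re; under eq_Rintegral do rewrite bmZE Defs.ImM.
    by rewrite RintegralD// !RintegralZl//; [exact: Re_integrable|exact: Im_integrable].
  by apply: bm_ext => x; rewrite D Z.
rewrite lecE kop_Re kop_Im; apply/andP; split.
  under eq_Rintegral do rewrite (Im_ge0 (f0 _)).
  by rewrite Rintegral_cst// mul0r.
by apply: Rintegral_ge0 => y _; exact: ge0_Re.
Qed.

Lemma kop_bpcont Q : bpcont (kop Q).
Proof.
apply: posop_bpcont => [|g_ [M gM] cg x]; first exact: kop_posop.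
rewrite (_ : 0 = fine 0%E)//; apply: fine_cvg.
rewrite [X in _ --> X](_ : _ = \int[Q x]_y (cst 0%E y))%E; last by rewrite integral0.
apply: (@dominated_cvg _ _ _ _ _ measurableT _ _ (fun=> M%:E)) => //.
- by move=> n; apply/measurable_EFinP; exact: (bm_cmeas (g_ n)).1.
- by move=> y _; apply: cvg_EFin => //; [exact: nearW|exact: cg].
- apply: (@bounded_integrable _ (fun=> M) `|M|) => //; exact: fker_lty.
- by move=> n y _; rewrite lee_fin (le_trans (Re_le_normc _)).
Qed.

End kernel_operators.

(** * Completeness and the monotone class theorem for bounded functions *)

Section limits.
Context {R : realType} {d} {E : measurableType d}.
Local Notation B := (bmfun R E).
Implicit Types (f g h : B) (V W : B -> B).

Lemma bm_cauchy_limit (f_ : nat -> B) (e : nat -> E -> R) (M : R) :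
  (forall n x, normc (f_ n x) <= M) ->
  (forall x n k, (k <= n)%N -> normc (f_ n x - f_ k x) <= e k x) ->
  (forall x, e ^~ x @ \oo --> (0 : R)) ->
  exists f, forall k x, normc (f x - f_ k x) <= e k x.
Proof.
move=> fM fe e0.
have /choice[r rP] : forall x, exists l : R, ((fun n => Re (f_ n x)) @ \oo --> l) /\
    forall k, `|l - Re (f_ k x)| <= e k x.
  move=> x; apply: cauchy_ub_cvg (e0 x) => n k kn.
  by rewrite -ReB (le_trans (Re_le_normc _))// fe.
have /choice[i iP] : forall x, exists l : R, ((fun n => Im (f_ n x)) @ \oo --> l) /\
    forall k, `|l - Im (f_ k x)| <= e k x.
  move=> x; apply: cauchy_ub_cvg (e0 x) => n k kn.
  by rewrite -ImB (le_trans (Im_le_normc _))// fe.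
pose l x : R[i] := r x +i* i x.
have l2 k x : normc (l x - f_ k x) <= e k x + e k x.
  rewrite (le_trans (normc_le_ReIm _))// ReB ImB/= lerD//.
    by have [_] := rP x.
  by have [_] := iP x.
have lM x : normc (l x) <= M.
  rewrite -subr_le0; apply: le0_cvg0 (cvg0D (e0 x) (e0 x)) => n.
  rewrite lerBlDl (le_trans (normc_le_dist _ (f_ n x)))// lerD//.
have ml : cmeasurable l.
  split; [apply: (@measurable_fun_cvg _ _ _ _ (fun n x => Re (f_ n x)))|
          apply: (@measurable_fun_cvg _ _ _ _ (fun n x => Im (f_ n x)))].
  - by move=> n; have [] := bm_cmeas (f_ n).
  - by move=> x _; have [] := rP x.
  - by move=> n; have [] := bm_cmeas (f_ n).
  - by move=> x _; have [] := iP x.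
have bl : (l : E -> R[i]^o) \in bmpred by apply/bmpredP; split=> //; exists M.
exists (BMFun bl) => k x; rewrite -subr_le0.
apply: (near_le0_cvg0 (n0 := k)) (cvg0D (e0 x) (e0 x)) => n kn.
rewrite lerBlDl (le_trans (normc_le_dist _ (f_ n x - f_ k x)))// lerD ?fe//.
by rewrite opprB addrA subrK.
Qed.

Lemma bm_geom_complete : @geom_complete R B.
Proof.
move=> u C q q0 q1 uC; pose S n := \sum_(i < n) u i.
have q10 : 0 < 1 - q by rewrite subr_gt0.
have C0 : 0 <= C by have := uC 0%N; rewrite expr0 mulr1; apply: le_trans (nm_ge0 _).
(* Keeping the term [- q ^+ n] lets the induction close with an equality. *)
have SS n k : (k <= n)%N -> nm (S n - S k) <= C * (q ^+ k - q ^+ n) / (1 - q).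
  elim: n => [|n ih]; first by rewrite leqn0 => /eqP ->; rewrite !subrr nm0 mulr0 mul0r.
  rewrite leq_eqVlt => /predU1P[->|/ih{}ih]; first by rewrite !subrr nm0 mulr0 mul0r.
  rewrite /S big_ord_recr/= addrAC (le_trans (nmD _ _))//.
  rewrite (le_trans (lerD ih (uC n)))// exprS.
  by rewrite le_eqVlt; apply/orP; left; apply/eqP; field; rewrite gt_eqF.
pose e k (_ : E) := C * q ^+ k / (1 - q).
have Se n k : (k <= n)%N -> nm (S n - S k) <= C * q ^+ k / (1 - q).
  move=> /SS/le_trans; apply; rewrite ler_pM2r ?invr_gt0// ler_wpM2l//.
  by rewrite gerBl exprn_ge0.
have [|||s sP] := @bm_cauchy_limit S e (C / (1 - q)).
- move=> n x; rewrite (le_trans (supnorm_ub _ x))// -nm_bm.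
  by have := Se n 0%N isT; rewrite /S big_ord0 subr0 expr0 mulr1.
- by move=> x n k kn; rewrite -bmBE (le_trans (supnorm_ub _ x))// -nm_bm Se.
- move=> x; rewrite (_ : e ^~ x = fun k => (C / (1 - q)) * q ^+ k); last first.
    by apply/funext => k; rewrite /e mulrAC.
  by apply: cvg0Ml; apply: cvg_expr; rewrite ger0_norm.
exists s => n; rewrite nm_bm; apply: supnorm_le => x.
by rewrite bmBE sP.
Qed.

Lemma bmind_setT : bmind setT = bmcst 1 :> B.
Proof. by apply: bm_ext => x; rewrite bmindE// in_setT. Qed.

(** The functional monotone class theorem for a pi-system [G]: Dynkin's theorem extends [P] to all
    indicators, and these generate every function through sums and bounded pointwise limits. *)
Lemma bmfun_ind (G : set (set E)) (P : B -> Prop) :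
  @measurable _ E = <<s G >> -> setI_closed G -> P (bmcst 1) ->
  (forall A, G A -> P (bmind A)) ->
  (forall (a : R[i]) f g, P f -> P g -> P (a *: f + g)) ->
  (forall (f_ : nat -> B) f, bpcvg f_ f -> (forall n, P (f_ n)) -> P f) ->
  forall f, P f.
Proof.
move=> GE GI P1 PG PD Plim.
have P0 : P 0 by have := PD (-1) _ _ P1 P1; rewrite scaleN1r addNr.
have PZ a f : P f -> P (a *: f) by move=> Pf; rewrite -[_ *: _]addr0; exact: PD.
have PA f g : P f -> P g -> P (f + g) by move=> Pf Pg; rewrite -[f]scale1r; exact: PD.
have Pind A : measurable A -> P (bmind A).
  rewrite GE; apply: (@dynkin_induction _ _ G (fun A => P (bmind A))) => //.
  - by rewrite bmind_setT.
  - move=> S mS PS; rewrite (_ : bmind (~` S) = -1 *: bmind S + bmcst 1); first exact: PD.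
    apply: bm_ext => x; rewrite bmDE bmZE !bmindE//; last exact: measurableC.
    by rewrite in_setC bmcstE; case: (x \in S); rewrite /= ?mulr1 ?mulr0 ?addNr ?add0r.
  - move=> F mF tF PF.
    have mU n : measurable (\big[setU/set0]_(i < n) F i) by exact: bigsetU_measurable.
    have mUF : measurable (\bigcup_k F k) by exact: bigcupT_measurable.
    apply: (Plim (fun n => bmind (\big[setU/set0]_(i < n) F i))); last first.
      elim=> [|n ih]; first rewrite big_ord0 (_ : bmind set0 = 0)//.
        by apply: bm_ext => x; rewrite bmindE// in_set0.
      rewrite (_ : bmind _ = bmind (\big[setU/set0]_(i < n) F i) + bmind (F n)).
        exact: PA.
      apply: bm_ext => x; rewrite bmDE !bmindE// big_ord_recr/= in_setU.
      have [xU|] := boolP (x \in \big[setU/set0]_(i < n) F i); last by rewrite add0r.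
      rewrite (_ : x \in F n = false) ?addr0//; apply/negP => /set_mem xn.
      move/set_mem: xU; rewrite -bigcup_mkord => -[k /= kn xk].
      by have kn' := tF k n I I (ex_intro _ x (conj xk xn)); rewrite kn' ltnn in kn.
    split; first by exists 1 => n x; rewrite bmindE//; case: (_ \in _); rewrite ?normc1 ?normc0.
    move=> x; have [/set_mem[k _ xk]|nx] := boolP (x \in \bigcup_k F k).
      apply: cvg_near_cst; exists k.+1 => // n kn.
      rewrite !bmindE// (mem_set (_ : (\bigcup_k F k) x)); last by exists k.
      rewrite mem_set ?subrr ?normc0//.
      by rewrite -bigcup_mkord; exists k.
    apply: cvg_near_cst; apply: nearW => n.
    rewrite !bmindE// (negbTE nx) (_ : _ \in _ = false) ?subrr ?normc0//.
    apply/negP => /set_mem; rewrite -bigcup_mkord => -[k _ xk].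
    by move/negP: nx; apply; apply/mem_set; exists k.
have Ppos f : (forall x, 0 <= f x) -> P f.
  move=> /bm_approx[c [K [A [c0 mA cf]]]]; apply: Plim cf _ => n.
  by elim/big_ind : _ => // k _; apply: PZ; exact: Pind.
have Preal f : (forall x, Im (f x) = 0) -> P f.
  move=> f0; rewrite (_ : f = -1 *: bmcst (supnorm f)%:C + (f + bmcst (supnorm f)%:C)).
    apply: PD; first by rewrite bmcst_scale; exact: PZ.
    apply: Ppos => x; rewrite bmDE bmcstE lecE ImD/= f0 addr0 eqxx ReD/=.
    have := le_trans (Re_le_normc _) (supnorm_ub f x).
    by rewrite ler_norml => /andP[h _]; lra.
  by rewrite scaleN1r addrC addrK.
by move=> f; rewrite (bm_ReIm f); apply: PA; [|apply: PZ]; apply: Preal.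
Qed.

(** Meant for operators defined as differences, whose sign is visible on sets only. *)
Lemma posop_ind W : lin W -> bpcont W ->
  (forall A x, measurable A -> 0 <= W (bmind A) x) -> posop W.
Proof.
move=> lW cW W0; split=> // f /bm_approx[c [K [A [c0 mA cf]]]] x.
have [_ /(_ x) h] := cW _ _ cf; set f_ := (fun n => \sum_(k < _) _) in cf h.
have p n : 0 <= W (f_ n) x.
  rewrite /f_ (lin_sum lW) bm_sumE; apply: sumr_ge0 => k _.
  by rewrite (linZ lW) bmZE mulr_ge0 ?realC_ge0// W0.
rewrite lecE; apply/andP; split.
  rewrite -normr_eq0 eq_le normr_ge0 andbT; apply: le0_cvg0 h => n.
  by rewrite (le_trans _ (Im_le_normc _))// ImB (Im_ge0 (p n)) sub0r normrN.
rewrite -oppr_le0; apply: le0_cvg0 h => n.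
rewrite (le_trans _ (Re_le_normc _))// ReB (le_trans _ (ler_norm _))//.
by rewrite lerDr; exact/ge0_Re/(p n).
Qed.

Lemma kop_ind (Q : R.-fker E ~> E) A x : measurable A ->
  kop Q (bmind A) x = (fine (Q x A))%:C.
Proof.
move=> mA; apply: complex_ext => /=.
  rewrite /Rintegral; congr fine.
  by rewrite asboolT// integral_indic// setIT.
by rewrite Rintegral_cst// mul0r.
Qed.

End limits.

(** * Densities on the product space and their approximation by sums of products *)

Section kernels_on_products.
Context {R : realType} {d} {E : measurableType d}.
Local Notation B := (bmfun R E).
Local Notation B2 := (bmfun R (E * E)%type).
Implicit Types (f g h a b : B) (q : B2) (V W : B -> B) (Q : R.-fker E ~> E).

Lemma bmsec_subproof q x : (fun y => q (x, y)) \in bmpred.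
Proof.
have [mr mi] := bm_cmeas q; apply/bmpredP; split.
  by split; [apply: (measurableT_comp mr)|apply: (measurableT_comp mi)].
by exists (supnorm q) => y; exact: supnorm_ub.
Qed.

Definition bmsec q x : B := BMFun (bmsec_subproof q x).

Lemma bmsecE q x y : bmsec q x y = q (x, y). Proof. by []. Qed.

Lemma bmfst_subproof a : (fun z : E * E => a z.1) \in bmpred.
Proof.
have [mr mi] := bm_cmeas a; apply/bmpredP; split.
  by split; [apply: (measurableT_comp mr)|apply: (measurableT_comp mi)].
by exists (supnorm a) => y; exact: supnorm_ub.
Qed.

Definition bmtens a b : B2 := bmmul (BMFun (bmfst_subproof a)) (BMFun (bm_snd b)).

Lemma bmtensE a b x y : bmtens a b (x, y) = a x * b y. Proof. by []. Qed.

Lemma kopx_sec Q q f x : kopx Q q f x = kop Q (bmmul f (bmsec q x)) x.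
Proof. by []. Qed.

#[local] Opaque kop kopx.

Lemma bmmul_linl (a : R[i]) f h g : bmmul (a *: f + h) g = a *: bmmul f g + bmmul h g.
Proof. by apply: bm_ext => x; rewrite bmmulE !bmDE !bmZE !bmmulE mulrDl mulrA. Qed.

Lemma kopx_lin Q q : lin (kopx Q q).
Proof.
move=> a u v; apply: bm_ext => x; rewrite bmDE bmZE 3!kopx_sec bmmul_linl.
by rewrite (kop_posop Q).1.
Qed.

Lemma kopx_linr Q (c : R[i]) q q' f :
  kopx Q (c *: q + q') f = c *: kopx Q q f + kopx Q q' f.
Proof.
apply: bm_ext => x; rewrite bmDE bmZE 3!kopx_sec -bmZE -bmDE -(kop_posop Q).1.
congr (kop Q _ x); apply: bm_ext => y.
rewrite !(bmDE, bmZE, bmmulE, bmsecE) mulrDr; congr (_ + _).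
by rewrite mulrCA.
Qed.

Lemma kopx_dom Q q f x (M : R) : (forall z, normc (q z) <= M) ->
  normc (kopx Q q f x) <= M * Re (kop Q (bmabs f) x).
Proof.
move=> qM; rewrite -ReZ -bmZE -(linZ (kop_posop Q).1) kopx_sec.
apply: posop_dom; first exact: kop_posop.
move=> y; rewrite bmZE bmmulE normcM rmorphM/= mulrC.
by rewrite ler_wpM2r ?realC_ge0 ?Defs.normc_ge0// lecR qM.
Qed.

Lemma kopx_tens Q a b f : kopx Q (bmtens a b) f = bmmul a (kop Q (bmmul f b)).
Proof.
apply: bm_ext => x; rewrite bmmulE -bmZE -(linZ (kop_posop Q).1) kopx_sec.
by congr (kop Q _ x); apply: bm_ext => y; rewrite bmZE !bmmulE bmsecE bmtensE mulrCA.
Qed.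

(** The degenerate kernels of Fredholm's theory: against a measure that does not depend on [x] they
    define finite-rank operators. *)
Definition degenerate q := exists n (a b : 'I_n -> B), q = \sum_(i < n) bmtens (a i) (b i).

Lemma degenerate_tens a b : degenerate (bmtens a b).
Proof. by exists 1%N, (fun=> a), (fun=> b); rewrite big_ord1. Qed.

Lemma degenerateD q q' : degenerate q -> degenerate q' -> degenerate (q + q').
Proof.
move=> [n [a [b ->]]] [m [a' [b' ->]]]; exists (n + m)%N.
exists (fun i => match fintype.split i with inl j => a j | inr j => a' j end).
exists (fun i => match fintype.split i with inl j => b j | inr j => b' j end).
rewrite big_split_ord/=; congr (_ + _); apply: eq_bigr => i _.
  by rewrite (unsplitK (inl i)).
by rewrite (unsplitK (inr i)).
Qed.

Lemma degenerateZ (c : R[i]) q : degenerate q -> degenerate (c *: q).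
Proof.
move=> [n [a [b ->]]]; exists n, (fun i => c *: a i), b.
rewrite scaler_sumr; apply: eq_bigr => i _; apply: bm_ext => -[x y].
by rewrite bmZE !bmtensE bmZE mulrA.
Qed.

(** The [L^1] norm of the row [q (x, .)] for the measure [Q x], written as an operator applied to 1
    so that measurability in [x] is inherited. *)
Definition rowabs Q q := kopx Q (bmabs q) (bmcst 1).

Lemma rowabsE Q q x : rowabs Q q x = kop Q (bmsec (bmabs q) x) x.
Proof. by rewrite /rowabs kopx_sec; congr (kop Q _ x); apply: bm_ext => y; rewrite bmmulE mul1r. Qed.

Lemma rowabs_ge0 Q q x : 0 <= rowabs Q q x.
Proof. by rewrite rowabsE; apply: (kop_posop Q).2 => y; rewrite bmsecE bmabs_ge0. Qed.

Lemma kopx_rowabs Q q f x (M : R) : (forall y, normc (f y) <= M) ->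
  normc (kopx Q q f x) <= M * Re (rowabs Q q x).
Proof.
move=> fM; rewrite -ReZ rowabsE -bmZE -(linZ (kop_posop Q).1) kopx_sec.
apply: posop_dom; first exact: kop_posop.
move=> y; rewrite bmZE bmmulE normcM 2!bmsecE bmabsE rmorphM/=.
by rewrite ler_wpM2r ?realC_ge0 ?Defs.normc_ge0// lecR fM.
Qed.

Lemma rowabs_le Q q q' q'' x : (forall z, normc (q z) <= normc (q' z) + normc (q'' z)) ->
  rowabs Q q x <= (rowabs Q q' + rowabs Q q'') x.
Proof.
move=> qq; rewrite bmDE 3!rowabsE -bmDE -(linD (kop_posop Q).1).
apply: posop_le; first exact: kop_posop.
by move=> y; rewrite bmDE !bmsecE !bmabsE -rmorphD/= lecR.
Qed.

Lemma rowabsZ Q (c : R[i]) q : rowabs Q (c *: q) = (normc c)%:C *: rowabs Q q.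
Proof.
apply: bm_ext => x; rewrite bmZE 2!rowabsE -bmZE -(linZ (kop_posop Q).1).
congr (kop Q _ x); apply: bm_ext => y.
by rewrite bmZE !bmsecE !bmabsE bmZE normcM rmorphM.
Qed.

Lemma bpcvg_rowabs Q (q_ : nat -> B2) q : bpcvg q_ q ->
  bpcvg (fun n => rowabs Q (q_ n - q)) 0.
Proof.
move=> /bpcvg_abs[[M qM] cq]; split.
  have [N N0 QN] := bm_bounded (kop Q (bmcst 1)).
  exists (M * N) => n x; rewrite rowabsE.
  rewrite (le_trans (posop_supnorm x (kop_posop Q) (M := M) _))//.
    by move=> y; rewrite bmsecE.
  rewrite ler_wpM2l//; first exact: le_trans (Defs.normc_ge0 _) (qM 0%N point).
  by rewrite (le_trans (ler_norm _))// (le_trans (Re_le_normc _)).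
move=> x; have : bpcvg (fun n => bmsec (bmabs (q_ n - q)) x) 0.
  by split; [exists M => n y; exact: qM|move=> y; exact: cq].
move=> /(kop_bpcont Q)[_ /(_ x)]; rewrite (lin0 (kop_posop Q).1).
by under eq_fun do rewrite -rowabsE.
Qed.

(** The error is measured in mean, at one point after [W]: sums of products are in general not dense
    for row norms uniform in [x]. In mean, the approximable [q] are closed under bounded pointwise
    limits, so rectangles suffice. *)
Lemma degenerate_approx Q W x0 q (eps : R) : posop W -> bpcont W -> 0 < eps ->
  exists2 q', degenerate q' & Re (W (rowabs Q (q - q')) x0) <= eps.
Proof.
move=> pW cW; move: eps.
pose P q := forall eps : R, 0 < eps -> exists2 q', degenerate q' &
  Re (W (rowabs Q (q - q')) x0) <= eps.
have tri q1 q2 q3 : (forall z, normc (q1 z) <= normc (q2 z) + normc (q3 z)) ->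
    Re (W (rowabs Q q1) x0) <= Re (W (rowabs Q q2) x0) + Re (W (rowabs Q q3) x0).
  move=> h; rewrite -ReD -bmDE -(linD pW.1); apply: posop_le_Re => // x.
  exact: rowabs_le.
have deg q1 : degenerate q1 -> P q1.
  move=> dq1 e e0; exists q1 => //; rewrite subrr.
  rewrite (_ : rowabs Q 0 = 0) ?(lin0 pW.1) ?ltW//.
  by rewrite -(scale0r (0 : B2)) rowabsZ normc0 scale0r.
suff: P q by move=> Pq e /Pq.
apply: (@bmfun_ind _ _ _ [set A `*` A' | A in measurable & A' in measurable] P).
- exact: measurable_prod_measurableType.
- move=> _ _ [A mA [A' mA' <-]] [C mC [C' mC' <-]]; rewrite -setXI.
  by exists (A `&` C); [exact: measurableI|exists (A' `&` C') => //; exact: measurableI].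
- rewrite (_ : bmcst 1 = bmtens (bmcst 1) (bmcst 1)); first by apply/deg/degenerate_tens.
  by apply: bm_ext => -[x y]; rewrite bmtensE !bmcstE mulr1.
- move=> _ [A mA [A' mA' <-]].
  rewrite (_ : bmind _ = bmtens (bmind A) (bmind A')); first by apply/deg/degenerate_tens.
  apply: bm_ext => -[x y]; rewrite bmtensE !bmindE//; last exact: measurableX.
  by rewrite in_setX/= -natrM mulnb.
- move=> c q1 q2 P1 P2 e e0; pose N := normc c + 1.
  have N0 : 0 < N by rewrite ltr_wpDl// Defs.normc_ge0.
  have [|q1' d1 h1] := P1 (e / 2 / N); first by rewrite !divr_gt0.
  have [|q2' d2 h2] := P2 (e / 2); first by rewrite !divr_gt0.
  exists (c *: q1' + q2'); first by apply: degenerateD => //; exact: degenerateZ.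
  rewrite (le_trans (tri _ (c *: (q1 - q1')) (q2 - q2') _))//.
    move=> z; rewrite -[X in normc (bmval X z)](_ : c *: (q1 - q1') + (q2 - q2') = _).
      by rewrite bmDE le_normcD.
    by rewrite scalerBr opprD addrACA.
  rewrite rowabsZ (linZ pW.1) bmZE ReZ [leRHS](splitr e) lerD//.
  rewrite (le_trans (y := N * (e / 2 / N)))//; last by rewrite mulrCA divff ?mulr1// gt_eqF.
  apply: ler_pM => //; [exact: Defs.normc_ge0| |by rewrite lerDl].
  by apply/ge0_Re/pW.2 => x; exact: rowabs_ge0.
- move=> q_ q1 cq Pq e e0.
  have [_ /(_ x0)] := cW _ _ (bpcvg_rowabs Q cq).
  rewrite (lin0 pW.1) bm0E => /cvg0_lt/(_ (divr_gt0 e0 (ltr0Sn R 1)))[n hn].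
  have [|q' d' h'] := Pq n (e / 2); first by rewrite divr_gt0.
  exists q' => //; rewrite [leRHS](splitr e).
  rewrite (le_trans (tri _ (q_ n - q1) (q_ n - q') _))//; last first.
    rewrite lerD// (le_trans _ (ltW hn))// subr0.
    by rewrite (le_trans (ler_norm _))// Re_le_normc.
  move=> z; rewrite 3!bmBE (normcB (q_ n z) (q1 z)) -(subrKA (q_ n z)).
  exact: le_normcD.
Qed.

End kernels_on_products.

(** * A positive supersolution above the spectral radius *)

Section supersolution.
Context {R : realType} {d} {E : measurableType d}.
Local Notation B := (bmfun R E).
Implicit Types (f g h : B) (V W : B -> B).

Lemma bdlin_bounded_linear_on (V : normedModType R[i]) (U : V -> V) :
  bounded_linear_on setT U <-> bdlin U.
Proof.
split=> [[_ lU [M UM]]|[lU [M UM]]].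
  split; first by move=> a u v; exact: lU.
  by exists M => v; rewrite -lecR rmorphM/= -!nmE; exact: UM.
split=> //; exists M => v _.
by rewrite !nmE -rmorphM/= lecR.
Qed.

Lemma resolvent_exists (V : normedModType R[i]) (T : V -> V) (z : R[i]) :
  @geom_complete R V -> bdlin T -> spectral_radius T < normc z ->
  exists U, bdlin U /\ forall v, U (z *: v - T v) = v /\ z *: U v - T (U v) = v.
Proof.
move=> cV bT rz; have [M M0 TM] := bdlin_ub bT.
(* The [sup] in the spectral radius dominates the spectrum only once that set is known to be
   bounded; the Neumann series gives the bound. *)
have bound z' : spectrum_on setT T z' -> normc z' <= M.
  move=> sz'; rewrite leNgt; apply/negP => Mz'; apply: sz'.
  have [B [bB BK KB]] := invertible_neumann cV bT.1 (ltW M0) TM Mz'.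
  exists B; split; first exact/bdlin_bounded_linear_on.
  by move=> v _; rewrite BK; split=> //; exact: KB.
apply: contrapT => nU; move: rz; rewrite ltNge => /negP; apply.
apply: ub_le_sup; first by exists M => _ [z' sz' <-]; exact: bound.
exists z => // -[U [bU UK]]; apply: nU; exists U; split; first exact/bdlin_bounded_linear_on.
by move=> v; exact: UK.
Qed.

Variable V : B -> B.
Hypothesis pV : posop V.

Let sol (lam : R) g := lam%:C *: g - V g = bmcst 1.

Let sol_exists lam : spectral_radius V < lam -> exists g, sol lam g.
Proof.
move=> rl; have l0 : 0 <= lam by rewrite (le_trans _ (ltW rl))// spectral_radius_ge0.
have [|U [_ UK]] := @resolvent_exists _ V lam%:C (@bm_geom_complete _ _ _) (posop_bdlin pV).
  by rewrite normc_realC ger0_norm.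
by exists (U (bmcst 1)); have [_] := UK (bmcst 1).
Qed.

Let sol_Re lam g x : sol lam g -> lam * Re (g x) = 1 + Re (V (bmre g) x).
Proof.
move=> /(congr1 (fun h : B => Re (h x))).
by rewrite bmBE ReB bmZE ReZ bmcstE/= -(posop_Re g x pV) => /eqP; rewrite subr_eq => /eqP.
Qed.

(** The resolvent identity [g - g0 = U ((sigma - lam)%:C *: g)] makes solutions Lipschitz in the
    parameter near [sigma]. *)
Let sol_local (sigma : R) : spectral_radius V < sigma -> exists (delta K : R) g0,
  [/\ 0 < delta, 0 <= K, sol sigma g0 & forall lam g, `|lam - sigma| < delta ->
    sol lam g -> forall x, `|Re (g x) - Re (g0 x)| <= K * `|lam - sigma|].
Proof.
move=> rs; have s0 : 0 <= sigma by rewrite (le_trans _ (ltW rs))// spectral_radius_ge0.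
have [|U [bU UK]] := @resolvent_exists _ V sigma%:C (@bm_geom_complete _ _ _) (posop_bdlin pV).
  by rewrite normc_realC ger0_norm.
have [M M0 UM] := bdlin_ub bU.
(* For [lam] this close to [sigma], the term [M * |lam - sigma| * nm (g - g0)] is at most half of
   [nm (g - g0)] and is absorbed, which doubles the constant. *)
exists (2 * M)^-1, (2 * M * nm (U (bmcst 1))), (U (bmcst 1)); split.
- by rewrite invr_gt0 mulr_gt0.
- by rewrite !mulr_ge0 ?nm_ge0// ltW.
- by have [_] := UK (bmcst 1).
move=> lam g ls gs x; set g0 := U _.
have gg0 : g - g0 = U ((sigma - lam)%:C *: g).
  have [e _] := UK (g - g0); rewrite -{1}e; congr U.
  have [_ e0] := UK (bmcst 1); rewrite -/g0 in e0.
  rewrite scalerBr (linB pV.1) opprD addrACA -opprD e0.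
  have -> : sigma%:C *: g - V g = (sigma - lam)%:C *: g + (lam%:C *: g - V g).
    by rewrite rmorphB/= scalerBl addrA subrK.
  by rewrite gs addrK.
set t := nm (g - g0).
have h1 : t <= M * (`|lam - sigma| * nm g).
  by rewrite /t gg0 (le_trans (UM _))// nmZ normc_realC distrC.
have h2 : nm g <= nm g0 + t by rewrite -{1}(subrK g0 g) addrC nmD.
have h3 : `|Re (g x) - Re (g0 x)| <= t.
  by rewrite -ReB -bmBE (le_trans (Re_le_normc _))// /t nm_bm supnorm_ub.
apply: (le_trans h3); have n0 := nm_ge0 g0.
have a0 := normr_ge0 (lam - sigma); move: ls h1 a0.
move: `|lam - sigma| => a ls h1 a0.
have aM : a * (2 * M) < 1.
  by rewrite -ltr_pdivlMr ?mulr_gt0// div1r.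
have h4 : t <= M * a * nm g0 + M * a * t.
  by rewrite -mulrDr (le_trans h1)// -mulrA ler_wpM2l ?(ltW M0)// ler_wpM2l.
have t0 : 0 <= t by exact: nm_ge0.
have : M * a * t <= 2^-1 * t by rewrite ler_wpM2r//; lra.
by lra.
Qed.

(** A minimum principle: if [a = sup (- Re g)] were nonnegative, [Re g >= - a] would give
    [a * lam <= a * M - 1], impossible for [lam > M]. *)
Let large_pos : exists L : R, forall lam g, L < lam -> sol lam g ->
  forall x, 0 <= Re (g x).
Proof.
have [M M0 VM] := bm_bounded (V (bmcst 1)); exists M => lam g Ml gs.
have l0 : 0 < lam by exact: le_lt_trans M0 Ml.
pose X := [set - Re (g x) | x in setT].
have X0 : X !=set0 by exists (- Re (g point)), point.
have ubX : has_ubound X.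
  exists (supnorm g) => _ [x _ <-].
  by rewrite (le_trans (ler_norm _))// normrN (le_trans (Re_le_normc _))// supnorm_ub.
pose a := sup X.
have aP x : - Re (g x) <= a by apply: ub_le_sup => //; exists x.
suff a0 : a < 0 by move=> x; have := aP x; lra.
rewrite ltNge; apply/negP => a0.
have h x : - Re (g x) <= (a * M - 1) / lam.
  rewrite ler_pdivlMr// mulNr mulrC (sol_Re x gs) opprD addrC lerD2r.
  rewrite lerNl.
  have : Re (V ((- (a%:C)) *: bmcst 1) x) <= Re (V (bmre g) x).
    apply: posop_le_Re => // y; rewrite bmZE bmcstE mulr1 bmreE -rmorphN lecR.
    by rewrite lerNl.
  rewrite (linZ pV.1) bmZE -rmorphN ReZ; apply: le_trans.
  rewrite mulNr lerN2 ler_wpM2l// (le_trans (ler_norm _))//.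
  by rewrite (le_trans (Re_le_normc _)).
have : a <= (a * M - 1) / lam by apply: ge_sup => // _ [x _ <-].
rewrite ler_pdivlMr//; have : a * M <= a * lam by rewrite ler_wpM2l// ltW.
by lra.
Qed.

(* Positivity of [(lam - V)^-1 1] propagates from large [lam] down to the
   spectral radius by connectedness: a nonnegative solution is at least
   [lam^-1], hence stays positive for nearby parameters. *)
Lemma supersolution lam : spectral_radius V < lam -> exists h : B,
  [/\ lam%:C *: h - V h = bmcst 1, forall x, Im (h x) = 0
    & forall x, lam^-1 <= Re (h x)].
Proof.
move=> rl; have l0 : 0 < lam by rewrite (le_lt_trans _ rl)// spectral_radius_ge0.
pose pos mu := exists g, sol mu g /\ forall x, 0 <= Re (g x).
have sol_lb mu g : 0 < mu -> sol mu g -> (forall x, 0 <= Re (g x)) ->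
    forall x, mu^-1 <= Re (g x).
  move=> m0 gs g0 x; rewrite -[leLHS]mulr1 ler_pdivrMl// (sol_Re x gs) lerDl.
  by apply/ge0_Re/pV.2 => y; rewrite bmreE realC_ge0.
suff [g [gs g0]] : pos lam.
  exists (bmre g); split=> //; last by move=> x; exact: (sol_lb _ _ l0 gs g0 x).
  apply: bm_ext => x; apply: complex_ext.
    rewrite bmBE ReB bmZE ReZ bmcstE [Re (bmre g x)]/=.
    by rewrite (sol_Re x gs) addrK.
  by rewrite bmBE ImB bmZE ImZ (posop_real (f := bmre g))//= mulr0 subr0.
apply: contrapT => npos.
(* At [sigma], the supremum of the bad parameters, the solution is a limit of nonnegative ones from
   the right, hence at least [sigma^-1]. It stays nonnegative slightly to the left too, where bad
   parameters should be found. *)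
pose X := [set mu : R | lam <= mu /\ ~ pos mu].
have X0 : X !=set0 by exists lam.
have [L LP] := large_pos.
have ubX : has_ubound X.
  exists L => mu [lm nm]; rewrite leNgt; apply/negP => Lm; apply: nm.
  have [g gs] := sol_exists (lt_le_trans rl lm).
  by exists g; split=> //; exact: LP gs.
pose sigma := sup X.
have ls : lam <= sigma by apply: ub_le_sup.
have s0 : 0 < sigma by exact: lt_le_trans ls.
have [delta [K [g0 [d0 K0 gs loc]]]] := sol_local (lt_le_trans rl ls).
have g0ge x : 0 <= Re (g0 x).
  rewrite leNgt; apply/negP => gx.
  (* The second bound makes the variation [K * eps] less than half of the supposed negative
     value. *)
  pose eps := Num.min (delta / 2) (- Re (g0 x) / (2 * (K + 1))).
  have K1 : 0 < K + 1 by rewrite ltr_wpDl.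
  have e0 : 0 < eps.
    by rewrite lt_min !divr_gt0// ?mulr_gt0// oppr_gt0.
  have ed : eps < delta.
    by rewrite (le_lt_trans (y := delta / 2)) ?ge_min ?lexx//; lra.
  have eK : eps * (2 * (K + 1)) <= - Re (g0 x).
    by rewrite -ler_pdivlMr ?mulr_gt0// ge_min lexx orbT.
  have [g [gs' g'0]] : pos (sigma + eps).
    apply: contrapT => np; have : sigma + eps <= sigma.
      by apply: ub_le_sup => //; split=> //; lra.
    by lra.
  have := loc (sigma + eps) g; rewrite (_ : sigma + eps - sigma = eps); last by ring.
  rewrite (gtr0_norm e0) => /(_ ed gs' x); rewrite ler_norml => /andP[_ h].
  have := g'0 x; have : 0 <= K * eps by rewrite mulr_ge0// ltW.
  have : eps * (2 * (K + 1)) = 2 * (K * eps) + 2 * eps by ring.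
  by move: eK h gx; lra.
have g0lb := sol_lb _ _ s0 gs g0ge.
(* Here the variation [K * eps] must not exceed the lower bound [sigma^-1] of [g0]. *)
pose eps := Num.min delta (sigma^-1 / (K + 1)).
have K1 : 0 < K + 1 by rewrite ltr_wpDl.
have e0 : 0 < eps by rewrite lt_min d0/= divr_gt0// invr_gt0.
have [mu [lm np] sm] := sup_adherent e0 (conj X0 ubX).
have ms : mu <= sigma by exact: ub_le_sup.
apply: np; have [g gs'] := sol_exists (lt_le_trans rl lm).
exists g; split=> // x.
have dm : `|mu - sigma| < eps.
  by rewrite distrC ger0_norm ?subr_ge0// ltrBlDl -ltrBlDr.
have := loc mu g (lt_le_trans dm _) gs' x; rewrite ge_min lexx => /(_ isT) h.
have hK : K * `|mu - sigma| <= sigma^-1.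
  rewrite (le_trans (y := (K + 1) * (sigma^-1 / (K + 1))))//.
    apply: ler_pM => //; first by rewrite lerDl.
    by rewrite (le_trans (ltW dm))// ge_min lexx orbT.
  by rewrite mulrCA divff ?mulr1// gt_eqF.
move: h; rewrite ler_norml => /andP[h _]; have := g0lb x.
by lra.
Qed.

End supersolution.

Lemma normcN (R : realType) (z : R[i]) : normc (- z) = normc z.
Proof. by rewrite -[- z]sub0r normcB subr0. Qed.

(** * Splitting a dominated operator along a splitting of the dominating one *)

Section dominated_splitting.
Context {R : realType} {d} {E : measurableType d}.
Local Notation B := (bmfun R E).
Local Notation B2 := (bmfun R (E * E)%type).
Variables (N : R.-fker E ~> E) (beta : B2) (V S U : B -> B) (h : B).
Variables (lam c m : R) (q_ : nat -> B2) (e_ : nat -> B).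
Implicit Types (f g : B).

#[local] Opaque kop kopx.

Hypothesis Nconst : forall f x y, kop N f x = kop N f y.
Hypotheses (pV : posop V) (cV : bpcont V) (pS : posop S) (lU : lin U).
Hypothesis VE : forall f x, V f x = S f x + kopx N beta f x.
Hypotheses (beta0 : forall z, 0 <= beta z) (m0 : 0 <= m).
Hypothesis betam : forall z, normc (beta z) <= m.
Hypotheses (c0 : 0 <= c) (qc : forall n z, normc (q_ n z) <= c).
Hypotheses (e0 : forall n x, 0 <= e_ n x) (ecvg : bpcvg e_ 0).
Hypothesis qe : forall x n k, (k <= n)%N ->
  Re (V (bmsec (bmabs (q_ n - q_ k)) x) x) <= Re (e_ k x).
Hypothesis qU : forall f x,
  (fun n => normc (V (bmmul f (bmsec (q_ n) x)) x - U f x)) @ \oo --> (0 : R).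
Hypotheses (lam0 : 0 < lam) (hreal : forall x, Im (h x) = 0).
Hypothesis hlb : forall x, lam^-1 <= Re (h x).
Hypothesis hS : forall x, Re (S h x) <= lam * Re (h x).

(** The share of [V (f q_n)] carried by the density [beta]; [Bop] will be its limit in [n]. *)
Let kk n f := kopx N (bmmul (q_ n) beta) f.

Let Re_e_cvg x : (fun n => Re (e_ n x)) @ \oo --> (0 : R).
Proof.
apply: cvg0_le (ecvg.2 x) => n.
by rewrite ge0_Re// andTb bm0E subr0 (le_trans (ler_norm _))// Re_le_normc.
Qed.

Let kkE n f x : kk n f x = kopx N beta (bmmul f (bmsec (q_ n) x)) x.
Proof.
rewrite /kk 2!kopx_sec; congr (bmval (kop N _) x); apply: bm_ext => y.
by rewrite !bmmulE !bmsecE bmmulE mulrA.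
Qed.

Let V_split n f x :
  V (bmmul f (bmsec (q_ n) x)) x = S (bmmul f (bmsec (q_ n) x)) x + kk n f x.
Proof. by rewrite VE kkE. Qed.

Let kk_cauchy f x n k : (k <= n)%N ->
  normc (kk n f x - kk k f x) <= supnorm f * Re (e_ k x).
Proof.
move=> kn; have -> : kk n f x - kk k f x = kopx N (bmmul (q_ n - q_ k) beta) f x.
  rewrite (_ : bmmul (q_ n - q_ k) beta = -1 *: bmmul (q_ k) beta + bmmul (q_ n) beta).
    by rewrite kopx_linr bmDE bmZE mulN1r addrC.
  by apply: bm_ext => z; rewrite bmDE bmZE !bmmulE bmBE mulN1r mulrBl addrC.
set w := bmsec (bmabs (q_ n - q_ k)) x.
rewrite (le_trans (y := supnorm f * Re (kopx N beta w x)))//.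
  rewrite 2!kopx_sec -ReZ -bmZE -(linZ (kop_posop N).1).
  apply: posop_dom; first exact: kop_posop.
  move=> y; rewrite bmZE !bmmulE !bmsecE bmmulE bmabsE.
  rewrite !normcM 2!rmorphM/= (ge0_normc (beta0 _)) -ge0_realE//.
  rewrite ler_wpM2r ?mulr_ge0 ?realC_ge0 ?Defs.normc_ge0//.
  by rewrite lecR supnorm_ub.
rewrite ler_wpM2l//; first exact: le_trans (Defs.normc_ge0 _) (supnorm_ub f x).
apply: le_trans (qe x kn); rewrite VE ReD lerDr.
by apply/ge0_Re/pS.2 => y; rewrite bmsecE bmabs_ge0.
Qed.

(** The limit is taken on operators, not on densities: [beta N] is dominated by [V], for which the
    rows of [q_n] are Cauchy in mean. Linearity survives because the same [e_] controls every
    [f]. *)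
Lemma dominated_part_exists : exists Bop : B -> B, lin Bop /\
  forall f n x, normc (Bop f x - kopx N (bmmul (q_ n) beta) f x) <=
    supnorm f * Re (e_ n x).
Proof.
have /choice[Bop BP] : forall f, exists g,
    forall n x, normc (g x - kk n f x) <= supnorm f * Re (e_ n x).
  move=> f; have [M M0 NM] := bm_bounded (kop N (bmcst 1)).
  apply: (@bm_cauchy_limit _ _ _ (kk ^~ f) (fun n x => supnorm f * Re (e_ n x))
    (c * m * (supnorm f * M))).
  - move=> n x; rewrite (le_trans (kopx_dom N f x (M := c * m) _))//.
      by move=> z; rewrite bmmulE normcM ler_pM ?Defs.normc_ge0.
    rewrite ler_wpM2l ?mulr_ge0// (le_trans (ler_norm _))// (le_trans (Re_le_normc _))//.
    rewrite (le_trans (posop_supnorm x (kop_posop N) (M := supnorm f) _))//.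
      by move=> y; rewrite bmabsE normc_realC ger0_norm ?Defs.normc_ge0// supnorm_ub.
    rewrite ler_wpM2l//; first exact: le_trans (Defs.normc_ge0 _) (supnorm_ub f x).
    by rewrite (le_trans (ler_norm _))// (le_trans (Re_le_normc _)).
  - by move=> x n k; exact: kk_cauchy.
  - by move=> x; apply: cvg0Ml.
exists Bop; split=> // a f g; apply: bm_ext => x; rewrite bmDE bmZE.
apply/eqP; rewrite -subr_eq0; apply/eqP/eq0_normc/le_anti; rewrite Defs.normc_ge0 andbT.
apply: (le0_cvg0 (v := fun n =>
  (supnorm (a *: f + g) + (normc a * supnorm f + supnorm g)) * Re (e_ n x))) => [n|].
  have -> : Bop (a *: f + g) x - (a * Bop f x + Bop g x) =
      (Bop (a *: f + g) x - kk n (a *: f + g) x) -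
      (a * (Bop f x - kk n f x) + (Bop g x - kk n g x)).
    rewrite [kk n (a *: f + g)]kopx_lin bmDE bmZE -/(kk n f) -/(kk n g); ring.
  rewrite (le_trans (le_normcD _ _))// mulrDl lerD// ?BP//.
  rewrite normcN (le_trans (le_normcD _ _))// mulrDl lerD ?BP// normcM -mulrA.
  by rewrite ler_wpM2l ?Defs.normc_ge0// BP.
exact: cvg0Ml.
Qed.

Variable Bop : B -> B.
Hypothesis lB : lin Bop.
Hypothesis BP : forall f n x, normc (Bop f x - kopx N (bmmul (q_ n) beta) f x) <=
    supnorm f * Re (e_ n x).

Lemma dominated_part_le f x : normc (Bop f x) <= c * m * Re (kop N (bmabs f) x).
Proof.
rewrite -subr_le0; apply: le0_cvg0 (cvg0Ml (supnorm f) (Re_e_cvg x)) => n.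
rewrite lerBlDl (le_trans (normc_le_dist _ (kk n f x)))// lerD ?BP//.
by apply: kopx_dom => z; rewrite bmmulE normcM ler_pM ?Defs.normc_ge0.
Qed.

Let bmmul_q_le f n x y :
  (normc (bmmul f (bmsec (q_ n) x) y))%:C <= (c%:C *: bmabs f) y.
Proof.
rewrite bmZE bmabsE bmmulE bmsecE -rmorphM/= lecR normcM mulrC.
by rewrite ler_wpM2r ?Defs.normc_ge0.
Qed.

(** [U - Bop] is the pointwise limit of [S (f q_n)], and [q_n] is bounded by [c]. *)
Lemma small_part_le f x : normc (U f x - Bop f x) <= c * Re (S (bmabs f) x).
Proof.
rewrite -subr_le0.
apply: (le0_cvg0 _ (cvg0D (qU f x) (cvg0Ml (supnorm f) (Re_e_cvg x)))) => n.
rewrite lerBlDl -ReZ -bmZE -(linZ pS.1).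
have -> : U f x - Bop f x = S (bmmul f (bmsec (q_ n) x)) x +
    ((U f x - V (bmmul f (bmsec (q_ n) x)) x) - (Bop f x - kk n f x)).
  by rewrite V_split; ring.
rewrite (le_trans (le_normcD _ _))// lerD//.
  by apply: posop_dom => // y; exact: bmmul_q_le.
rewrite (le_trans (le_normcD _ _))// lerD//; first by rewrite normcB.
by rewrite normcN BP.
Qed.

Lemma dominated_le f x : normc (U f x) <= c * Re (V (bmabs f) x).
Proof.
rewrite -subr_le0; apply: (le0_cvg0 _ (qU f x)) => n.
rewrite lerBlDl -ReZ -bmZE -(linZ pV.1).
rewrite (le_trans (normc_le_dist _ (V (bmmul f (bmsec (q_ n) x)) x)))// lerD//.
  by apply: posop_dom => // y; exact: bmmul_q_le.
by rewrite normcB.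
Qed.

Let A f := U f - Bop f.

Let A_step f t : 0 <= t -> (forall x, normc (f x) <= t * Re (h x)) ->
  forall x, normc (A f x) <= c * lam * t * Re (h x).
Proof.
move=> t0 ft x; rewrite /A bmBE (le_trans (small_part_le f x))// -!mulrA ler_wpM2l//.
rewrite (le_trans (y := t * Re (S h x)))//; last first.
  by rewrite mulrCA ler_wpM2l.
rewrite -ReZ -bmZE -(linZ pS.1); apply: posop_le_Re => // y.
rewrite bmZE bmabsE (_ : h y = (Re (h y))%:C) -?rmorphM/= ?lecR//.
by apply: complex_ext => //=; rewrite hreal.
Qed.

(** [h] serves as a weight equivalent to the constant 1: the start uses [1 <= lam * Re (h x)], and
    each application of [A] multiplies a bound by [h] by [c * lam]. *)
Lemma small_part_iter n f : nm (iter n A f) <= lam * nm h * (c * lam) ^+ n * nm f.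
Proof.
have cl0 : 0 <= c * lam by rewrite mulr_ge0// ltW.
have H x : normc (iter n A f x) <= (c * lam) ^+ n * (lam * nm f) * Re (h x).
  have f0 : 0 <= lam * nm f by rewrite mulr_ge0 ?nm_ge0// ltW.
  elim: n x => [x|n ih x].
    rewrite expr0 mul1r /= (le_trans (supnorm_ub f x))// -nm_bm mulrAC.
    by rewrite ler_peMl ?nm_ge0// -ler_pdivrMl// mulr1.
  by rewrite iterS exprS -(mulrA (c * lam)); apply: A_step => //;
    rewrite mulr_ge0// exprn_ge0.
rewrite nm_bm; apply: supnorm_le => x; rewrite (le_trans (H x))//.
rewrite [leRHS](_ : _ = (c * lam) ^+ n * (lam * nm f) * nm h); last by ring.
rewrite ler_wpM2l ?mulr_ge0 ?exprn_ge0 ?nm_ge0 ?(ltW lam0)//.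
by rewrite (le_trans (ler_norm _))// (le_trans (Re_le_normc _))// nm_bm supnorm_ub.
Qed.

Lemma dominated_part_bdlin : bdlin Bop.
Proof.
split=> //; have [M M0 NM] := bm_bounded (kop N (bmcst 1)).
exists (c * m * M) => f; rewrite !nm_bm; apply: supnorm_le => x.
rewrite (le_trans (dominated_part_le f x))// -!mulrA !ler_wpM2l//.
rewrite (le_trans (ler_norm _))// (le_trans (Re_le_normc _))// mulrC.
rewrite (le_trans (posop_supnorm x (kop_posop N) (M := supnorm f) _))//.
  by move=> y; rewrite bmabsE normc_realC ger0_norm ?Defs.normc_ge0// supnorm_ub.
rewrite ler_wpM2l//; first exact: le_trans (Defs.normc_ge0 _) (supnorm_ub f x).
by rewrite (le_trans (ler_norm _))// (le_trans (Re_le_normc _)).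
Qed.

Lemma dominated_bdlin : bdlin U.
Proof.
split=> //; have [M M0 VM] := bm_bounded (V (bmcst 1)).
exists (c * M) => f; rewrite !nm_bm; apply: supnorm_le => x.
rewrite (le_trans (dominated_le f x))// -!mulrA !ler_wpM2l//.
rewrite (le_trans (ler_norm _))// (le_trans (Re_le_normc _))// mulrC.
rewrite (le_trans (posop_supnorm x pV (M := supnorm f) _))//.
  by move=> y; rewrite bmabsE normc_realC ger0_norm ?Defs.normc_ge0// supnorm_ub.
rewrite ler_wpM2l//; first exact: le_trans (Defs.normc_ge0 _) (supnorm_ub f x).
by rewrite (le_trans (ler_norm _))// (le_trans (Re_le_normc _)).
Qed.

Lemma dominated_iter_le n f x : normc (iter n U f x) <= c ^+ n * Re (iter n V (bmabs f) x).
Proof.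
elim: n x => [x|n ih x]; first by rewrite mul1r.
rewrite (le_trans (dominated_le _ _))// exprS -mulrA ler_wpM2l//.
rewrite iterS -ReZ -bmZE -(linZ pV.1); apply: posop_le_Re => // y.
rewrite bmabsE bmZE (ge0_realE (_ : 0 <= iter n V (bmabs f) y)) -?rmorphM/= ?lecR//.
by apply: (posop_iter n pV).2 => z; exact: bmabs_ge0.
Qed.

(** Since [N] does not depend on its starting point, the coefficient functionals can be evaluated at
    [point]. *)
Lemma kopx_degenerate_finite_rank q : degenerate q -> finite_rank (kopx N q).
Proof.
move=> [n [a [b ->]]].
exists n, a, (fun i f => kop N (bmmul f (b i)) point : R[i]^o); split=> [i|f].
  split=> [t u v|]; first by rewrite bmmul_linl (kop_posop N).1.
  have [M M0 NM] := bm_bounded (kop N (bmcst 1)).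
  exists (supnorm (b i) * M) => f.
  rewrite (_ : nm (_ : R[i]^o) = normc (kop N (bmmul f (b i)) point)); last first.
    by rewrite /nm normc_def.
  rewrite (le_trans (posop_supnorm point (kop_posop N)
    (M := supnorm f * supnorm (b i)) _))//.
    by move=> y; rewrite bmmulE normcM ler_pM ?Defs.normc_ge0 ?supnorm_ub.
  rewrite -nm_bm [leRHS](_ : _ = nm f * supnorm (b i) * M); last by ring.
  rewrite ler_wpM2l ?mulr_ge0 ?nm_ge0// -?nm_bm ?nm_ge0//.
  by rewrite (le_trans (ler_norm _))// (le_trans (Re_le_normc _)).
apply: bm_ext => x.
have -> : kopx N (\sum_(i < n) bmtens (a i) (b i)) f =
    \sum_(i < n) kopx N (bmtens (a i) (b i)) f.
  elim/big_rec2 : _ => [|i u v _ <-].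
    apply: bm_ext => y; rewrite kopx_sec (_ : bmmul _ _ = 0) ?(lin0 (kop_posop N).1)//.
    by apply: bm_ext => z; rewrite bmmulE bmsecE bm0E mulr0.
  by rewrite -[bmtens _ _ + _]scale1r -{1}[bmtens _ _]scale1r scale1r kopx_linr scale1r.
rewrite 2!bm_sumE; apply: eq_bigr => i _.
by rewrite kopx_tens bmmulE bmZE mulrC (Nconst _ point x).
Qed.

(** Half of [delta] pays for replacing [Bop] by the density [q_n beta], half for replacing that
    density by a degenerate one. *)
Lemma dominated_part_approx W x0 (delta : R) : posop W -> bpcont W -> 0 < delta ->
  exists2 D, finite_rank D &
    forall f, Re (W (bmabs (Bop f - D f)) x0) <= delta * nm f.
Proof.
move=> pW cW d0.
have [_ /(_ x0)] := cW _ _ ecvg; rewrite (lin0 pW.1) bm0E.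
move=> /cvg0_lt/(_ (divr_gt0 d0 (ltr0Sn R 1)))[n hn].
have [|q dq hq] := degenerate_approx N x0 (bmmul (q_ n) beta) (eps := delta / 2) pW cW.
  by rewrite divr_gt0.
exists (kopx N q); first exact: kopx_degenerate_finite_rank.
move=> f; set r := rowabs N _ in hq.
rewrite (le_trans (y := Re (W ((nm f)%:C *: (e_ n + r)) x0)))//.
  apply: posop_le_Re => // x; rewrite bmabsE bmZE (bmDE (e_ n) r).
  have r0 : 0 <= r x by exact: rowabs_ge0.
  rewrite (ge0_realE (e0 n x)) (ge0_realE r0) -rmorphD -rmorphM/= lecR mulrDr.
  rewrite -[X in normc X <= _]/(Bop f x - kopx N q f x) -(subrKA (kk n f x)).
  rewrite (le_trans (le_normcD _ _))// lerD//; first by rewrite nm_bm BP.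
  rewrite (_ : _ - _ = kopx N (bmmul (q_ n) beta - q) f x).
    by rewrite nm_bm; apply: kopx_rowabs => y; exact: supnorm_ub.
  rewrite (_ : _ - q = -1 *: q + bmmul (q_ n) beta) ?kopx_linr ?bmDE ?bmZE.
    by rewrite mulN1r addrC.
  by rewrite scaleN1r addrC.
rewrite (linZ pW.1) bmZE ReZ mulrC ler_wpM2r ?nm_ge0//.
rewrite (linD pW.1) bmDE ReD [leRHS](splitr delta) lerD//.
rewrite (le_trans _ (ltW hn))// subr0.
by rewrite (le_trans (ler_norm _))// Re_le_normc.
Qed.

End dominated_splitting.

(** * Norm limits of finite-rank operators and the expansion of [(A + B)^n] *)

Section approximable.
Context {R : realType} {V : normedModType R[i]}.
Implicit Types (A B D F T U : V -> V).

Definition approximable D := forall eps : R, 0 < eps ->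
  exists2 F, finite_rank F & forall v, nm (D v - F v) <= eps * nm v.

Lemma approximable0 : approximable (fun=> 0).
Proof.
move=> e e0; exists (fun=> 0); first exact: finite_rank0.
by move=> v; rewrite subrr nm0 mulr_ge0 ?nm_ge0// ltW.
Qed.

Lemma approximableD D D' : approximable D -> approximable D' ->
  approximable (fun v => D v + D' v).
Proof.
move=> aD aD' e e0; have e2 : 0 < e / 2 by rewrite divr_gt0.
have [F fF DF] := aD _ e2; have [F' fF' DF'] := aD' _ e2.
exists (fun v => F v + F' v); first exact: finite_rankD.
move=> v; rewrite opprD addrACA (le_trans (nmD _ _))//.
by rewrite (splitr e) mulrDl lerD.
Qed.

Lemma approximable_compl B D : bdlin B -> approximable D -> approximable (fun v => B (D v)).
Proof.
move=> bB aD e e0; have [M M0 BM] := bdlin_ub bB.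
have [|F fF DF] := aD (e / M); first by rewrite divr_gt0.
exists (fun v => B (F v)); first exact: finite_rank_compl.
move=> v; rewrite -(linB bB.1) (le_trans (BM _))// -ler_pdivlMl//.
by rewrite (le_trans (DF v))// mulrCA mulrA [e * _]mulrC.
Qed.

Lemma approximable_compr B D : bdlin B -> approximable D -> approximable (fun v => D (B v)).
Proof.
move=> bB aD e e0; have [M M0 BM] := bdlin_ub bB.
have [|F fF DF] := aD (e / M); first by rewrite divr_gt0.
exists (fun v => F (B v)); first exact: (finite_rank_compr bB fF).
move=> v; rewrite (le_trans (DF _))// -mulrA ler_wpM2l ?(ltW e0)//.
by rewrite ler_pdivrMl.
Qed.

Lemma bernoulli (x : R) n : 0 <= x -> 1 + n%:R * x <= (1 + x) ^+ n.
Proof.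
move=> x0; elim: n => [|n ih]; first by rewrite mul0r addr0 expr0.
rewrite exprS; apply: (le_trans (y := (1 + x) * (1 + n%:R * x))); last first.
  by rewrite ler_wpM2l// addr_ge0.
have : 0 <= n%:R * x * x by rewrite !mulr_ge0.
by rewrite -natr1; lra.
Qed.

Section words.
Variables (A B U : V -> V) (C a b r : R).
Hypotheses (bA : bdlin A) (bB : bdlin B) (bU : bdlin U).
Hypothesis UE : forall v, U v = A v + B v.
Hypothesis BUB : forall j, approximable (fun v => B (iter j U (B v))).
Hypotheses (C0 : 0 < C) (a0 : 0 < a) (ar : a < r) (b0 : 0 < b).
Hypothesis AC : forall n v, nm (iter n A v) <= C * a ^+ n * nm v.
Hypothesis Bb : forall v, nm (B v) <= b * nm v.

(* [\sum_(k < n) A^k B A^(n-1-k)]: the words of [(A + B)^n] with one [B]. *)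
Fixpoint one_B_words n v :=
  if n is n'.+1 then A (one_B_words n' v) + B (iter n' A v) else 0.

(** The words of [(A + B)^n] with at least one [B]. *)
Let L n v := iter n U v - iter n A v.

Let L_S n v : L n.+1 v = U (L n v) + B (iter n A v).
Proof.
by rewrite /L !iterS (linB bU.1) [in U (iter n A v)]UE opprD addrA subrK.
Qed.

(** Every word of [L n] contains a [B], and the leading [B] makes two, with a power of [U] between
    them. *)
Let BUL n j : approximable (fun v => B (iter j U (L n v))).
Proof.
elim: n j => [|n ih] j.
  rewrite [X in approximable X](_ : _ = fun=> 0); first exact: approximable0.
  apply/funext => v; rewrite /L subrr (lin0 (lin_iter j bU.1)).
  exact: lin0 bB.1.
rewrite [X in approximable X](_ : _ = fun v => B (iter j.+1 U (L n v)) +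
    B (iter j U (B (iter n A v)))).
  apply: approximableD; first exact: ih.
  by apply: (approximable_compr (D := fun v => B (iter j U (B v)))) => //; exact: bdlin_iter.
by apply/funext => v; rewrite L_S (linD (lin_iter j bU.1)) (linD bB.1) -iterSr.
Qed.

Let two_B_words n : approximable (fun v => L n v - one_B_words n v).
Proof.
elim: n => [|n ih].
  rewrite [X in approximable X](_ : _ = fun=> 0); first exact: approximable0.
  by apply/funext => v; rewrite /L subrr subr0.
rewrite [X in approximable X](_ : _ = fun v => A (L n v - one_B_words n v) + B (L n v)).
  by apply: approximableD; [exact: approximable_compl|exact: (BUL n 0)].
by apply/funext => v; rewrite L_S UE /= opprD addrACA subrr addr0 addrAC -(linB bA.1).
Qed.

(** The powers [iter j A] are carried along because [one_B_words] puts further letters [A] on the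
    left. The factor [a] stands for the exponent [j + n - 1]. *)
Let one_B_words_le n j v :
  a * nm (iter j A (one_B_words n v)) <= n%:R * (C * C * b) * a ^+ (j + n) * nm v.
Proof.
elim: n j => [|n ih] j /=.
  by rewrite (lin0 (lin_iter j bA.1)) nm0 mulr0 !mul0r.
rewrite (linD (lin_iter j bA.1)) -iterSr.
rewrite (le_trans (ler_wpM2l (ltW a0) (nmD _ _)))// mulrDr -natr1.
rewrite 3!mulrDl mul1r lerD//; first by rewrite addnS -addSn ih.
rewrite (le_trans (ler_wpM2l (ltW a0) (AC _ _)))//.
have h : nm (B (iter n A v)) <= b * (C * a ^+ n * nm v).
  by rewrite (le_trans (Bb _))// ler_wpM2l ?(ltW b0)//; exact: AC.
rewrite (le_trans (y := a * (C * a ^+ j * (b * (C * a ^+ n * nm v)))))//.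
  by rewrite ler_wpM2l ?(ltW a0)// ler_wpM2l// mulr_ge0 ?exprn_ge0// ltW.
by rewrite addnS exprS exprD le_eqVlt; apply/orP; left; apply/eqP; ring.
Qed.

(** One-[B] words grow like [n * a ^+ n]; an intermediate rate [a' < r] absorbs the factor [n] by
    Bernoulli's inequality. The 8 is the one required by [ess_spectral_radius_le]. *)
Lemma iter_finite_rank_small : exists n F, [/\ (0 < n)%N, finite_rank F
  & forall v, nm (iter n U v - F v) <= r ^+ n / 8 * nm v].
Proof.
have r0 : 0 < r by exact: lt_trans ar.
pose a' := (a + r) / 2; have [aa' a'r] : a < a' /\ a' < r by rewrite !midf_lt.
have a'0 : 0 < a' by exact: lt_trans aa'.
pose e := a' / a - 1; have e0 : 0 < e.
  by rewrite subr_gt0 ltr_pdivlMr// mul1r.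
pose K := C + C * C * b / (a * e).
have Kn n : C * a ^+ n + n%:R * (C * C * b) * a ^+ n / a <= K * a' ^+ n.
  rewrite mulrDl lerD//.
    by rewrite ler_wpM2l ?(ltW C0)// lerXn2r ?nnegrE ?ltW.
  have h : n%:R * e * a ^+ n <= a' ^+ n.
    have -> : a' = a * (1 + e) by rewrite /e addrC subrK mulrCA divff ?mulr1// gt_eqF.
    rewrite exprMn mulrC ler_wpM2l ?exprn_ge0 ?(ltW a0)//.
    by rewrite (le_trans _ (bernoulli n (ltW e0)))// lerDr.
  rewrite [leLHS](_ : _ = C * C * b / (a * e) * (n%:R * e * a ^+ n)).
    by rewrite ler_wpM2l// !mulr_ge0 ?invr_ge0 ?mulr_ge0 ?ltW.
  by field; rewrite !gt_eqF.
have K0 : 0 < K by rewrite addr_gt0// divr_gt0 ?mulr_gt0.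
have h0 : (fun n => (K * (a' / r)) * (a' / r) ^+ n) @ \oo --> (0 : R).
  have ar0 : 0 <= a' / r := divr_ge0 (ltW a'0) (ltW r0).
  apply: cvg0Ml; apply: cvg_expr; rewrite (ger0_norm ar0).
  by rewrite ltr_pdivrMr// mul1r.
(* Half of [r ^+ n / 8] is for words with at most one [B], the other half for the finite-rank
   approximation. The extra factor [a' / r] in [h0] makes the exponent [k.+1] positive. *)
have [|k] := cvg0_lt h0 (e := 16^-1); first by rewrite invr_gt0.
rewrite -mulrA -exprS => hk.
have [|F fF PF] := two_B_words k.+1 (eps := r ^+ k.+1 / 16).
  by rewrite divr_gt0// exprn_gt0.
exists k.+1, F; split=> // v.
have -> : iter k.+1 U v - F v = iter k.+1 A v + one_B_words k.+1 v +
    (L k.+1 v - one_B_words k.+1 v - F v).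
  rewrite [RHS]addrA; congr (_ - F v); rewrite /L.
  by rewrite -(addrA (iter k.+1 U v)) -opprD addrC subrK.
rewrite (le_trans (nmD _ _))//.
rewrite (_ : r ^+ k.+1 / 8 = r ^+ k.+1 / 16 + r ^+ k.+1 / 16); last by field.
rewrite mulrDl lerD//.
apply: (le_trans (y := K * a' ^+ k.+1 * nm v)).
  rewrite (le_trans (nmD _ _))//.
  rewrite (le_trans _ (ler_wpM2r (nm_ge0 v) (Kn k.+1)))// mulrDl lerD//.
  by rewrite mulrAC ler_pdivlMr// mulrC; have := one_B_words_le k.+1 0 v.
rewrite ler_wpM2r ?nm_ge0//.
have rk : 0 < r ^+ k.+1 by rewrite exprn_gt0.
move: hk; rewrite expr_div_n mulrA ltr_pdivrMr// => /ltW h.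
by rewrite (le_trans h)// mulrC.
Qed.

End words.

Lemma ess_spectral_radius_le_words T A B U l (C a b rho1 rho0 : R) :
  @geom_complete R V -> bdlin T -> (0 < l)%N -> (forall v, U v = iter l T v) ->
  bdlin A -> bdlin B -> (forall v, U v = A v + B v) ->
  (forall j, approximable (fun v => B (iter j U (B v)))) ->
  0 < C -> 0 < a -> a < rho1 ^+ l -> 0 < b ->
  (forall n v, nm (iter n A v) <= C * a ^+ n * nm v) ->
  (forall v, nm (B v) <= b * nm v) ->
  0 < rho1 -> rho1 < rho0 -> ess_spectral_radius T <= rho0.
Proof.
move=> cV bT l0 UT bA bB UE BUB C0 a0 ar b0 AC Bb r1 r10.
have bU : bdlin U by rewrite (funext UT); exact: bdlin_iter.
have [n [F [n0 fF UF]]] := iter_finite_rank_small bA bB bU UE BUB C0 a0 ar b0 AC Bb.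
apply: (@ess_spectral_radius_le _ _ T F (n * l) ((rho1 ^+ l) ^+ n / 8) rho1 rho0) => //.
- by rewrite muln_gt0 n0.
- by rewrite divr_ge0// exprn_ge0// exprn_ge0// ltW.
- move=> v; rewrite (_ : iter (n * l) T v = iter n U v) ?UF//.
  by elim: (n) v => //= k ih v; rewrite mulSn iterD ih UT.
- by rewrite mulrC divfK// -exprM mulnC.
Qed.

End approximable.

(** * The essential spectral radius of dominated operators *)

Section essential_radius_of_dominated_operators.
Context {R : realType} {d} {E : measurableType d}.
Local Notation B := (bmfun R E).
Local Notation B2 := (bmfun R (E * E)%type).
Variables (N : R.-fker E ~> E) (beta : B2) (V S U T : B -> B) (h : B).
Variables (lam c m : R) (q_ : nat -> B2) (e_ : nat -> B) (l : nat).
Implicit Types (f g : B).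

#[local] Opaque kop kopx.

Lemma ess_spectral_radius_dominated (rho1 rho0 : R) :
  (forall f x y, kop N f x = kop N f y) ->
  posop V -> bpcont V -> posop S -> lin U ->
  (forall f x, V f x = S f x + kopx N beta f x) ->
  (forall z, 0 <= beta z) -> 0 <= m -> (forall z, normc (beta z) <= m) ->
  0 <= c -> (forall n z, normc (q_ n z) <= c) ->
  (forall n x, 0 <= e_ n x) -> bpcvg e_ 0 ->
  (forall x n k, (k <= n)%N ->
    Re (V (bmsec (bmabs (q_ n - q_ k)) x) x) <= Re (e_ k x)) ->
  (forall f x,
    (fun n => normc (V (bmmul f (bmsec (q_ n) x)) x - U f x)) @ \oo --> (0 : R)) ->
  0 < lam -> (forall x, Im (h x) = 0) -> (forall x, lam^-1 <= Re (h x)) ->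
  (forall x, Re (S h x) <= lam * Re (h x)) ->
  bdlin T -> (0 < l)%N -> (forall f, U f = iter l T f) ->
  c * lam < rho1 ^+ l -> 0 < rho1 -> rho1 < rho0 ->
  ess_spectral_radius T <= rho0.
Proof.
move=> Nc pV cV pS lU VE b0 m0 bm c0 qc e0 ecvg qe qU lam0 hr hlb hS bT l0 UT cl r1 r10.
have [Bop [lB BP]] :=
  dominated_part_exists pS VE b0 m0 bm c0 qc e0 ecvg qe.
have bB := dominated_part_bdlin m0 bm c0 qc e0 ecvg lB BP.
have bU := dominated_bdlin pV lU c0 qc qU.
have [b bb0 Bb] := bdlin_ub bB.
have cl0 : 0 <= c * lam by rewrite mulr_ge0// ltW.
(* [c * lam] may be 0, while the expansion in words asks for a positive rate. *)
pose a := (c * lam + rho1 ^+ l) / 2.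
have [ca ar] : c * lam < a /\ a < rho1 ^+ l by rewrite !midf_lt.
have a0 : 0 < a by exact: le_lt_trans ca.
have hn0 : 0 <= lam * nm h by rewrite mulr_ge0 ?nm_ge0// ltW.
apply: (@ess_spectral_radius_le_words _ _ T (fun f => U f - Bop f) Bop U l
  (lam * nm h + 1) a b rho1 rho0) => //.
- exact: bm_geom_complete.
- exact: bdlinB.
- by move=> f; rewrite subrK.
(* [Bop (iter j U g)] is bounded at every point by [K] times [W (bmabs g)]. As [N] ignores its
   starting point, this bound is the same everywhere, so smallness in mean of [g = Bop f - D f] at
   [point] gives smallness in norm. *)
- move=> j e ee; pose W f := kop N (iter j V f).
  have pW : posop W by exact: (posop_comp (kop_posop N) (posop_iter j pV)).
  have cW : bpcont W by exact: (bpcont_comp (@kop_bpcont _ _ _ N) (bpcont_iter j cV)).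
  pose K := c * m * c ^+ j.
  have K0 : 0 <= K by rewrite !mulr_ge0// exprn_ge0.
  have [|D fD BD] := dominated_part_approx Nc e0 ecvg BP point pW cW
    (delta := e / (K + 1)).
    by rewrite divr_gt0// ltr_wpDl.
  have bUB : bdlin (fun f => Bop (iter j U f)) by exact: bdlin_comp bB (bdlin_iter j bU).
  exists (fun f => Bop (iter j U (D f))).
    exact: (finite_rank_compl bUB).
  move=> f; rewrite -(linB bUB.1) nm_bm; apply: supnorm_le => x.
  set g := Bop f - D f.
  rewrite (le_trans (dominated_part_le bm qc e0 ecvg BP _ _))//.
  apply: (le_trans (y := c * m * (c ^+ j * Re (W (bmabs g) x)))).
    rewrite ler_wpM2l ?mulr_ge0// -ReZ -bmZE -(linZ (kop_posop N).1).
    apply: posop_le_Re => [|y]; first exact: kop_posop.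
    rewrite bmabsE bmZE (ge0_realE (_ : 0 <= iter j V (bmabs g) y)).
      by rewrite -rmorphM/= lecR; exact: (dominated_iter_le pV c0 qc qU).
    by apply: (posop_iter j pV).2 => z; exact: bmabs_ge0.
  rewrite mulrA -/K.
  have -> : Re (W (bmabs g) x) = Re (W (bmabs g) point) by rewrite /W (Nc _ x point).
  rewrite (le_trans (ler_wpM2l K0 (BD f)))// mulrA ler_wpM2r ?nm_ge0//.
  by rewrite mulrCA ler_piMr ?(ltW ee)// ler_pdivrMr ?mul1r ?lerDl ?ltr_wpDl.
- by rewrite ltr_wpDl.
- move=> n f; have := small_part_iter pS VE c0 qc e0 ecvg qU lam0 hr hlb hS BP n f.
  move=> /le_trans; apply; rewrite ler_wpM2r ?nm_ge0//.
  apply: ler_pM => //; [by rewrite exprn_ge0|by rewrite lerDl|].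
  by rewrite lerXn2r ?nnegrE ?(ltW ca)// ltW.
Qed.

End essential_radius_of_dominated_operators.

(** * Truncating the absolutely continuous part of the kernel *)

Section kernel_splitting.
Context {R : realType} {d} {E : measurableType d}.
Local Notation B := (bmfun R E).
Local Notation B2 := (bmfun R (E * E)%type).
Implicit Types (f g : B) (A : set E).

Lemma lin_diff (V : lmodType R[i]) (T T' : V -> V) :
  (forall (a : R[i]) u v, T (a *: u + v) = a *: T u + T v) ->
  (forall (a : R[i]) u v, T' (a *: u + v) = a *: T' u + T' v) ->
  forall (a : R[i]) u v, T (a *: u + v) - T' (a *: u + v) = a *: (T u - T' u) + (T v - T' v).
Proof. by move=> lT lT' a u v; rewrite lT lT' opprD addrACA scalerBr. Qed.

Lemma posopD (V W : B -> B) : posop V -> posop W -> posop (fun f => V f + W f).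
Proof.
move=> [lV V0] [lW W0]; split=> [a f g|f f0 x].
  by rewrite lV lW scalerDr addrACA.
by rewrite bmDE addr_ge0 ?V0 ?W0.
Qed.

Lemma kopx_posop (Q : R.-fker E ~> E) (q : B2) : (forall z, 0 <= q z) -> posop (kopx Q q).
Proof.
move=> q0; split; first exact: kopx_lin.
move=> f f0 x; rewrite kopx_sec; apply: (kop_posop Q).2 => y.
by rewrite bmmulE bmsecE mulr_ge0.
Qed.

Lemma kopx_bpcont (Q : R.-fker E ~> E) (q : B2) : bpcont (kopx Q q).
Proof.
move=> f_ f ff; have [[M fM] cf] := ff; split.
  have [K K0 QK] := bm_bounded (kop Q (bmcst 1)).
  exists (supnorm q * (M * K)) => n x.
  rewrite (le_trans (kopx_dom Q (f_ n) x (supnorm_ub q)))// ler_wpM2l//.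
    exact: le_trans (Defs.normc_ge0 _) (supnorm_ub q point).
  rewrite (le_trans (ler_norm _))// (le_trans (Re_le_normc _))//.
  rewrite (le_trans (posop_supnorm x (kop_posop Q) (M := M) _))//.
    by move=> y; rewrite bmabsE normc_realC ger0_norm ?Defs.normc_ge0.
  rewrite ler_wpM2l//; first exact: le_trans (Defs.normc_ge0 _) (fM 0%N point).
  by rewrite (le_trans (ler_norm _))// (le_trans (Re_le_normc _)).
move=> x; have [_ /(_ x)] := kop_bpcont Q (bpcvgM (bmsec q x) ff).
by under eq_fun do rewrite -2!kopx_sec.
Qed.

Variables (Q S : R.-fker E ~> E) (l : nat) (nu : probability E R) (alpha : E * E -> R).

#[local] Opaque kop kopx.

Lemma kpowE n x A : measurable A ->
  kpow Q n x A = (Re (iter n (kop Q) (bmind A) x))%:E.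
Proof.
move=> mA; elim: n x => [|n ih] x; first by rewrite /= asboolT.
rewrite iterS kop_Re /= /Rintegral fineK.
  by apply: eq_integral => y _; rewrite ih.
exact: (integrable_fin_num measurableT (Re_integrable Q x _)).
Qed.

(** [nu] as a kernel that ignores its starting point, so that densities against [nu] fit [kopx]. *)
Definition const_kernel : R.-fker E ~> E :=
  kprobability (@measurable_cst _ _ E (pprobability E R) setT (nu : pprobability E R)).

Hypothesis ui : unif_integrable nu alpha.
Hypothesis SE : forall x A, measurable A ->
  S x A = (kpow Q l x A - acker nu alpha x A)%E.

Let alpha0 z : 0 <= alpha z. Proof. by have [] := ui. Qed.

Let malpha : measurable_fun setT alpha. Proof. by have [] := ui. Qed.

Let malphax x : measurable_fun setT (fun y => alpha (x, y)).
Proof. exact: measurableT_comp. Qed.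

Let mset x (m : R) : measurable [set y | m <= alpha (x, y)].
Proof.
rewrite (_ : [set _ | _] = setT `&` (fun y => alpha (x, y)) @^-1` `[m, +oo[%classic).
  by apply: malphax => //; exact: measurable_itv.
by rewrite setTI; apply/seteqP; split=> y /=; rewrite in_itv/= andbT.
Qed.

Let mge x (m : R) : measurable_fun setT (fun y => (m <= alpha (x, y))%R%:R : R).
Proof.
rewrite (_ : (fun _ => _) = \1_[set y | m <= alpha (x, y)]); first exact: measurable_indic.
apply/funext => y; rewrite indicE; congr ((nat_of_bool _)%:R).
by apply/idP/idP => [h|/set_mem//]; exact/mem_set.
Qed.

Let mlt x (m : R) : measurable_fun setT (fun y => (alpha (x, y) < m)%R%:R : R).
Proof.
rewrite (_ : (fun _ => _) = fun y => 1 - (m <= alpha (x, y))%R%:R).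
  exact: (measurable_funB (measurable_cst _) (mge x m)).
by apply/funext => y; case: ltP; rewrite ?subr0 ?subrr.
Qed.

Let tail_small (eps : R) : 0 < eps -> exists m : nat, forall x,
  (\int[nu]_(y in [set y | (m%:R <= alpha (x, y))%R]) (alpha (x, y))%:E <= eps%:E)%E.
Proof.
move=> e0; have [_ _ cv] := ui.
have : nbhs (0%:E : \bar R) [set y : \bar R | (y < eps%:E)%E].
  exact: (@nbhs_open_ereal_lt _ 0 (fun=> eps)).
move=> /cv[m _ /(_ m (leqnn m))/= h]; exists m => x.
rewrite (le_trans _ (ltW h))//; apply: ereal_sup_ubound.
by exists x.
Qed.

Definition truncate (m : R) : E * E -> R[i] :=
  fun z => (alpha z * (alpha z < m)%R%:R)%:C.

Lemma truncate_bmpred (m : R) : 0 <= m -> truncate m \in bmpred.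
Proof.
move=> m0; apply: (@real_bmpred _ _ _ _ m).
  apply: measurable_funM => //.
  rewrite (_ : (fun _ => _) = \1_(alpha @^-1` `]-oo, m[%classic)).
    apply: measurable_indic; rewrite -[X in measurable X]setTI.
    by apply: malpha => //; exact: measurable_itv.
  apply/funext => z; rewrite indicE; congr ((nat_of_bool _)%:R).
  by apply/idP/idP => [h|/set_mem]; [apply/mem_set|]; rewrite /= in_itv.
move=> z; case: ltP => h; rewrite ?mulr1 ?mulr0 ?normr0// ger0_norm//.
exact: ltW.
Qed.

(** The truncation level is chosen after [h]: the tail of [alpha] applied to [h] is at most 1, which
    fits in the slack of [lam h - S h = 1]. *)
Lemma kernel_splitting (lam : R) : spectral_radius (kop S) < lam ->
  exists (beta : B2) (m : R) (S' : B -> B) (h : B),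
  [/\ [/\ posop S', forall f x, iter l (kop Q) f x = S' f x + kopx const_kernel beta f x,
        forall z, 0 <= beta z, 0 <= m & forall z, normc (beta z) <= m],
      0 < lam, forall x, Im (h x) = 0, forall x, lam^-1 <= Re (h x)
    & forall x, Re (S' h x) <= lam * Re (h x)].
Proof.
move=> rl; have l0 : 0 < lam by rewrite (le_lt_trans _ rl)// spectral_radius_ge0.
have [h [hE hr hlb]] := supersolution (kop_posop S) rl.
pose eps := (nm h + 1)^-1.
have nh0 : 0 < nm h + 1 by rewrite ltr_wpDl// nm_ge0.
have [|m tail] := @tail_small eps; first by rewrite invr_gt0.
have m0 : 0 <= m%:R :> R by [].
pose beta : B2 := BMFun (truncate_bmpred m0).
pose V := iter l (kop Q).
have pV : posop V by apply/posop_iter/kop_posop.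
have cV : bpcont V by apply/bpcont_iter/kop_bpcont.
pose K := kopx const_kernel beta.
(* The tail of [alpha]. Its density may be unbounded, so it is introduced as a difference, and its
   positivity is read off on indicators. *)
pose Rm f := V f - K f - kop S f.
have lRm : lin Rm.
  apply: (lin_diff (T := fun f => V f - K f)); last exact: (kop_posop S).1.
  by apply: lin_diff; [exact: pV.1|exact: kopx_lin].
have cRm : bpcont Rm.
  apply: bpcontB; last exact: kop_bpcont.
  by apply: bpcontB => //; exact: kopx_bpcont.
have beta0 z : 0 <= beta z by rewrite /= /truncate realC_ge0 mulr_ge0.
have pK : posop K by exact: kopx_posop.
have KE A x : measurable A -> (Re (K (bmind A) x))%:E =
    (\int[nu]_(y in A) (alpha (x, y) * (alpha (x, y) < m%:R)%R%:R)%:E)%E.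
  move=> mA; rewrite /K kopx_sec kop_Re /Rintegral fineK; last first.
    exact: (integrable_fin_num measurableT (Re_integrable const_kernel x _)).
  rewrite [RHS]integral_mkcond; apply: eq_integral => y _.
  rewrite bmmulE bmindE// bmsecE patchE.
  by case: (y \in A); rewrite ?mul1r// mul0r.
have RmE A x : measurable A -> (Re (Rm (bmind A) x))%:E =
    (\int[nu]_(y in A) (alpha (x, y) * (m%:R <= alpha (x, y))%R%:R)%:E)%E.
  move=> mA; have := SE x mA; rewrite kpowE// -/V.
  have -> : S x A = (Re (kop S (bmind A) x))%:E.
    rewrite kop_ind//= fineK// ge0_fin_numE//.
    by rewrite (le_lt_trans _ (fker_lty S x))// le_measure// inE.
  have -> : acker nu alpha x A = ((Re (K (bmind A) x))%:E +
      \int[nu]_(y in A) (alpha (x, y) * (m%:R <= alpha (x, y))%R%:R)%:E)%E.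
    rewrite KE// -ge0_integralD//.
    - apply: eq_integral => y _; rewrite -EFinD -mulrDr.
      by case: ltP => _; rewrite ?addr0 ?add0r mulr1.
    - by move=> y _; rewrite lee_fin mulr_ge0.
    - by apply/measurable_EFinP; apply: measurable_funTS; exact: measurable_funM.
    - by move=> y _; rewrite lee_fin mulr_ge0.
    - by apply/measurable_EFinP; apply: measurable_funTS; exact: measurable_funM.
  rewrite /Rm !bmBE !ReB; set w := (\int[nu]_(y in A) _)%E.
  (* An infinite tail integral would make the right-hand side of [SE] infinite, while [S x A] is
     finite. *)
  case: w => [w||] //=.
  by move=> [h']; congr EFin; rewrite h'; ring.
have pRm : posop Rm.
  apply: posop_ind => // A x mA; rewrite lecE; apply/andP; split.
    rewrite /Rm !bmBE !ImB.
    by rewrite (Im_ge0 (pV.2 _ (bmind_ge0 A) x)) (Im_ge0 (pK.2 _ (bmind_ge0 A) x))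
      (Im_ge0 ((kop_posop S).2 _ (bmind_ge0 A) x)) !subr0.
  by rewrite -lee_fin RmE//; apply: integral_ge0 => y _; rewrite lee_fin mulr_ge0.
have S'E : (fun f => V f - K f) = fun f => kop S f + Rm f.
  by apply/funext => f; rewrite /Rm [RHS]addrC subrK.
exists beta, m%:R, (fun f => V f - K f), h; split=> //.
  split=> //.
  - by rewrite S'E; apply: posopD => //; exact: kop_posop.
  - by move=> f x; rewrite bmBE subrK.
  - move=> z; rewrite -[beta z]/((alpha z * (alpha z < m%:R)%R%:R)%:C) normc_realC.
    by case: ltP => h'; rewrite ?mulr1 ?mulr0 ?normr0// ger0_norm// ltW.
move=> x; have -> : V h - K h = kop S h + Rm h by rewrite /Rm [RHS]addrC subrK.
rewrite bmDE ReD.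
have -> : Re (kop S h x) = lam * Re (h x) - 1.
  have /(congr1 (fun f : B => Re (f x))) := hE.
  by rewrite bmBE ReB bmZE ReZ bmcstE/= => <-; ring.
suff : Re (Rm h x) <= 1 by lra.
have R1 : Re (Rm (bmcst 1) x) <= eps.
  rewrite -lee_fin -bmind_setT RmE// (le_trans _ (tail x))//.
  rewrite [leRHS]integral_mkcond le_eqVlt; apply/orP; left; apply/eqP.
  apply: eq_integral => y _; rewrite patchE.
  have -> : (y \in [set y | m%:R <= alpha (x, y)]) = (m%:R <= alpha (x, y)).
    by apply/idP/idP => [/set_mem|h']; [|apply/mem_set].
  by case: ifP; rewrite ?mulr1// mulr0.
rewrite (le_trans (ler_norm _))// (le_trans (Re_le_normc _))//.
rewrite (le_trans (posop_supnorm x pRm (supnorm_ub h)))// -nm_bm.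
rewrite (le_trans (ler_wpM2l (nm_ge0 h) R1))//.
by rewrite ler_pdivrMr// mul1r lerDl.
Qed.

End kernel_splitting.

(** * Finite partitions from a sequence of sets *)

Section dyadic_code.
Context {R : realType} {d} {E : measurableType d}.
Local Notation B := (bmfun R E).
Implicit Types (f g : B) (A : set E).
Variable G_ : nat -> set E.
Hypothesis mG : forall n, measurable (G_ n).

(* Indexes the atoms of the algebra generated by G_0, ..., G_{k-1}. *)
Fixpoint code k (y : E) : nat :=
  if k is k'.+1 then ((y \in G_ k') + (code k' y).*2)%N else 0.

Lemma code_lt k y : (code k y < 2 ^ k)%N.
Proof.
elim: k => //= k ih; rewrite expnS mul2n -[X in (X < _)%N]/(_ + _)%N.
by rewrite -ltn_half_double half_bit_double.
Qed.

(** The newest set is the lowest bit, so halving forgets it. *)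
Lemma code_half k n y : (k <= n)%N -> code k y = iter (n - k) half (code n y).
Proof.
move=> /subnK; move: (n - k)%N => j <-.
by elim: j => //= j ih; rewrite -iterS iterSr half_bit_double.
Qed.

Lemma measurable_code k i : measurable [set y | code k y = i].
Proof.
elim: k i => [|k ih] i /=.
  have [->|i0] := eqVneq i 0%N.
    by rewrite (_ : [set _ | _] = setT)//; apply/seteqP; split.
  rewrite (_ : [set _ | _] = set0)//; apply/seteqP; split=> // y /= h.
  by rewrite -h in i0.
rewrite (_ : [set _ | _] =
    (if odd i then G_ k else ~` G_ k) `&` [set y | code k y = i./2]).
  by apply: measurableI => //; case: ifP => _ //; exact: measurableC.
apply/seteqP; split=> y /=.
  move=> <-; rewrite half_bit_double oddD odd_double addbF oddb; split=> //.
  by have [/set_mem//|/negP h] := boolP (y \in G_ k) => /mem_set.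
move=> [yG ci]; rewrite ci -[RHS]odd_double_half; congr (nat_of_bool _ + _)%N.
by case: (odd i) yG => [/mem_set//|h]; apply/negP => /set_mem.
Qed.

Lemma measurable_code_pred k (a : pred nat) : measurable [set y | a (code k y)].
Proof.
rewrite (_ : [set _ | _] = \bigcup_(i in [set i | a i]) [set y | code k y = i]).
  by apply: bigcup_measurable => i _; exact: measurable_code.
by apply/seteqP; split=> y /= => [h|[i /= ai ci]]; [exists (code k y)|rewrite ci].
Qed.

Definition bmcode k (phi : nat -> R[i]) : B :=
  \sum_(i < 2 ^ k) phi i *: bmind [set y | code k y = i].

Lemma bmcodeE k phi y : bmcode k phi y = phi (code k y).
Proof.
rewrite bm_sumE (bigD1 (Ordinal (code_lt k y)))// big1 ?addr0.
  have h : bmind [set y' | code k y' = code k y] y = 1 :> R[i].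
    by rewrite bmindE ?mem_set//; exact: measurable_code.
  by rewrite -[LHS]/(_ + 0) addr0 bmZE h mulr1.
move=> i /andP[_ ni]; rewrite bmZE bmindE; last exact: measurable_code.
rewrite (_ : _ \in _ = false) ?mulr0//; apply/negP => /set_mem/= ci.
by move/eqP: ni; apply; apply: val_inj; rewrite /= ci.
Qed.

Definition code_sets := [set A | exists k (a : pred nat), A = [set y | a (code k y)]].

Lemma bmind_code_set k (a : pred nat) :
  bmind [set y | a (code k y)] = bmcode k (fun i => (a i)%:R).
Proof.
apply: bm_ext => y; rewrite bmindE ?bmcodeE; last exact: measurable_code_pred.
congr (nat_of_bool _)%:R.
by apply/idP/idP => [/set_mem//|h]; exact/mem_set.
Qed.

Lemma code_sets_setI : setI_closed code_sets.
Proof.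
move=> _ _ [k [a ->]] [k' [a' ->]].
exists (maxn k k'), (fun i => a (iter (maxn k k' - k) half i) &&
  a' (iter (maxn k k' - k') half i)).
apply/seteqP; split=> y /=; rewrite -!code_half ?leq_maxl ?leq_maxr//.
  by move=> [-> ->].
by move=> /andP.
Qed.

Lemma code_sets_generate : measurable = <<s range G_ >> ->
  @measurable _ E = <<s code_sets >>.
Proof.
move=> mE; apply/seteqP; split.
  rewrite mE; apply: smallest_sub; first exact: smallest_sigma_algebra.
  move=> _ [n _ <-]; apply: sub_gen_smallest; exists n.+1, odd.
  apply/seteqP; split=> y /=; rewrite oddD odd_double addbF oddb.
    exact: mem_set.
  exact: set_mem.
apply: smallest_sub; first exact: sigma_algebra_measurable.
move=> _ [k [a ->]].
exact: measurable_code_pred.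
Qed.

End dyadic_code.

Lemma countably_generated_seq d (E : measurableType d) : countably_generated E ->
  exists G_ : nat -> set E, measurable = <<s range G_ >>.
Proof.
move=> [G /pcard_injP[f fi] GE].
(* Values [n] not attained on [G] give the empty set; this also covers an empty [G]. *)
exists (fun n => [set y | exists2 A, G A & f A = n /\ A y]).
have GA A : G A -> [set y | exists2 A', G A' & f A' = f A /\ A' y] = A.
  move=> GA; apply/seteqP; split=> y /= => [[A' GA' [ff A'y]]|Ay].
    by rewrite -(fi A' A)// inE.
  by exists A.
rewrite GE; apply/seteqP; split.
  apply: smallest_sub; first exact: smallest_sigma_algebra.
  move=> A AG; apply: sub_gen_smallest; exists (f A) => //; exact: GA.
apply: smallest_sub; first exact: smallest_sigma_algebra.
move=> _ [n _ <-].
have [[A AG <-]|nA] := pselect (exists2 A, G A & f A = n).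
  by rewrite GA//; exact: sub_gen_smallest.
rewrite (_ : [set _ | _] = set0); first exact: sigma_algebra0.
by apply/seteqP; split=> // y /= [A GA' [fA _]]; apply: nA; exists A.
Qed.

Lemma mul_conj_normc (R : realType) (z : R[i]) : z * conjc z = (normc z ^+ 2)%:C.
Proof.
case: z => a b /=; rewrite sqr_sqrtr ?addr_ge0 ?sqr_ge0//.
by apply: complex_ext => /=; ring.
Qed.

(** * Martingale approximation of the density of [U] with respect to [V] *)

Section relative_density.
Context {R : realType} {d} {E : measurableType d}.
Local Notation B := (bmfun R E).
Local Notation B2 := (bmfun R (E * E)%type).
Implicit Types (f g : B) (A : set E).
Variables (V U : B -> B) (c : R) (G_ : nat -> set E).
Hypotheses (pV : posop V) (cV : bpcont V) (lU : lin U) (c0 : 0 <= c).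
Hypothesis UV : forall f x, normc (U f x) <= c * Re (V (bmabs f) x).
Hypothesis mG : measurable = <<s range G_ >>.

Let mGn n : measurable (G_ n).
Proof. by rewrite mG; apply: sub_gen_smallest; exists n. Qed.

Let C k i := [set y | code G_ k y = i].
Let ind k i : B := bmind (C k i).

(* [powR 0 (-1) = 0]: the ratio is 0 where the denominator vanishes. *)
Let ratio_fun k i x : R[i] := U (ind k i) x * ((Re (V (ind k i) x)) `^ (-1))%:C.

Let V_ind_ge0 k i x : 0 <= Re (V (ind k i) x).
Proof. by apply/ge0_Re/pV.2 => y; exact: bmind_ge0. Qed.

Let bmabs_ind k i : bmabs (ind k i) = ind k i.
Proof.
by apply: bm_ext => y; rewrite bmabsE ge0_normc ?bmind_ge0// -ge0_realE// bmind_ge0.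
Qed.

Let ratio_fun_le k i x : normc (ratio_fun k i x) <= c.
Proof.
rewrite normcM normc_realC ger0_norm ?powR_ge0// powR_inv1//.
have [v0|v0] := eqVneq (Re (V (ind k i) x)) 0; first by rewrite v0 invr0 mulr0.
rewrite ler_pdivrMr; first by rewrite -{2}bmabs_ind.
by rewrite lt_neqAle eq_sym v0 V_ind_ge0.
Qed.

Let ratio_subproof k i : (ratio_fun k i : E -> R[i]^o) \in bmpred.
Proof.
apply/bmpredP; split; last by exists c => x; exact: ratio_fun_le.
apply: cmeasurableM; first exact: bm_cmeas.
split; last exact: measurable_cst.
apply: (measurableT_comp (measurable_powR (-1))).
exact: (bm_cmeas (V (ind k i))).1.
Qed.

Let ratio k i : B := BMFun (ratio_subproof k i).

Let ratio_le k i x : normc (ratio k i x) <= c. Proof. exact: ratio_fun_le. Qed.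

(** Where the denominator vanishes, the domination [UV] forces the numerator to vanish too. *)
Let ratioE k i x : ratio k i x * V (ind k i) x = U (ind k i) x.
Proof.
rewrite -[ratio k i x]/(ratio_fun k i x) /ratio_fun powR_inv1//.
have pv : 0 <= V (ind k i) x by apply: pV.2 => y; exact: bmind_ge0.
rewrite {2}(ge0_realE pv) -mulrA -rmorphM/=.
have [v0|v0] := eqVneq (Re (V (ind k i) x)) 0; last by rewrite mulVf// mulr1.
rewrite v0 mulr0 mulr0; apply/esym/eq0_normc/eqP; rewrite eq_le Defs.normc_ge0 andbT.
by rewrite (le_trans (UV _ _))// bmabs_ind v0 mulr0.
Qed.

Definition density_approx k : B2 := \sum_(i < 2 ^ k) bmtens (ratio k i) (ind k i).

Lemma density_approx_sec k x :
  bmsec (density_approx k) x = bmcode G_ k (fun i => ratio k i x).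
Proof.
apply: bm_ext => y; rewrite bmsecE !bm_sumE; apply: eq_bigr => i _.
by rewrite bmtensE bmZE.
Qed.

Lemma density_approx_le k z : normc (density_approx k z) <= c.
Proof.
case: z => x y; rewrite -bmsecE density_approx_sec bmcodeE//.
Qed.

Let bmmul_code k phi psi : bmmul (bmcode G_ k phi) (bmcode G_ k psi) =
  bmcode G_ k (fun i => phi i * psi i) :> B.
Proof. by apply: bm_ext => y; rewrite bmmulE !bmcodeE. Qed.

Let bmcode_refine k n phi : (k <= n)%N ->
  bmcode G_ k phi = bmcode G_ n (phi \o iter (n - k) half) :> B.
Proof. by move=> kn; apply: bm_ext => y; rewrite !bmcodeE//= -code_half. Qed.

(** The martingale property: functions of level [k] are integrated exactly by every later
    approximation. *)
Let density_approx_code k n phi x : (k <= n)%N ->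
  V (bmmul (bmcode G_ k phi) (bmsec (density_approx n) x)) x = U (bmcode G_ k phi) x.
Proof.
move=> kn; rewrite (bmcode_refine phi kn) density_approx_sec bmmul_code.
rewrite (lin_sum pV.1) (lin_sum lU) !bm_sumE; apply: eq_bigr => i _.
by rewrite (linZ pV.1) (linZ lU) !bmZE -mulrA ratioE.
Qed.

Let conj_subproof f : (fun x => conjc (f x)) \in bmpred.
Proof.
have [mr mi] := bm_cmeas f; apply/bmpredP; split.
  by split; [rewrite (_ : (fun _ => _) = fun x => Re (f x)) //|
     rewrite (_ : (fun _ => _) = fun x => - Im (f x)); last by (apply/funext => x; case: (f x))];
   [apply/funext => x; case: (f x)|exact: measurable_funN].
exists (supnorm f) => x; rewrite (le_trans _ (supnorm_ub f x))//.
by case: (f x) => a b; rewrite /= sqrrN.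
Qed.

Let bmconj f : B := BMFun (conj_subproof f).

Let bmmul_conj_ge0 g y : 0 <= bmmul g (bmconj g) y.
Proof. by rewrite bmmulE mul_conj_normc realC_ge0 exprn_ge0// Defs.normc_ge0. Qed.

Let p k x := bmsec (density_approx k) x.

(** The squared norm of [p k x] in [L^2] of the measure [V (x, .)]; this expanded form is visibly
    measurable in [x]. *)
Let energy_bm k : B :=
  \sum_(i < 2 ^ k) bmmul (bmmul (ratio k i) (bmconj (ratio k i))) (V (ind k i)).
Let energy k x : R := Re (energy_bm k x).

Let p_conj k x : bmconj (p k x) = bmcode G_ k (fun i => conjc (ratio k i x)).
Proof.
apply: bm_ext => y; rewrite /p density_approx_sec bmcodeE//.
by rewrite -[LHS]/(conjc (bmcode G_ k _ y)) bmcodeE.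
Qed.

Let energyE k x : energy k x = Re (V (bmmul (p k x) (bmconj (p k x))) x).
Proof.
rewrite p_conj /p density_approx_sec bmmul_code (lin_sum pV.1) /energy /energy_bm.
congr Re; rewrite !bm_sumE; apply: eq_bigr => i _.
by rewrite (linZ pV.1) bmZE !bmmulE.
Qed.

Let posop_Re_eq f g x : (forall y, Re (f y) = Re (g y)) -> Re (V f x) = Re (V g x).
Proof.
move=> fg; rewrite posop_Re// [RHS]posop_Re//; congr (Re (V _ x)).
by apply: bm_ext => y; rewrite !bmreE fg.
Qed.

(* Pythagoras for the martingale p_k in L^2 of the measure V(x, .). *)
Let energy_incr k n x : (k <= n)%N ->
  Re (V (bmmul (p n x - p k x) (bmconj (p n x - p k x))) x) = energy n x - energy k x.
Proof.
move=> kn.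
(* The conjugate of [p k x] has level [k], so its pairing with any later [p m x] is the value of [U]
   on it. *)
have cross m : (k <= m)%N -> Re (V (bmmul (bmconj (p k x)) (p m x)) x) = energy k x.
  move=> km; rewrite p_conj density_approx_code// -(density_approx_code (n := k))//.
  rewrite energyE p_conj; congr (Re (V _ x)); apply: bm_ext => y.
  by rewrite !bmmulE mulrC.
(* Only real parts agree: the two conjugate cross terms are merged into twice one of them. *)
rewrite (posop_Re_eq (g := (bmmul (p n x) (bmconj (p n x)) +
    bmmul (bmconj (p k x)) (p k x)) - 2%:C *: bmmul (bmconj (p k x)) (p n x))).
  rewrite (linB pV.1) (linD pV.1) (linZ pV.1) bmBE bmDE bmZE ReB ReD ReZ -energyE.
  by rewrite !cross//; ring.
move=> y; rewrite !(bmBE, bmDE, bmZE) !bmmulE ReB ReD ReZ.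
set a := p n x; set b := p k x.
rewrite -[bmconj (a - b) y]/(conjc (a y - b y)) -[bmconj a y]/(conjc (a y)).
rewrite -[bmconj b y]/(conjc (b y)) bmBE.
by case: (a y) => a1 a2; case: (b y) => b1 b2 /=; ring.
Qed.

Let V1 x := Re (V (bmcst 1) x).

Let V1_ge0 x : 0 <= V1 x.
Proof. by apply/ge0_Re/pV.2 => y; rewrite bmcstE ler01. Qed.

Let energy_le k x : energy k x <= c ^+ 2 * V1 x.
Proof.
rewrite energyE /V1 -ReZ -bmZE -(linZ pV.1); apply: posop_le_Re => // y.
rewrite bmmulE mul_conj_normc bmZE mulr1 lecR lerXn2r ?nnegrE ?Defs.normc_ge0//.
exact: density_approx_le.
Qed.

Let energy_nd x : nondecreasing_seq (energy ^~ x).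
Proof.
move=> k n kn; rewrite -subr_ge0 -energy_incr//.
by apply/ge0_Re/pV.2 => y; exact: bmmul_conj_ge0.
Qed.

Let energy_lim x : R := lim (energy ^~ x @ \oo).

Let energy_cvg x : energy ^~ x @ \oo --> energy_lim x.
Proof.
apply: nondecreasing_is_cvgn; first exact: energy_nd.
by exists (c ^+ 2 * V1 x) => _ [k _ <-]; exact: energy_le.
Qed.

Let energy_le_lim k x : energy k x <= energy_lim x.
Proof. by apply: nondecreasing_cvgn_le; [exact: energy_nd|exact: energy_cvg]. Qed.

(** The Cauchy-Schwarz bound for the [L^1] distance from [p k x] to all later terms, with [V1 x + 1]
    in place of the total mass [V1 x]. *)
Let err_fun k x : R := Num.sqrt ((energy_lim x - energy k x) * (V1 x + 1)).

Let err_subproof k : (fun x => (err_fun k x)%:C) \in bmpred.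
Proof.
have [K K0 VK] := bm_bounded (V (bmcst 1)).
have V1K x : V1 x <= K by rewrite (le_trans (ler_norm _))// (le_trans (Re_le_normc _)).
apply: (@real_bmpred _ _ _ _ (Num.sqrt (c ^+ 2 * K * (K + 1)))).
  apply: (@measurableT_comp _ _ _ _ _ _ (@Num.sqrt R)).
    exact: (continuous_measurable_fun (@sqrt_continuous R)).
  apply: measurable_funM; last first.
    by apply: measurable_funD => //; exact: (bm_cmeas (V (bmcst 1))).1.
  apply: measurable_funB; last exact: (bm_cmeas (energy_bm k)).1.
  apply: (@measurable_fun_cvg _ _ _ _ energy) => //.
  by move=> n; exact: (bm_cmeas (energy_bm n)).1.
move=> x; rewrite ger0_norm ?sqrtr_ge0// ler_wsqrtr// ler_pM//.
- by rewrite subr_ge0.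
- by rewrite addr_ge0.
- have : energy_lim x <= c ^+ 2 * V1 x.
    by apply: limr_le; [exact: energy_cvg|exact: nearW].
  have : 0 <= energy k x.
    by rewrite energyE; apply/ge0_Re/pV.2 => y; exact: bmmul_conj_ge0.
  have := ler_wpM2l (exprn_ge0 2 c0) (V1K x); lra.
- by rewrite lerD2r.
Qed.

Let err k : B := BMFun (err_subproof k).

(** Cauchy-Schwarz from positivity alone: apply [V] to [2 s |g| <= s^2 + |g|^2] and take
    [s = w / (V1 x + 1)]; the added 1 avoids a zero denominator. *)
Let L1_le_L2 g x : Re (V (bmabs g) x) ^+ 2 <= Re (V (bmmul g (bmconj g)) x) * (V1 x + 1).
Proof.
set w := Re (V (bmabs g) x); set D := Re _.
have amgm s : 2 * s * w <= s ^+ 2 * V1 x + D.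
  rewrite /V1 /w /D -!ReZ -ReD -!bmZE -!(linZ pV.1) -bmDE -(linD pV.1).
  apply: posop_le_Re => // y; rewrite bmDE !bmZE bmcstE mulr1 bmabsE bmmulE mul_conj_normc.
  rewrite -rmorphM -rmorphD/= lecR; have := sqr_ge0 (s - normc (g y)); lra.
have v1 : 0 < V1 x + 1 by rewrite ltr_wpDl.
have := amgm (w / (V1 x + 1)); set t := V1 x + 1 in v1 *; set q := w / t.
have -> : V1 x = t - 1 by rewrite /t addrK.
have -> : w = q * t by rewrite /q divfK// gt_eqF.
move=> h; have h' : q ^+ 2 * t + q ^+ 2 <= D by have := h; lra.
rewrite exprMn expr2 mulrA; rewrite (le_trans _ (ler_wpM2r (ltW v1) h'))//.
by rewrite mulrDl lerDl mulr_ge0 ?sqr_ge0// ltW.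
Qed.

Lemma density_approx_cauchy x n k : (k <= n)%N ->
  Re (V (bmsec (bmabs (density_approx n - density_approx k)) x) x) <= Re (err k x).
Proof.
move=> kn; rewrite -[Re (err k x)]/(err_fun k x).
have -> : bmsec (bmabs (density_approx n - density_approx k)) x = bmabs (p n x - p k x).
  by apply: bm_ext => y; rewrite bmsecE !bmabsE !bmBE !bmsecE.
rewrite -[leLHS]ger0_norm ?posop_abs_ge0// -sqrtr_sqr ler_wsqrtr//.
rewrite (le_trans (L1_le_L2 _ _))// energy_incr// ler_wpM2r//.
  by rewrite addr_ge0.
by rewrite lerD2r energy_le_lim.
Qed.

Lemma err_cvg : bpcvg err 0.
Proof.
have [K K0 VK] := bm_bounded (V (bmcst 1)).
split.
  have [M M0 eM] := bm_bounded (err 0); exists M => n x.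
  rewrite (le_trans _ (eM x))// -[err n x]/((err_fun n x)%:C) -[err 0 x]/((err_fun 0 x)%:C).
  rewrite !normc_realC !ger0_norm ?sqrtr_ge0// ler_wsqrtr// ler_wpM2r ?addr_ge0//.
  by rewrite lerD2l lerN2; apply: energy_nd.
move=> x; rewrite [X in X @ _ --> _](_ : _ = fun n =>
    Num.sqrt ((energy_lim x - energy n x) * (V1 x + 1))); last first.
  apply/funext => n; rewrite bm0E subr0 -[err n x]/((err_fun n x)%:C).
  by rewrite normc_realC ger0_norm ?sqrtr_ge0.
rewrite -[X in _ --> X]sqrtr0; apply: continuous_cvg; first exact: sqrt_continuous.
rewrite -[X in _ --> X](mul0r (V1 x + 1)) -(subrr (energy_lim x)).
apply: cvgM; last exact: cvg_cst.
by apply: cvgB; [exact: cvg_cst|exact: energy_cvg].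
Qed.

Lemma density_approx_lim f x :
  (fun n => normc (V (bmmul f (bmsec (density_approx n) x)) x - U f x)) @ \oo --> (0 : R).
Proof.
pose P f := (fun n => normc (V (bmmul f (bmsec (density_approx n) x)) x - U f x)) @ \oo
  --> (0 : R).
have Pcode k phi : P (bmcode G_ k phi).
  apply: cvg_near_cst; exists k => // n kn.
  by rewrite density_approx_code// subrr normc0.
have Vq n g : normc (V (bmmul g (bmsec (density_approx n) x)) x) <= c * Re (V (bmabs g) x).
  rewrite -ReZ -bmZE -(linZ pV.1); apply: posop_dom => // y.
  rewrite bmZE bmmulE normcM bmabsE -rmorphM/= lecR mulrC.
  by rewrite ler_wpM2r ?Defs.normc_ge0// density_approx_le.
apply: (@bmfun_ind _ _ _ (code_sets G_) P) => {f}.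
- exact: code_sets_generate.
- exact: code_sets_setI.
- rewrite (_ : bmcst 1 = bmcode G_ 0 (fun=> 1)); first exact: Pcode.
  by apply: bm_ext => y; rewrite bmcodeE.
- by move=> _ [k [a ->]]; rewrite bmind_code_set//; exact: Pcode.
- move=> a f g Pf Pg; apply: cvg0_le (cvg0D (cvg0Ml (normc a) Pf) Pg) => n.
  rewrite Defs.normc_ge0 andTb bmmul_linl pV.1 lU !bmDE !bmZE opprD addrACA -mulrBr.
  by rewrite (le_trans (le_normcD _ _))// normcM.
- move=> f_ f ff Pf.
  have [_ /(_ x) Vf] := cV (bpcvg_abs ff).
  apply/cvgrPdist_le => /= e e0.
  (* [m] is fixed before [n]: replacing [f] by [f_ m] then costs less than [e / 4] in [U] and,
     uniformly in [n], in the approximations; convergence for [f_ m] uses the remaining [e / 2]. *)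
  have [m Vm] : exists m, c * Re (V (bmabs (f_ m - f)) x) < e / 4.
    apply: cvg0_lt; last by rewrite divr_gt0.
    apply: cvg0Ml; apply: cvg0_le Vf => n; rewrite posop_abs_ge0// andTb.
    by rewrite (lin0 pV.1) bm0E subr0 (le_trans (ler_norm _))// Re_le_normc.
  have /cvgrPdist_le/(_ _ (divr_gt0 e0 (ltr0n _ 2)))[n0 _ Pn] := Pf m.
  exists n0 => // n /= /Pn/=; rewrite !sub0r !normrN !ger0_norm ?Defs.normc_ge0// => h.
  have -> : V (bmmul f (bmsec (density_approx n) x)) x - U f x =
      (V (bmmul (f_ m) (bmsec (density_approx n) x)) x - U (f_ m) x) +
      (U (f_ m - f) x - V (bmmul (f_ m - f) (bmsec (density_approx n) x)) x).
    have -> : bmmul (f_ m - f) (bmsec (density_approx n) x) =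
        bmmul (f_ m) (bmsec (density_approx n) x) - bmmul f (bmsec (density_approx n) x).
      by apply: bm_ext => y; rewrite bmBE !bmmulE bmBE mulrBl.
    rewrite (linB lU) (linB pV.1) !bmBE; ring.
  rewrite (le_trans (le_normcD _ _))// (le_trans (lerD h (le_normcD _ _)))// normcN.
  have := UV (f_ m - f) x; have := Vq n (f_ m - f); lra.
Qed.

Lemma relative_density_exists : exists (q_ : nat -> B2) (e_ : nat -> B),
  [/\ forall n z, normc (q_ n z) <= c,
      forall n x, 0 <= e_ n x,
      bpcvg e_ 0,
      forall x n k, (k <= n)%N ->
        Re (V (bmsec (bmabs (q_ n - q_ k)) x) x) <= Re (e_ k x)
    & forall f x,
        (fun n => normc (V (bmmul f (bmsec (q_ n) x)) x - U f x)) @ \oo --> (0 : R)].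
Proof.
exists density_approx, err; split.
- exact: density_approx_le.
- by move=> n x; rewrite -[err n x]/((err_fun n x)%:C) realC_ge0 sqrtr_ge0.
- exact: err_cvg.
- exact: density_approx_cauchy.
- exact: density_approx_lim.
Qed.

End relative_density.

(** * The bounds for [Q] and for [Q_chi] *)

Section kernels_dominating_an_absolutely_continuous_part.
Context {R : realType} {d} {E : measurableType d}.
Local Notation B := (bmfun R E).
Local Notation B2 := (bmfun R (E * E)%type).
Implicit Types (f g : B).
Variables (Q S : R.-fker E ~> E) (l : nat) (nu : probability E R) (alpha : E * E -> R).
Hypotheses (l0 : (0 < l)%N) (ui : unif_integrable nu alpha).
Hypothesis SE : forall x A, measurable A ->
  S x A = (kpow Q l x A - acker nu alpha x A)%E.

#[local] Opaque kop kopx.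

Let V : B -> B := iter l (kop Q).

Let pV : posop V. Proof. exact: posop_iter (kop_posop Q). Qed.

Let cV : bpcont V. Proof. exact: bpcont_iter (@kop_bpcont _ _ _ Q). Qed.

Lemma ess_spectral_radius_kernel_le (T : B -> B) (b : R) (q_ : nat -> B2) (e_ : nat -> B) :
  bdlin T -> 0 <= b ->
  (forall n z, normc (q_ n z) <= b ^+ l) ->
  (forall n x, 0 <= e_ n x) -> bpcvg e_ 0 ->
  (forall x n k, (k <= n)%N ->
    Re (V (bmsec (bmabs (q_ n - q_ k)) x) x) <= Re (e_ k x)) ->
  (forall f x, (fun n => normc (V (bmmul f (bmsec (q_ n) x)) x - iter l T f x)) @ \oo
    --> (0 : R)) ->
  ess_spectral_radius T <= b * spectral_radius (kop S) `^ (l%:R^-1).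
Proof.
move=> bT b0 qb e0 ecvg qe qU; set s := spectral_radius (kop S).
have s0 : 0 <= s by exact: spectral_radius_ge0.
set v := b * s `^ (l%:R^-1); have v0 : 0 <= v by rewrite mulr_ge0// powR_ge0.
have vl : v ^+ l = b ^+ l * s.
  rewrite exprMn -[(s `^ _) ^+ l]powR_mulrn ?powR_ge0// -powRrM mulVf ?powRr1//.
  by rewrite pnatr_eq0 -lt0n.
apply/ler_addgt0Pr => eps eps0; pose rho1 := v + eps / 2.
have e2 : 0 < eps / 2 by rewrite divr_gt0.
have vrho : b ^+ l * s < rho1 ^+ l.
  rewrite -vl ltrXn2r ?nnegrE ?gtn_eqF// ?addr_ge0 ?(ltW e2)//.
  by rewrite ltrDl.
have bl0 : 0 <= b ^+ l by rewrite exprn_ge0.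
(* Chosen so that [b ^+ l * (s + delta) < rho1 ^+ l]; the added 1 covers [b = 0]. *)
pose delta := (rho1 ^+ l - b ^+ l * s) / (b ^+ l + 1).
have delta0 : 0 < delta by rewrite divr_gt0 ?subr_gt0 ?ltr_wpDl.
have [|beta [m [S' [h [[pS' VE beta0 m0 bm] lam0 hr hlb hS]]]]] :=
  kernel_splitting ui SE (lam := s + delta); first by rewrite ltrDl.
apply: (ess_spectral_radius_dominated (N := const_kernel nu) (beta := beta) (V := V)
  (S := S') (U := iter l T) (h := h) (lam := s + delta) (c := b ^+ l) (m := m)
  (q_ := q_) (e_ := e_) (l := l) (rho1 := rho1)) => //.
- by apply: lin_iter; exact: bT.1.
- rewrite mulrDr -ltrBrDl /delta mulrA ltr_pdivrMr ?ltr_wpDl// mulrC.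
  by rewrite ltr_pM2l ?subr_gt0// ltrDl.
- by rewrite ltr_wpDl.
- by rewrite /rho1 ltrD2l; lra.
Qed.

Lemma ess_spectral_radius_kernel_le_const (T : B -> B) (b : R) (q : B2) :
  bdlin T -> 0 <= b -> (forall z, normc (q z) <= b ^+ l) ->
  (forall f x, iter l T f x = V (bmmul f (bmsec q x)) x) ->
  ess_spectral_radius T <= b * spectral_radius (kop S) `^ (l%:R^-1).
Proof.
move=> bT b0 qb TE.
apply: (@ess_spectral_radius_kernel_le T b (fun=> q) (fun=> 0)) => //.
- split; first by exists 0 => n x; rewrite bm0E normc0.
  by move=> x; apply: cvg_near_cst; apply: nearW => n; rewrite subrr normc0.
- move=> x n k _; rewrite subrr (_ : bmsec _ x = 0) ?(lin0 pV.1)//.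
  by apply: bm_ext => y; rewrite bmsecE bmabsE !bm0E normc0.
- move=> f x; apply: cvg_near_cst; apply: nearW => n.
  by rewrite TE subrr normc0.
Qed.

Lemma kopx_bdlin q : bdlin (kopx Q q).
Proof.
have [M M0 QM] := bdlin_ub (posop_bdlin (kop_posop Q)).
split; first exact: kopx_lin.
exists (supnorm q * M) => f; rewrite !nm_bm; apply: supnorm_le => x.
rewrite (le_trans (kopx_dom Q f x (supnorm_ub q)))// -mulrA ler_wpM2l//.
  exact: le_trans (Defs.normc_ge0 _) (supnorm_ub q point).
rewrite (le_trans (ler_norm _))// (le_trans (Re_le_normc _))//.
rewrite (le_trans (supnorm_ub _ x))// -nm_bm (le_trans (QM _))//.
apply: ler_wpM2l; [exact: ltW|rewrite nm_bm; apply: supnorm_le] => y.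
rewrite bmabsE normc_realC ger0_norm ?Defs.normc_ge0//.
exact: supnorm_ub.
Qed.

Lemma iter_kopx_dom q n f x :
  normc (iter n (kopx Q q) f x) <= supnorm q ^+ n * Re (iter n (kop Q) (bmabs f) x).
Proof.
have sq0 : 0 <= supnorm q by exact: le_trans (Defs.normc_ge0 _) (supnorm_ub q point).
elim: n x => [|n ih] x; first by rewrite expr0 mul1r bmabsE.
rewrite !iterS (le_trans (kopx_dom Q _ x (supnorm_ub q)))// exprS -mulrA ler_wpM2l//.
rewrite -ReZ -bmZE -(linZ (kop_posop Q).1); apply: posop_le_Re; first exact: kop_posop.
move=> y; rewrite bmabsE bmZE (ge0_realE (_ : 0 <= iter n (kop Q) (bmabs f) y)).
  by rewrite -rmorphM/= lecR.
by apply: (posop_iter n (kop_posop Q)).2 => z; exact: bmabs_ge0.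
Qed.

Lemma ess_spectral_radius_kop_le :
  ess_spectral_radius (kop Q) <= spectral_radius (kop S) `^ (l%:R^-1).
Proof.
rewrite -[leRHS]mul1r.
apply: (@ess_spectral_radius_kernel_le_const _ _ (bmcst 1)) => //.
- exact: posop_bdlin (kop_posop Q).
- by move=> z; rewrite bmcstE normc1 expr1n.
- move=> f x; congr (V _ x); apply: bm_ext => y.
  by rewrite bmmulE bmsecE bmcstE mulr1.
Qed.

(** For [l = 1] the density relative to [Q] is [chi] itself. For a general power it is not given by
    a formula, and the martingale supplies it from the domination with constant
    [supnorm chi ^+ l]. *)
Lemma ess_spectral_radius_kopx_le (chi : B2) : l = 1%N \/ countably_generated E ->
  ess_spectral_radius (kopx Q chi) <=
    supnorm chi * spectral_radius (kop S) `^ (l%:R^-1).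
Proof.
have c0 : 0 <= supnorm chi by exact: le_trans (Defs.normc_ge0 _) (supnorm_ub chi point).
move=> [l1|/countably_generated_seq[G_ mG]].
  apply: (@ess_spectral_radius_kernel_le_const _ _ chi) => //.
  - exact: kopx_bdlin.
  - by move=> z; rewrite l1 expr1 supnorm_ub.
  - by move=> f x; rewrite /V l1 /= kopx_sec.
have [q_ [e_ [qb e0 ecvg qe qU]]] := relative_density_exists pV cV
  (lin_iter l (kopx_lin Q chi)) (exprn_ge0 l c0) (iter_kopx_dom chi l) mG.
apply: (@ess_spectral_radius_kernel_le _ _ q_ e_) => //.
exact: kopx_bdlin.
Qed.

End kernels_dominating_an_absolutely_continuous_part.

Theorem mainTheorem1 (R : realType) (d : measure_display) (E : measurableType d)
    (Q : R.-fker E ~> E) (l : nat) (nu : probability E R) (alpha : E * E -> R)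
    (S : R.-fker E ~> E) :
  (1 <= l)%N ->
  unif_integrable nu alpha ->
  (forall (x : E) (A : set E), measurable A ->
     S x A = (kpow Q l x A - acker nu alpha x A)%E) ->
  spectral_radius (kop S) `^ (l%:R^-1) < spectral_radius (kop Q) ->
  (quasi_compact (kop Q) /\
   ess_spectral_radius (kop Q) <= spectral_radius (kop S) `^ (l%:R^-1)) /\
  (l = 1%N \/ countably_generated E ->
   forall chi : bmfun R (E * E)%type,
     supnorm chi * spectral_radius (kop S) `^ (l%:R^-1)
       < spectral_radius (kopx Q chi) ->
     quasi_compact (kopx Q chi) /\
     ess_spectral_radius (kopx Q chi)
       <= supnorm chi * spectral_radius (kop S) `^ (l%:R^-1)).
Proof.
move=> l0 ui SE sQ.
have eQ := ess_spectral_radius_kop_le l0 ui SE.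
split; first by split=> //; exact: le_lt_trans eQ sQ.
move=> lE chi schi; have echi := ess_spectral_radius_kopx_le l0 ui SE chi lE.
by split=> //; exact: le_lt_trans echi schi.
Qed.
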